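(* Let $\mu$ be one of the thirty-seven $\mathbf{Z}$-valued measures on the class $\mathfrak{P}$ of permutations (i.e. any $\mathbf{Z}$-valued measure on $\mathfrak{P}$), let $\mathfrak{P}'$ be the support of $\mu$, and let $\mu'$ be the restriction of $\mu$ to $\mathfrak{P}'$. Let $k$ be a field, and regard $\mu$ and $\mu'$ as $k$-valued. Then: (a) The category $\underline{\mathrm{Perm}}_k(\mathfrak{P}';\mu')^{\mathrm{kar}}$ is a semi-simple pre-Tannakian category. (b) Nilpotent endomorphisms in $\underline{\mathrm{Perm}}_k(\mathfrak{P};\mu)$ have categorical trace $0$. (c) The semi-simplification of $\underline{\mathrm{Perm}}_k(\mathfrak{P};\mu)^{\mathrm{kar}}$ is $\underline{\mathrm{Perm}}_k(\mathfrak{P}';\mu')^{\mathrm{kar}}$.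
   Context: A permutation is a finite (possibly empty) set equipped with two total orders $<$ and $\prec$. An embedding is an injective map preserving both orders. $\mathfrak{P}$ is the class of all permutations. Let $\mathfrak{F}$ be a class of permutations closed under isomorphism and passing to substructures, containing the empty permutation. Given embeddings $i\colon Y\to X$ and $j\colon Y\to Y'$ in $\mathfrak{F}$, an amalgamation is a member $X'$ of $\mathfrak{F}$ with embeddings $i'\colon Y'\to X'$ and $j'\colon X\to X'$ that agree on $Y$ and are jointly surjective, taken up to isomorphism compatible with $i',j'$. ''An amalgamation of $X$ and $Y$'' means one over the empty permutation. $\mathfrak{F}$ is a Fraïssé class if in addition amalgamations in $\mathfrak{F}$ always exist. A measure on $\mathfrak{F}$ valued in a commutative ring $k$ is a rule $\mu$ assigning to each embedding $i$ in $\mathfrak{F}$ a value $\mu(i)\in k$ such that: (i) $\mu(i)=1$ if $i$ is an isomorphism; (ii) $\mu(j\circ i)=\mu(j)\mu(i)$ when defined; (iii) for embeddings $i\colon Y\to X$ and $j\colon Y\to Y'$ with amalgamations $(X'_\alpha,i'_\alpha,j'_\alpha)$, $1\le\alpha\le n$, one has $\mu(i)=\sum_\alpha\mu(i'_\alpha)$. There are exactly thirty-seven $\mathbf{Z}$-valued measures on $\mathfrak{P}$. The support of a $\mathbf{Z}$-valued measure $\mu$ on $\mathfrak{P}$ is the class $\mathfrak{P}'$ of permutations $X$ with $\mu(\emptyset\subset X)\ne 0$. It is a Fraïssé class, and the restriction $\mu'$ of $\mu$ to embeddings between members of $\mathfrak{P}'$ is a measure on $\mathfrak{P}'$. Let $\mathfrak{F}$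 be a Fraïssé class of permutations with a measure $\mu$ valued in a field $k$. The $k$-linear symmetric tensor category $\underline{\mathrm{Perm}}_k(\mathfrak{F};\mu)$ is defined as follows. - Objects are finite formal direct sums of symbols $\mathrm{Vec}_X$ with $X\in\mathfrak{F}$. - Morphisms $\mathrm{Vec}_X\to\mathrm{Vec}_Y$ are formal $k$-linear combinations of amalgamations of $X$ and $Y$ in $\mathfrak{F}$. - Composition: if $A$ is an amalgamation of $X$ and $Y$ and $B$ is an amalgamation of $Y$ and $Z$, then $B\circ A=\sum_W\mu(C_W\to W)\,C_W$. The sum is over isomorphism classes of members $W$ of $\mathfrak{F}$ with jointly surjective embeddings of $X,Y,Z$ such that the substructure of $W$ on the union of the images of $X$ and $Y$ is $A$, and that on the union of the images of $Y$ and $Z$ is $B$. Here $C_W$ is the substructure on the union of the images of $X$ and $Z$. - Tensor product: $\mathrm{Vec}_X\otimes\mathrm{Vec}_{X'}=\bigoplus_V\mathrm{Vec}_V$ over amalgamations $V$ of $X$ and $X'$, with unit $\mathrm{Vec}_\emptyset$. For morphisms $f\colon\mathrm{Vec}_X\to\mathrm{Vec}_Y$ and $f'\colon\mathrm{Vec}_{X'}\to\mathrm{Vec}_{Y'}$, the coefficient in $f\otimes f'$ of an amalgamation $C$ of $V$ (an amalgamation of $X,X'$) and $W$ (an amalgamation of $Y,Y'$) is the product of the coefficient in $f$ of the amalgamation of $X,Y$ induced by $C$ and the coefficient in $f'$ of the amalgamation of $X',Y'$ induced by $C$. The symmetry is the evident one. Every object is rigid (in fact self-dual), so categorical traces are defined.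 The superscript $\mathrm{kar}$ denotes the Karoubi (idempotent) completion. A pre-Tannakian category over $k$ is a $k$-linear abelian symmetric monoidal category with $k$-bilinear tensor product in which all objects have finite length, all Hom spaces are finite dimensional, every object is rigid, and $\operatorname{End}(\mathbf{1})=k$. It is semi-simple if every object is a finite direct sum of simple objects. The semi-simplification of a rigid $k$-linear symmetric monoidal category is its quotient by the tensor ideal of negligible morphisms, where $f\colon M\to N$ is negligible if $\operatorname{tr}(f\circ g)=0$ for all $g\colon N\to M$. In (c), ''is'' means equivalent as $k$-linear symmetric monoidal categories. *)

(* Defs.v *)
From HB Require Import structures.
From mathcomp Require Import all_boot all_order all_algebra perm generic_quotient.
From mathcomp Require Import boolp.

Set Implicit Arguments.
Unset Strict Implicit.
Unset Printing Implicit Defensive.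

Import GRing.Theory.
Local Open Scope ring_scope.

(** * Permutations, embeddings, amalgamations, measures *)

Definition strict_total (T : finType) (r : rel T) : Prop :=
  [/\ irreflexive r, transitive r & forall x y, x != y -> r x y || r y x].

Record permutation := Permutation {
  points :> finType;
  lt1 : rel points;
  lt2 : rel points;
  lt1_total : strict_total lt1;
  lt2_total : strict_total lt2 }.

Definition is_emb (X Y : permutation) (f : X -> Y) : bool :=
  injectiveb f &&
  [forall x, forall y,
     (lt1 (f x) (f y) == lt1 x y) && (lt2 (f x) (f y) == lt2 x y)].

Definition embedding (X Y : permutation) := {f : {ffun X -> Y} | is_emb f}.
HB.instance Definition _ (X Y : permutation) := Finite.on (embedding X Y).
HB.instance Definition _ (X Y : permutation) := SubType.on (embedding X Y).

Definition emb_fun (X Y : permutation) (h : embedding X Y) : X -> Y := val h.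
Coercion emb_fun : embedding >-> Funclass.

Lemma is_emb_finfun (X Y : permutation) (f : X -> Y) :
  is_emb f -> is_emb (finfun f).
Proof.
case/andP=> /injectiveP fi /forallP fo; apply/andP; split.
  by apply/injectiveP => x y; rewrite !ffunE; apply: fi.
by apply/forallP => x; apply/forallP => y; rewrite !ffunE; have/forallP := fo x.
Qed.

Definition mk_emb (X Y : permutation) (f : X -> Y) (fP : is_emb f) :
  embedding X Y := exist _ (finfun f) (is_emb_finfun fP).

Lemma is_emb_comp (X Y Z : permutation) (g : embedding Y Z)
  (f : embedding X Y) : is_emb (fun x => g (f x)).
Proof.
have /andP[/injectiveP gi /forallP go] := valP g.
have /andP[/injectiveP fi /forallP fo] := valP f.
apply/andP; split; first by apply/injectiveP => x y /gi /fi.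
apply/forallP => x; apply/forallP => y; rewrite /emb_fun.
have /forallP/(_ y)/andP[/eqP <- /eqP <-] := fo x.
by have /forallP := go (val f x).
Qed.

Definition comp_emb (X Y Z : permutation) (g : embedding Y Z)
  (f : embedding X Y) : embedding X Z := mk_emb (is_emb_comp g f).

Lemma strict_total_void : strict_total (fun _ _ : void => false).
Proof. by split=> -[]. Qed.

Definition empty_perm : permutation :=
  Permutation strict_total_void strict_total_void.

Lemma is_emb_void (X : permutation) :
  is_emb (X := empty_perm) (Y := X) (of_void X).
Proof.
apply/andP; split; first by apply/injectiveP => -[].
by apply/forallP => -[].
Qed.

Definition emb_empty (X : permutation) : embedding empty_perm X :=
  mk_emb (is_emb_void X).

(** Every permutation is isomorphic to [std s] for exactly one [n] and
    [s : 'S_n], and [std s] has no automorphism but the identity.  Hence a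
    permutation equipped with a map from a fixed set has, up to isomorphism
    compatible with that map, exactly one representative on some [std s]; this
    is how isomorphism classes of amalgamations are enumerated below. *)
Lemma strict_total_ord n (f : 'I_n -> 'I_n) :
  injective f -> strict_total (fun x y => f x < f y)%N.
Proof.
move=> fi; split=> [x|y x z|x y]; first exact: ltnn.
  exact: ltn_trans.
by rewrite -neq_ltn; apply: contra => /eqP/val_inj/fi ->.
Qed.

Definition std n (s : 'S_n) : permutation :=
  Permutation (@strict_total_ord n id (@inj_id _))
              (@strict_total_ord n s (@perm_inj _ s)).

(** A standard permutation with a map from [S]; the maps used below are jointly
    surjective, so the bound on the size is no restriction. *)
Definition marked (S : finType) :=
  {n : 'I_#|S|.+1 & ('S_n * {ffun S -> 'I_n})%type}.

Definition marked_perm (S : finType) (c : marked S) : permutation :=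
  std (tagged c).1.

Definition mark (S : finType) (c : marked S) : S -> marked_perm c :=
  (tagged c).2.

Definition mark_surj (S : finType) (c : marked S) : bool :=
  [forall w, exists z, mark c z == w].

Section Amalgamations.
Variable F : permutation -> Prop.

(** Amalgamations in [F] of [i : Y -> X] and [j : Y -> Y'], one for each
    isomorphism class. *)
Definition amalg (Y X Y' : permutation) (i : embedding Y X)
    (j : embedding Y Y') :=
  {c : marked (X + Y')%type |
    [&& is_emb (fun x => mark c (inl x)), is_emb (fun y => mark c (inr y)),
        mark_surj c, [forall y, mark c (inl (i y)) == mark c (inr (j y))]
      & `[< F (marked_perm c) >] ] }.
HB.instance Definition _ Y X Y' i j := Finite.on (@amalg Y X Y' i j).
HB.instance Definition _ Y X Y' i j := SubType.on (@amalg Y X Y' i j).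

Section Legs.
Variables (Y X Y' : permutation) (i : embedding Y X) (j : embedding Y Y').
Variable A : amalg i j.

Definition amalg_perm : permutation := marked_perm (val A).

Lemma amalg_l_subproof : is_emb (fun x => mark (val A) (inl x)).
Proof. by case/and5P: (valP A). Qed.
Lemma amalg_r_subproof : is_emb (fun y => mark (val A) (inr y)).
Proof. by case/and5P: (valP A). Qed.

Definition amalg_l : embedding X amalg_perm := mk_emb amalg_l_subproof.
Definition amalg_r : embedding Y' amalg_perm := mk_emb amalg_r_subproof.

Lemma amalg_mem : F amalg_perm.
Proof. by case/and5P: (valP A) => _ _ _ _ /asboolP. Qed.
End Legs.

Definition amalg0 (X Y : permutation) := amalg (emb_empty X) (emb_empty Y).
HB.instance Definition _ (X Y : permutation) := Finite.on (amalg0 X Y).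

(** Members of [F] with jointly surjective embeddings of [X], [Y], [Z], up to
    isomorphism. *)
Definition amalg3 (X Y Z : permutation) :=
  {c : marked (X + Y + Z)%type |
    [&& is_emb (fun x => mark c (inl (inl x))),
        is_emb (fun y => mark c (inl (inr y))),
        is_emb (fun z => mark c (inr z)),
        mark_surj c & `[< F (marked_perm c) >] ] }.
HB.instance Definition _ X Y Z := Finite.on (amalg3 X Y Z).
HB.instance Definition _ X Y Z := SubType.on (amalg3 X Y Z).

Section Legs3.
Variables (X Y Z : permutation) (W : amalg3 X Y Z).

Definition amalg3_perm : permutation := marked_perm (val W).

Lemma amalg3_1_subproof : is_emb (fun x => mark (val W) (inl (inl x))).
Proof. by case/and5P: (valP W). Qed.
Lemma amalg3_2_subproof : is_emb (fun y => mark (val W) (inl (inr y))).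
Proof. by case/and5P: (valP W). Qed.
Lemma amalg3_3_subproof : is_emb (fun z => mark (val W) (inr z)).
Proof. by case/and5P: (valP W). Qed.

Definition amalg3_1 : embedding X amalg3_perm := mk_emb amalg3_1_subproof.
Definition amalg3_2 : embedding Y amalg3_perm := mk_emb amalg3_2_subproof.
Definition amalg3_3 : embedding Z amalg3_perm := mk_emb amalg3_3_subproof.
End Legs3.

(** [h] identifies the amalgamation [A] of [X] and [Y] with the substructure of
    [W] on the union of the images of [u] and [v]. *)
Definition induced_by (X Y W : permutation) (A : amalg0 X Y)
    (u : embedding X W) (v : embedding Y W)
    (h : embedding (amalg_perm A) W) : bool :=
  [forall x, h (amalg_l A x) == u x] && [forall y, h (amalg_r A y) == v y].

Definition induced (X Y W : permutation) (A : amalg0 X Y)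
    (u : embedding X W) (v : embedding Y W) : bool :=
  [exists h : embedding (amalg_perm A) W, induced_by u v h].

End Amalgamations.

(** Values of a measure on embeddings that are not between members of [F] are
    irrelevant; the restriction of a measure to a subclass is thus the same
    function. *)
Definition emb_function (R : Type) :=
  forall X Y : permutation, embedding X Y -> R.

Record is_measure (R : comPzRingType) (F : permutation -> Prop)
    (mu : emb_function R) : Prop := IsMeasure {
  measure_iso : forall (X Y : permutation) (i : embedding X Y),
    F X -> F Y -> bijective i -> mu X Y i = 1;
  measure_comp : forall (X Y Z : permutation) (j : embedding Y Z)
      (i : embedding X Y),
    F X -> F Y -> F Z -> mu X Z (comp_emb j i) = mu Y Z j * mu X Y i;
  measure_amalg : forall (Y X Y' : permutation) (i : embedding Y X)
      (j : embedding Y Y'),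
    F X -> F Y -> F Y' ->
    mu Y X i = \sum_(A : amalg F i j) mu Y' (amalg_perm A) (amalg_r A) }.

Definition all_perms : permutation -> Prop := fun _ => True.

Definition measure_support (mu : emb_function int) : permutation -> Prop :=
  fun X => mu empty_perm X (emb_empty X) != 0.

Lemma support_empty (mu : emb_function int) :
  is_measure all_perms mu -> measure_support mu empty_perm.
Proof.
move=> hmu; rewrite /measure_support (measure_iso hmu) ?oner_eq0 //.
by exists id => -[].
Qed.

Definition scalar_measure (k : pzRingType) (mu : emb_function int) :
  emb_function k := fun X Y h => (mu X Y h)%:~R.

(** * Linear symmetric monoidal categories *)

Record smc_data (k : fieldType) := SmcData {
  ob : Type;
  mor : ob -> ob -> lmodType k;
  idm : forall X, mor X X;
  comp : forall X Y Z, mor Y Z -> mor X Y -> mor X Z;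
  one : ob;
  tens : ob -> ob -> ob;
  tensm : forall X Y X' Y',
    mor X Y -> mor X' Y' -> mor (tens X X') (tens Y Y');
  assoc : forall X Y Z, mor (tens (tens X Y) Z) (tens X (tens Y Z));
  lunit : forall X, mor (tens one X) X;
  runit : forall X, mor (tens X one) X;
  braid : forall X Y, mor (tens X Y) (tens Y X) }.

Arguments mor {k s} _ _.
Arguments idm {k s} X.
Arguments comp {k s X Y Z} _ _.
Arguments one {k s}.
Arguments tens {k s} _ _.
Arguments tensm {k s X Y X' Y'} _ _.
Arguments assoc {k s} X Y Z.
Arguments lunit {k s} X.
Arguments runit {k s} X.
Arguments braid {k s} X Y.

Declare Scope smc_scope.
Delimit Scope smc_scope with smc.
Notation "g ∘ f" := (comp g f) (at level 40, left associativity) : smc_scope.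
Notation "X ⊗ Y" := (tens X Y) (at level 38, left associativity) : smc_scope.
Notation "f ⊠ g" := (tensm f g) (at level 38, left associativity) : smc_scope.
Local Open Scope smc_scope.

Section Basic.
Context {k : fieldType} {C : smc_data k}.

Definition inverse_of {X Y : ob C} (f : mor X Y) (g : mor Y X) : Prop :=
  g ∘ f = idm X /\ f ∘ g = idm Y.

Definition is_iso {X Y : ob C} (f : mor X Y) : Prop :=
  exists g, inverse_of f g.
End Basic.

Record smc_laws (k : fieldType) (C : smc_data k) : Prop := SmcLaws {
  compA : forall (X Y Z T : ob C) (h : mor Z T) (g : mor Y Z) (f : mor X Y),
    h ∘ (g ∘ f) = h ∘ g ∘ f;
  comp1m : forall (X Y : ob C) (f : mor X Y), idm Y ∘ f = f;
  compm1 : forall (X Y : ob C) (f : mor X Y), f ∘ idm X = f;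
  comp_linear : forall (X Y Z : ob C) (g : mor Y Z),
    linear (fun f : mor X Y => g ∘ f);
  comp_linearl : forall (X Y Z : ob C) (f : mor X Y),
    linear (fun g : mor Y Z => g ∘ f);

  tensm1 : forall X Y : ob C, idm X ⊠ idm Y = idm (X ⊗ Y);
  tensm_comp : forall (X Y Z X' Y' Z' : ob C) (g : mor Y Z) (f : mor X Y)
      (g' : mor Y' Z') (f' : mor X' Y'),
    (g ∘ f) ⊠ (g' ∘ f') = (g ⊠ g') ∘ (f ⊠ f');
  tensm_linear : forall (X Y X' Y' : ob C) (f : mor X Y),
    linear (fun f' : mor X' Y' => f ⊠ f');
  tensm_linearl : forall (X Y X' Y' : ob C) (f' : mor X' Y'),
    linear (fun f : mor X Y => f ⊠ f');

  assoc_iso : forall X Y Z : ob C, is_iso (assoc X Y Z);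
  assoc_nat : forall (X Y Z X' Y' Z' : ob C)
      (f : mor X X') (g : mor Y Y') (h : mor Z Z'),
    assoc X' Y' Z' ∘ ((f ⊠ g) ⊠ h) = (f ⊠ (g ⊠ h)) ∘ assoc X Y Z;
  lunit_iso : forall X : ob C, is_iso (lunit X);
  lunit_nat : forall (X Y : ob C) (f : mor X Y),
    lunit Y ∘ (idm one ⊠ f) = f ∘ lunit X;
  runit_iso : forall X : ob C, is_iso (runit X);
  runit_nat : forall (X Y : ob C) (f : mor X Y),
    runit Y ∘ (f ⊠ idm one) = f ∘ runit X;
  braid_nat : forall (X Y X' Y' : ob C) (f : mor X X') (g : mor Y Y'),
    braid X' Y' ∘ (f ⊠ g) = (g ⊠ f) ∘ braid X Y;
  braid_sym : forall X Y : ob C, braid Y X ∘ braid X Y = idm (X ⊗ Y);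

  pentagon : forall X Y Z T : ob C,
    assoc X Y (Z ⊗ T) ∘ assoc (X ⊗ Y) Z T =
    (idm X ⊠ assoc Y Z T) ∘ assoc X (Y ⊗ Z) T ∘ (assoc X Y Z ⊠ idm T);
  triangle : forall X Y : ob C,
    (idm X ⊠ lunit Y) ∘ assoc X one Y = runit X ⊠ idm Y;
  hexagon : forall X Y Z : ob C,
    assoc Y Z X ∘ braid X (Y ⊗ Z) ∘ assoc X Y Z =
    (idm Y ⊠ braid X Z) ∘ assoc Y X Z ∘ (braid X Y ⊠ idm Z) }.

Record smc (k : fieldType) := Smc {
  smc_base :> smc_data k;
  smcP : smc_laws smc_base }.

(** ** Duals, traces *)

Section Rigid.
Context {k : fieldType} (C : smc_data k).

Record is_dual (X D : ob C) (ev : mor (D ⊗ X) one)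
    (coev : mor one (X ⊗ D)) : Prop := IsDual {
  dual_zigzag : runit X ∘ (idm X ⊠ ev) ∘ assoc X D X ∘ (coev ⊠ idm X)
                = lunit X;
  dual_zagzig : forall a : mor (D ⊗ (X ⊗ D)) (D ⊗ X ⊗ D),
    inverse_of (assoc D X D) a ->
    lunit D ∘ (ev ⊠ idm D) ∘ a ∘ (idm D ⊠ coev) = runit D }.

Record dual_of (X : ob C) := DualOf {
  dual : ob C;
  ev : mor (dual ⊗ X) one;
  coev : mor one (X ⊗ dual);
  dualP : is_dual ev coev }.

Definition rigid : Prop := forall X : ob C, inhabited (dual_of X).

(** The trace does not depend on the choice of the dual. *)
Definition tr (rC : rigid) (X : ob C) (f : mor X X) : mor (one : ob C) one :=
  let D := inhabited_witness (rC X) in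
  ev D ∘ braid X (dual D) ∘ (f ⊠ idm (dual D)) ∘ coev D.

Definition negligible (rC : rigid) (M N : ob C) (f : mor M N) : Prop :=
  forall g : mor N M, tr rC (f ∘ g) = 0.

Definition nilpotent_endo (X : ob C) (f : mor X X) : Prop :=
  exists n, iter n (comp f) (idm X) = 0.
End Rigid.

Arguments ev {k C X} d.
Arguments coev {k C X} d.
Arguments dual {k C X} d.

(** ** Semi-simple pre-Tannakian categories *)

Section PreTannakian.
Context {k : fieldType} (C : smc_data k).

Definition is_zero_ob (Z : ob C) : Prop :=
  (forall (T : ob C) (f g : mor Z T), f = g) /\
  (forall (T : ob C) (f g : mor T Z), f = g).

Definition mono (X Y : ob C) (f : mor X Y) : Prop :=
  forall (T : ob C) (g h : mor T X), f ∘ g = f ∘ h -> g = h.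

Definition epi (X Y : ob C) (f : mor X Y) : Prop :=
  forall (T : ob C) (g h : mor Y T), g ∘ f = h ∘ f -> g = h.

Definition is_kernel (K X Y : ob C) (i : mor K X) (f : mor X Y) : Prop :=
  f ∘ i = 0 /\
  forall (T : ob C) (g : mor T X), f ∘ g = 0 -> exists! u, i ∘ u = g.

Definition is_cokernel (X Y Q : ob C) (p : mor Y Q) (f : mor X Y) : Prop :=
  p ∘ f = 0 /\
  forall (T : ob C) (g : mor Y T), g ∘ f = 0 -> exists! u, u ∘ p = g.

Definition is_direct_sum (n : nat) (S : 'I_n -> ob C) (X : ob C) : Prop :=
  exists (inj : forall a, mor (S a) X) (proj : forall a, mor X (S a)),
    [/\ forall a, proj a ∘ inj a = idm (S a),
        forall a b, a != b -> proj a ∘ inj b = 0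
      & \sum_a inj a ∘ proj a = idm X].

Record abelian : Prop := IsAbelian {
  ab_direct_sum : forall n (S : 'I_n -> ob C), exists X, is_direct_sum S X;
  ab_kernel : forall (X Y : ob C) (f : mor X Y),
    exists K (i : mor K X), is_kernel i f;
  ab_cokernel : forall (X Y : ob C) (f : mor X Y),
    exists Q (p : mor Y Q), is_cokernel p f;
  ab_mono : forall (X Y : ob C) (f : mor X Y), mono f ->
    exists Z (g : mor Y Z), is_kernel f g;
  ab_epi : forall (X Y : ob C) (f : mor X Y), epi f ->
    exists Z (g : mor Z X), is_cokernel f g }.

Definition simple (S : ob C) : Prop :=
  ~ is_zero_ob S /\
  forall (U : ob C) (i : mor U S), mono i -> is_zero_ob U \/ is_iso i.

Inductive finite_length : ob C -> Prop :=
| finite_length_zero X : is_zero_ob X -> finite_length X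
| finite_length_extension (X' X S : ob C) (i : mor X' X) (p : mor X S) :
    is_kernel i p -> is_cokernel p i -> simple S ->
    finite_length X' -> finite_length X.

Definition finite_dim (V : lmodType k) : Prop :=
  exists n (e : 'I_n -> V),
    forall v, exists c : 'I_n -> k, v = \sum_a c a *: e a.

Record pre_tannakian : Prop := IsPreTannakian {
  pt_smc : smc_laws C;
  pt_abelian : abelian;
  pt_length : forall X : ob C, finite_length X;
  pt_finite_dim : forall X Y : ob C, finite_dim (mor X Y);
  pt_rigid : rigid C;
  pt_end_one : bijective (fun c : k => c *: idm (one : ob C)) }.

Definition semisimple : Prop :=
  forall X : ob C, exists n (S : 'I_n -> ob C),
    (forall a, simple (S a)) /\ is_direct_sum S X.

End PreTannakian.

(** ** Equivalences of linear symmetric monoidal categories *)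

Section Equivalence.
Context {k : fieldType}.

Record functor (C D : smc_data k) := Functor {
  fob :> ob C -> ob D;
  fmap : forall X Y : ob C, mor X Y -> mor (fob X) (fob Y);
  fmap1 : forall X, fmap (idm X) = idm (fob X);
  fmap_comp : forall (X Y Z : ob C) (g : mor Y Z) (f : mor X Y),
    fmap (g ∘ f) = fmap g ∘ fmap f }.
Arguments fmap {C D} F {X Y} _ : rename.

Definition linear_functor (C D : smc_data k) (F : functor C D) : Prop :=
  forall X Y : ob C, linear (@fmap C D F X Y).

(** [F] with [eps] and [phi] is a (strong) symmetric monoidal functor. *)
Record symmetric_monoidal (C D : smc_data k) (F : functor C D)
    (eps : mor (one : ob D) (F one))
    (phi : forall X Y : ob C, mor (F X ⊗ F Y) (F (X ⊗ Y))) : Prop :=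
  IsSymmetricMonoidal {
  mon_eps_iso : is_iso eps;
  mon_phi_iso : forall X Y, is_iso (phi X Y);
  mon_phi_nat : forall (X Y X' Y' : ob C) (f : mor X X') (g : mor Y Y'),
    phi X' Y' ∘ (fmap F f ⊠ fmap F g) = fmap F (f ⊠ g) ∘ phi X Y;
  mon_assoc : forall X Y Z : ob C,
    fmap F (assoc X Y Z) ∘ phi (X ⊗ Y) Z ∘ (phi X Y ⊠ idm (F Z)) =
    phi X (Y ⊗ Z) ∘ (idm (F X) ⊠ phi Y Z) ∘ assoc (F X) (F Y) (F Z);
  mon_lunit : forall X : ob C,
    fmap F (lunit X) ∘ phi one X ∘ (eps ⊠ idm (F X)) = lunit (F X);
  mon_runit : forall X : ob C,
    fmap F (runit X) ∘ phi X one ∘ (idm (F X) ⊠ eps) = runit (F X);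
  mon_braid : forall X Y : ob C,
    fmap F (braid X Y) ∘ phi X Y = phi Y X ∘ braid (F X) (F Y) }.

Definition quasi_inverse (C D : smc_data k) (F : functor C D)
    (G : functor D C) : Prop :=
  (exists eta : forall X : ob C, mor (G (F X)) X,
     (forall X, is_iso (eta X)) /\
     forall (X Y : ob C) (f : mor X Y),
       f ∘ eta X = eta Y ∘ fmap G (fmap F f)) /\
  (exists theta : forall X : ob D, mor (F (G X)) X,
     (forall X, is_iso (theta X)) /\
     forall (X Y : ob D) (f : mor X Y),
       f ∘ theta X = theta Y ∘ fmap F (fmap G f)).

Definition smc_equivalent (C D : smc_data k) : Prop :=
  exists F : functor C D,
    [/\ linear_functor F,
        exists eps phi, @symmetric_monoidal C D F eps phi
      & exists G : functor D C, quasi_inverse F G].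

End Equivalence.

(** * Karoubi completion *)

Section Karoubi.
Variables (k : fieldType) (C : smc k).
Implicit Types X Y Z T : ob C.

Lemma compm0 X Y Z (g : mor Y Z) : g ∘ (0 : mor X Y) = 0.
Proof.
have := comp_linear (smcP C) (X := X) g (-1) 0 0.
by rewrite scaler0 addr0 scaleN1r addNr.
Qed.

Lemma comp0m X Y Z (f : mor X Y) : (0 : mor Y Z) ∘ f = 0.
Proof.
have := comp_linearl (smcP C) (Z := Z) f (-1) 0 0.
by rewrite scaler0 addr0 scaleN1r addNr.
Qed.

Lemma compmD X Y Z (g : mor Y Z) (f f' : mor X Y) :
  g ∘ (f + f') = g ∘ f + g ∘ f'.
Proof. by rewrite -[f in LHS]scale1r (comp_linear (smcP C)) scale1r. Qed.

Lemma compDm X Y Z (g g' : mor Y Z) (f : mor X Y) :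
  (g + g') ∘ f = g ∘ f + g' ∘ f.
Proof. by rewrite -[g in LHS]scale1r (comp_linearl (smcP C)) scale1r. Qed.

Lemma compmZ X Y Z (g : mor Y Z) a (f : mor X Y) :
  g ∘ (a *: f) = a *: (g ∘ f).
Proof. by rewrite -[a *: f]addr0 (comp_linear (smcP C)) compm0 addr0. Qed.

Lemma compZm X Y Z a (g : mor Y Z) (f : mor X Y) :
  (a *: g) ∘ f = a *: (g ∘ f).
Proof. by rewrite -[a *: g]addr0 (comp_linearl (smcP C)) comp0m addr0. Qed.

Record kar_ob := KarOb {
  kob : ob C;
  kidem : mor kob kob;
  kidemP : kidem ∘ kidem = kidem }.
Implicit Types P Q R S : kar_ob.

Definition kar_pred P Q : pred (mor (kob P) (kob Q)) :=
  fun f => kidem Q ∘ f ∘ kidem P == f.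

Record kar_hom P Q := KarHom {
  kval : mor (kob P) (kob Q);
  kvalP : kar_pred kval }.

Lemma kar_pred_closed P Q : subsemimod_closed (@kar_pred P Q).
Proof.
split; first split; rewrite ?unfold_in.
- by rewrite /kar_pred compm0 comp0m.
- move=> f g /eqP Hf /eqP Hg; rewrite unfold_in /kar_pred.
  by rewrite compmD compDm Hf Hg.
- move=> a f /eqP Hf; rewrite unfold_in /kar_pred.
  by rewrite compmZ compZm Hf.
Qed.

HB.instance Definition _ P Q := [isSub for @kval P Q].
HB.instance Definition _ P Q := [Choice of kar_hom P Q by <:].
HB.instance Definition _ P Q :=
  GRing.SubChoice_isSubLmodule.Build k (mor (kob P) (kob Q))
    (@kar_pred P Q) (kar_hom P Q) (@kar_pred_closed P Q).

Lemma kar_val_inj P Q (f g : kar_hom P Q) : kval f = kval g -> f = g.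
Proof. exact: val_inj. Qed.

Lemma kidemA P X (f : mor X (kob P)) : kidem P ∘ (kidem P ∘ f) = kidem P ∘ f.
Proof. by rewrite (compA (smcP C)) kidemP. Qed.

Lemma kval_l P Q (f : kar_hom P Q) : kidem Q ∘ kval f = kval f.
Proof. by rewrite -(eqP (kvalP f)) -!(compA (smcP C)) kidemA. Qed.

Lemma kval_r P Q (f : kar_hom P Q) : kval f ∘ kidem P = kval f.
Proof. by rewrite -(eqP (kvalP f)) -!(compA (smcP C)) kidemP. Qed.

Lemma kar_res_subproof P Q (f : mor (kob P) (kob Q)) :
  kar_pred (P := P) (Q := Q) (kidem Q ∘ f ∘ kidem P).
Proof. by rewrite /kar_pred -!(compA (smcP C)) kidemP kidemA. Qed.

Definition kar_res P Q (f : mor (kob P) (kob Q)) : kar_hom P Q :=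
  KarHom (kar_res_subproof f).

Lemma kar_id_subproof P : kar_pred (P := P) (Q := P) (kidem P).
Proof. by rewrite /kar_pred !kidemP. Qed.

Definition kar_id P : kar_hom P P := KarHom (kar_id_subproof P).

Lemma kar_comp_subproof P Q R (g : kar_hom Q R) (f : kar_hom P Q) :
  kar_pred (P := P) (Q := R) (kval g ∘ kval f).
Proof.
by rewrite /kar_pred (compA (smcP C)) kval_l -(compA (smcP C)) kval_r.
Qed.

Definition kar_comp P Q R (g : kar_hom Q R) (f : kar_hom P Q) : kar_hom P R :=
  KarHom (kar_comp_subproof g f).

Lemma kar_one_subproof : idm one ∘ idm one = idm (one : ob C).
Proof. exact: (comp1m (smcP C)). Qed.

Definition kar_one : kar_ob := KarOb kar_one_subproof.

Lemma kar_tens_subproof P Q :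
  (kidem P ⊠ kidem Q) ∘ (kidem P ⊠ kidem Q) = kidem P ⊠ kidem Q.
Proof. by rewrite -(tensm_comp (smcP C)) !kidemP. Qed.

Definition kar_tens P Q : kar_ob := KarOb (kar_tens_subproof P Q).

Lemma kar_tensm_subproof P Q P' Q' (f : kar_hom P Q) (g : kar_hom P' Q') :
  kar_pred (P := kar_tens P P') (Q := kar_tens Q Q') (kval f ⊠ kval g).
Proof.
by rewrite /kar_pred /= -!(tensm_comp (smcP C)) (eqP (kvalP f)) (eqP (kvalP g)).
Qed.

Definition kar_tensm P Q P' Q' (f : kar_hom P Q) (g : kar_hom P' Q') :
  kar_hom (kar_tens P P') (kar_tens Q Q') := KarHom (kar_tensm_subproof f g).

Definition kar_assoc P Q R :
    kar_hom (kar_tens (kar_tens P Q) R) (kar_tens P (kar_tens Q R)) :=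
  kar_res (P := kar_tens (kar_tens P Q) R) (Q := kar_tens P (kar_tens Q R))
    (assoc (kob P) (kob Q) (kob R)).
Definition kar_lunit P : kar_hom (kar_tens kar_one P) P :=
  kar_res (P := kar_tens kar_one P) (Q := P) (lunit (kob P)).
Definition kar_runit P : kar_hom (kar_tens P kar_one) P :=
  kar_res (P := kar_tens P kar_one) (Q := P) (runit (kob P)).
Definition kar_braid P Q : kar_hom (kar_tens P Q) (kar_tens Q P) :=
  kar_res (P := kar_tens P Q) (Q := kar_tens Q P) (braid (kob P) (kob Q)).

Definition kar_data : smc_data k := {|
  ob := kar_ob;
  mor := fun P Q => kar_hom P Q : lmodType k;
  idm := kar_id;
  comp := kar_comp;
  one := kar_one;
  tens := kar_tens;
  tensm := kar_tensm;
  assoc := kar_assoc;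
  lunit := kar_lunit;
  runit := kar_runit;
  braid := kar_braid |}.

Section NaturalRestriction.
Variables (P Q : kar_ob) (n : mor (kob P) (kob Q)).
Hypothesis nat : n ∘ kidem P = kidem Q ∘ n.

Lemma kar_res_src : kval (kar_res n) = n ∘ kidem P.
Proof. by rewrite /= -(compA (smcP C)) nat kidemA. Qed.

Lemma kar_res_tgt : kval (kar_res n) = kidem Q ∘ n.
Proof. by rewrite kar_res_src nat. Qed.
End NaturalRestriction.

Lemma kar_res_iso P Q (n : mor (kob P) (kob Q)) :
  n ∘ kidem P = kidem Q ∘ n -> is_iso n ->
  is_iso (C := kar_data) (X := P) (Y := Q) (kar_res n).
Proof.
move=> nn [m [mn nm]].
have mnat : m ∘ kidem Q = kidem P ∘ m.
  have A := compA (smcP C).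
  transitivity (m ∘ (n ∘ kidem P) ∘ m).
    by rewrite nn -!A nm (compm1 (smcP C)).
  by rewrite A mn (comp1m (smcP C)).
have A := compA (smcP C).
exists (kar_res m); split; apply: kar_val_inj.
  change (kval (kar_res m) ∘ kval (kar_res n) = kidem P).
  rewrite (kar_res_src nn) (kar_res_tgt mnat) -A (A _ _ _ _ m) mn.
  by rewrite (comp1m (smcP C)) kidemP.
change (kval (kar_res n) ∘ kval (kar_res m) = kidem Q).
rewrite (kar_res_src mnat) (kar_res_tgt nn) -A (A _ _ _ _ n) nm.
by rewrite (comp1m (smcP C)) kidemP.
Qed.

(* Naturality of [n] with respect to the morphisms of the completion. *)
Lemma kar_res_nat P Q P' Q' (n : mor (kob P) (kob Q)) (n' : mor (kob P') (kob Q'))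
    (f : kar_hom P P') (g : kar_hom Q Q') :
  n ∘ kidem P = kidem Q ∘ n -> n' ∘ kidem P' = kidem Q' ∘ n' ->
  n' ∘ kval f = kval g ∘ n ->
  kar_comp (kar_res n') f = kar_comp g (kar_res n).
Proof.
move=> nn nn' H; apply: kar_val_inj.
change (kval (kar_res n') ∘ kval f = kval g ∘ kval (kar_res n)).
rewrite (kar_res_src nn') (kar_res_tgt nn) -(compA (smcP C)) kval_l.
by rewrite (compA (smcP C)) kval_r.
Qed.

Section Structure.
Variables P Q R : kar_ob.

Lemma kar_assoc_nat :
  assoc (kob P) (kob Q) (kob R) ∘ kidem (kar_tens (kar_tens P Q) R)
  = kidem (kar_tens P (kar_tens Q R)) ∘ assoc (kob P) (kob Q) (kob R).
Proof. exact: (assoc_nat (smcP C)). Qed.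

Lemma kar_lunit_nat :
  lunit (kob P) ∘ kidem (kar_tens kar_one P) = kidem P ∘ lunit (kob P).
Proof. exact: (lunit_nat (smcP C)). Qed.

Lemma kar_runit_nat :
  runit (kob P) ∘ kidem (kar_tens P kar_one) = kidem P ∘ runit (kob P).
Proof. exact: (runit_nat (smcP C)). Qed.

Lemma kar_braid_nat :
  braid (kob P) (kob Q) ∘ kidem (kar_tens P Q)
  = kidem (kar_tens Q P) ∘ braid (kob P) (kob Q).
Proof. exact: (braid_nat (smcP C)). Qed.

Lemma kar_assocE : kval (kar_assoc P Q R) =
  assoc (kob P) (kob Q) (kob R) ∘ ((kidem P ⊠ kidem Q) ⊠ kidem R).
Proof. exact: (@kar_res_src (kar_tens (kar_tens P Q) R)
    (kar_tens P (kar_tens Q R)) _ kar_assoc_nat). Qed.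

Lemma kar_lunitE :
  kval (kar_lunit P) = lunit (kob P) ∘ (idm one ⊠ kidem P).
Proof. exact: (@kar_res_src (kar_tens kar_one P)
    P _ kar_lunit_nat). Qed.

Lemma kar_runitE :
  kval (kar_runit P) = runit (kob P) ∘ (kidem P ⊠ idm one).
Proof. exact: (@kar_res_src (kar_tens P kar_one)
    P _ kar_runit_nat). Qed.

Lemma kar_braidE :
  kval (kar_braid P Q) = braid (kob P) (kob Q) ∘ (kidem P ⊠ kidem Q).
Proof. exact: (@kar_res_src (kar_tens P Q)
    (kar_tens Q P) _ kar_braid_nat). Qed.
End Structure.

Lemma kar_laws : smc_laws kar_data.
Proof.
have A := compA (smcP C); have T := tensm_comp (smcP C).
have I1 := comp1m (smcP C); have I2 := compm1 (smcP C).
have Tl X Y X' Y' Z' (f : mor X Y) (g : mor Y' Z') (g' : mor X' Y') :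
    f ⊠ (g ∘ g') = (idm Y ⊠ g) ∘ (f ⊠ g') by rewrite -T I1.
have Tr X Y X' Y' Z' (f : mor X Y) (g : mor Y' Z') (g' : mor X' Y') :
    (g ∘ g') ⊠ f = (g ⊠ idm Y) ∘ (g' ⊠ f) by rewrite -T I1.
split=> /=.
- by move=> *; apply: kar_val_inj; rewrite /= A.
- by move=> *; apply: kar_val_inj; rewrite /= kval_l.
- by move=> *; apply: kar_val_inj; rewrite /= kval_r.
- by move=> * a u v; apply: kar_val_inj; rewrite /= (comp_linear (smcP C)).
- by move=> * a u v; apply: kar_val_inj; rewrite /= (comp_linearl (smcP C)).
- by move=> *; apply: kar_val_inj.
- by move=> *; apply: kar_val_inj; rewrite /= T.
- by move=> * a u v; apply: kar_val_inj; rewrite /= (tensm_linear (smcP C)).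
- by move=> * a u v; apply: kar_val_inj; rewrite /= (tensm_linearl (smcP C)).
- move=> P Q R.
  exact: (@kar_res_iso (kar_tens (kar_tens P Q) R) (kar_tens P (kar_tens Q R))
            _ (kar_assoc_nat P Q R) (assoc_iso (smcP C) _ _ _)).
- move=> P Q R P' Q' R' f g h.
  exact: (@kar_res_nat (kar_tens (kar_tens P Q) R) (kar_tens P (kar_tens Q R))
            (kar_tens (kar_tens P' Q') R') (kar_tens P' (kar_tens Q' R'))
            _ _ (kar_tensm (kar_tensm f g) h) (kar_tensm f (kar_tensm g h))
            (kar_assoc_nat P Q R) (kar_assoc_nat P' Q' R')
            (assoc_nat (smcP C) _ _ _)).
- move=> P.
  exact: (@kar_res_iso (kar_tens kar_one P) P _ (kar_lunit_nat P)
            (lunit_iso (smcP C) _)).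
- move=> P Q f.
  exact: (@kar_res_nat (kar_tens kar_one P) P (kar_tens kar_one Q) Q
            _ _ (kar_tensm (kar_id kar_one) f) f
            (kar_lunit_nat P) (kar_lunit_nat Q) (lunit_nat (smcP C) _)).
- move=> P.
  exact: (@kar_res_iso (kar_tens P kar_one) P _ (kar_runit_nat P)
            (runit_iso (smcP C) _)).
- move=> P Q f.
  exact: (@kar_res_nat (kar_tens P kar_one) P (kar_tens Q kar_one) Q
            _ _ (kar_tensm f (kar_id kar_one)) f
            (kar_runit_nat P) (kar_runit_nat Q) (runit_nat (smcP C) _)).
- move=> P Q P' Q' f g.
  exact: (@kar_res_nat (kar_tens P Q) (kar_tens Q P)
            (kar_tens P' Q') (kar_tens Q' P')
            _ _ (kar_tensm f g) (kar_tensm g f)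
            (kar_braid_nat P Q) (kar_braid_nat P' Q') (braid_nat (smcP C) _ _)).
- move=> P Q; apply: kar_val_inj.
  change (kval (kar_braid Q P) ∘ kval (kar_braid P Q)
          = kidem P ⊠ kidem Q).
  rewrite !kar_braidE -A (A _ _ _ _ (kidem Q ⊠ kidem P)).
  by rewrite -(braid_nat (smcP C)) -A -T !kidemP A (braid_sym (smcP C)) I1.
- move=> P Q R S; apply: kar_val_inj.
  change (kval (kar_assoc P Q (kar_tens R S)) ∘ kval (kar_assoc (kar_tens P Q) R S)
    = (kidem P ⊠ kval (kar_assoc Q R S)) ∘ kval (kar_assoc P (kar_tens Q R) S) ∘
      (kval (kar_assoc P Q R) ⊠ kidem S)).
  set p := kidem P; set q := kidem Q; set r := kidem R; set s := kidem S.
  have pp : p ∘ p = p := kidemP P. have qq : q ∘ q = q := kidemP Q.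
  have rr : r ∘ r = r := kidemP R. have ss : s ∘ s = s := kidemP S.
  transitivity (assoc (kob P) (kob Q) (kob R ⊗ kob S) ∘
                assoc (kob P ⊗ kob Q) (kob R) (kob S) ∘
                (((p ⊠ q) ⊠ r) ⊠ s)).
    rewrite !kar_assocE /= -A (A _ _ _ _ (_ ⊠ _) (assoc _ _ _)).
    rewrite -(assoc_nat (smcP C)) -!A.
    by rewrite -!T !kidemP.
  rewrite !kar_assocE /= (pentagon (smcP C)) Tl Tr -!A.
  rewrite [in RHS](A _ _ _ _ (kidem P ⊠ _) (assoc _ _ _)).
  rewrite -(assoc_nat (smcP C)) -!A.
  rewrite [in RHS](A _ _ _ _ (_ ⊠ _ ⊠ _) (_ ⊠ _)) -T.
  rewrite -/p -/q -/r -/s.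
  rewrite -!T ss pp qq rr.
  rewrite I1 ss (A _ _ _ _ (p ⊠ _) (assoc _ _ _)) -(assoc_nat (smcP C)) -!A.
  by rewrite -!T pp qq rr.
- move=> P Q; apply: kar_val_inj.
  change ((kidem P ⊠ kval (kar_lunit Q)) ∘ kval (kar_assoc P kar_one Q)
    = kval (kar_runit P) ⊠ kidem Q).
  rewrite kar_lunitE kar_assocE kar_runitE /= Tl Tr -(triangle (smcP C)) -!A.
  rewrite (A _ _ _ _ (_ ⊠ _) (assoc _ _ _)) -(assoc_nat (smcP C)) -!A -!T.
  by rewrite !kidemP I1.
- move=> P Q R; apply: kar_val_inj.
  change (kval (kar_assoc Q R P) ∘ kval (kar_braid P (kar_tens Q R)) ∘
      kval (kar_assoc P Q R) =
    (kidem Q ⊠ kval (kar_braid P R)) ∘ kval (kar_assoc Q P R) ∘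
      (kval (kar_braid P Q) ⊠ kidem R)).
  set p := kidem P; set q := kidem Q; set r := kidem R.
  have pp : p ∘ p = p := kidemP P. have qq : q ∘ q = q := kidemP Q.
  have rr : r ∘ r = r := kidemP R.
  transitivity (assoc (kob Q) (kob R) (kob P) ∘ braid (kob P) (kob Q ⊗ kob R) ∘
                assoc (kob P) (kob Q) (kob R) ∘ ((p ⊠ q) ⊠ r)).
    rewrite !kar_assocE !kar_braidE /= -!A -/p -/q -/r.
    rewrite (A _ _ _ _ (p ⊠ _) (assoc _ _ _)) -(assoc_nat (smcP C)) -!A.
    rewrite (A _ _ _ _ (_ ⊠ p) (braid _ _)) -(braid_nat (smcP C)) -!A.
    rewrite (A _ _ _ _ (p ⊠ _) (assoc _ _ _)) -(assoc_nat (smcP C)) -!A.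
    by rewrite -!T !pp !qq !rr.
  rewrite (hexagon (smcP C)) !kar_assocE !kar_braidE /= Tl Tr -!A -/p -/q -/r.
  rewrite [in RHS](A _ _ _ _ (q ⊠ _) (assoc _ _ _)) -(assoc_nat (smcP C)) -!A.
  rewrite -!T !I1 !rr !(A _ _ _ _ (q ⊠ p)) -T qq pp.
  rewrite [in RHS](A _ _ _ _ (q ⊠ p) (braid _ _)) -(braid_nat (smcP C)).
  by rewrite -!A -T pp qq.
Qed.

Definition kar : smc k := Smc kar_laws.

End Karoubi.

(** * Semi-simplification *)

Section Semisimplification.
Variables (k : fieldType) (C : smc k) (rC : rigid C).

Lemma tr_linear (X : ob C) : linear (@tr k C rC X).
Proof.
move=> a f g; rewrite /tr (tensm_linearl (smcP C)).
by rewrite compmD compDm compmZ compZm.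
Qed.

Lemma negligible_linear (M N : ob C) (a : k) (f g : mor M N) :
  negligible rC f -> negligible rC g -> negligible rC (a *: f + g).
Proof.
by move=> Hf Hg h; rewrite compDm compZm tr_linear Hf Hg scaler0 addr0.
Qed.

Lemma negligible0 (M N : ob C) : negligible rC (0 : mor M N).
Proof.
move=> h; have := @tr_linear N (-1) 0 0.
by rewrite comp0m scaler0 addr0 scaleN1r addNr.
Qed.

Definition congruent (M N : ob C) : rel (mor M N) :=
  fun f g => `[< negligible rC (f - g) >].

Lemma congruent_refl (M N : ob C) : reflexive (@congruent M N).
Proof.
by move=> f; apply/asboolP; rewrite subrr; exact: negligible0.
Qed.

Lemma congruent_sub (M N : ob C) (f g h : mor M N) :
  congruent f h -> congruent g h -> congruent f g.
Proof.
move=> /asboolP H /asboolP H'; apply/asboolP.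
have := negligible_linear (-1) H' H.
by rewrite scaleN1r opprB addrC addrA subrK.
Qed.

Lemma congruent_sym (M N : ob C) : symmetric (@congruent M N).
Proof.
by move=> f g; apply/idP/idP; apply: congruent_sub; apply: congruent_refl.
Qed.

Lemma congruent_trans (M N : ob C) : transitive (@congruent M N).
Proof.
by move=> g f h H; rewrite congruent_sym => H'; apply: congruent_sub H H'.
Qed.

Definition congruent_equiv (M N : ob C) : equiv_rel (mor M N) :=
  EquivRel (@congruent M N) (@congruent_refl M N) (@congruent_sym M N)
    (@congruent_trans M N).

Definition ss_hom (M N : ob C) :=
  {eq_quot (congruent_equiv M N)}%qT.
HB.instance Definition _ (M N : ob C) := Choice.on (ss_hom M N).

Definition ss_pi (M N : ob C) (f : mor M N) : ss_hom M N :=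
  (\pi_(ss_hom M N) f)%qT.
Definition ss_repr (M N : ob C) (x : ss_hom M N) : mor M N := repr x.

Lemma ss_reprK (M N : ob C) : cancel (@ss_repr M N) (@ss_pi M N).
Proof. exact: reprK. Qed.

Lemma ss_piP (M N : ob C) (f g : mor M N) :
  ss_pi f = ss_pi g <-> negligible rC (f - g).
Proof. by split=> [/eqmodP/asboolP//|H]; apply/eqmodP/asboolP. Qed.

Lemma ss_repr_pi (M N : ob C) (f : mor M N) :
  negligible rC (ss_repr (ss_pi f) - f).
Proof. by apply/ss_piP; rewrite ss_reprK. Qed.

(* Operations on classes are computed on representatives; negligible morphisms
   form a tensor ideal, so the choice of representatives does not matter. *)
Definition ss_add (M N : ob C) (x y : ss_hom M N) :=
  ss_pi (ss_repr x + ss_repr y).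
Definition ss_opp (M N : ob C) (x : ss_hom M N) := ss_pi (- ss_repr x).
Definition ss_scale (M N : ob C) (a : k) (x : ss_hom M N) :=
  ss_pi (a *: ss_repr x).

Section Lmodule.
Variables M N : ob C.

Lemma ss_ind (P : ss_hom M N -> Prop) : (forall f, P (ss_pi f)) -> forall x, P x.
Proof. by move=> H x; rewrite -[x]ss_reprK. Qed.

Lemma ss_piD (f g : mor M N) : ss_add (ss_pi f) (ss_pi g) = ss_pi (f + g).
Proof.
apply/ss_piP; have := negligible_linear 1 (ss_repr_pi f) (ss_repr_pi g).
by rewrite scale1r opprD addrACA.
Qed.

Lemma ss_piZ (a : k) (f : mor M N) : ss_scale a (ss_pi f) = ss_pi (a *: f).
Proof.
apply/ss_piP; have := negligible_linear a (ss_repr_pi f) (@negligible0 _ _).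
by rewrite scalerBr addr0.
Qed.

Lemma ss_piN (f : mor M N) : ss_opp (ss_pi f) = ss_pi (- f).
Proof. by have := ss_piZ (-1) f; rewrite /ss_scale !scaleN1r. Qed.

Lemma ss_addA : associative (@ss_add M N).
Proof.
by elim/ss_ind=> f; elim/ss_ind=> g; elim/ss_ind=> h; rewrite !ss_piD addrA.
Qed.
Lemma ss_addC : commutative (@ss_add M N).
Proof. by elim/ss_ind=> f; elim/ss_ind=> g; rewrite !ss_piD addrC. Qed.
Lemma ss_add0 : left_id (ss_pi 0) (@ss_add M N).
Proof. by elim/ss_ind=> f; rewrite !ss_piD add0r. Qed.
Lemma ss_addN : left_inverse (ss_pi 0) (@ss_opp M N) (@ss_add M N).
Proof. by elim/ss_ind=> f; rewrite ss_piN ss_piD addNr. Qed.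

HB.instance Definition _ :=
  GRing.isZmodule.Build (ss_hom M N) ss_addA ss_addC ss_add0 ss_addN.

Lemma ss_scaleA (a b : k) (x : ss_hom M N) :
  ss_scale a (ss_scale b x) = ss_scale (a * b) x.
Proof. by elim/ss_ind: x => f; rewrite !ss_piZ scalerA. Qed.
Lemma ss_scale1 : left_id 1 (@ss_scale M N).
Proof. by elim/ss_ind=> f; rewrite ss_piZ scale1r. Qed.
Lemma ss_scaleDr : right_distributive (@ss_scale M N) +%R.
Proof.
move=> a; elim/ss_ind=> f; elim/ss_ind=> g.
by rewrite [_ + _]ss_piD !ss_piZ [RHS]ss_piD scalerDr.
Qed.
Lemma ss_scaleDl (x : ss_hom M N) : {morph (@ss_scale M N)^~ x : a b / a + b}.
Proof.
by move=> a b; elim/ss_ind: x => f; rewrite !ss_piZ [RHS]ss_piD scalerDl.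
Qed.

HB.instance Definition _ := GRing.Zmodule_isLmodule.Build k (ss_hom M N)
  ss_scaleA ss_scale1 ss_scaleDr ss_scaleDl.
End Lmodule.

(** The quotient of [C] by the tensor ideal of negligible morphisms. *)
Definition semisimplification : smc_data k := {|
  ob := ob C;
  mor := fun M N => ss_hom M N : lmodType k;
  idm := fun M => ss_pi (idm M);
  comp := fun M N P g f => ss_pi (ss_repr g ∘ ss_repr f);
  one := one;
  tens := fun M N => M ⊗ N;
  tensm := fun M N M' N' f g => ss_pi (ss_repr f ⊠ ss_repr g);
  assoc := fun M N P => ss_pi (assoc M N P);
  lunit := fun M => ss_pi (lunit M);
  runit := fun M => ss_pi (runit M);
  braid := fun M N => ss_pi (braid M N) |}.

End Semisimplification.

(** * The category of permutation modules *)

Section Perm.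
Variables (k : fieldType) (F : permutation -> Prop) (F0 : F empty_perm).
Variable mu : emb_function k.

(** The formal direct sum of the [Vec_(perm_of i)], [i] in a finite set. *)
Record perm_ob := PermOb {
  summand : finType;
  perm_of :> summand -> permutation;
  perm_ofP : forall i, F (perm_of i) }.
Implicit Types s t u v : perm_ob.

(** The amalgamations of a summand of [s] and a summand of [t]; these index
    both the matrix entries of morphisms from [s] to [t] and the summands of
    the tensor product of [s] and [t]. *)
Definition amalgs s t : finType :=
  {ij : summand s * summand t & amalg0 F (s ij.1) (t ij.2)}.

Definition am_ob s t (c : amalgs s t) : permutation := amalg_perm (tagged c).
Definition am_i s t (c : amalgs s t) : summand s := (tag c).1.
Definition am_j s t (c : amalgs s t) : summand t := (tag c).2.
Definition am_l s t (c : amalgs s t) : embedding (s (am_i c)) (am_ob c) :=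
  amalg_l (tagged c).
Definition am_r s t (c : amalgs s t) : embedding (t (am_j c)) (am_ob c) :=
  amalg_r (tagged c).

Definition perm_hom s t : lmodType k := {ffun amalgs s t -> k^o}.

(** Coefficient in [f] of the amalgamation of [s i] and [t j] induced by [W]. *)
Definition coef s t (f : perm_hom s t) (i : summand s) (j : summand t)
    (W : permutation) (a : embedding (s i) W) (b : embedding (t j) W) : k :=
  \sum_(A : amalg0 F (s i) (t j) | induced A a b)
    f (existT (fun ij => amalg0 F (s ij.1) (t ij.2)) (i, j) A).

(** [x : s i -> W] and [y : s i' -> W] are the same map on the same summand. *)
Definition agree s (i i' : summand s) (W : permutation)
    (x : s i -> W) (y : s i' -> W) : bool :=
  (i == i') &&
  [forall a, forall b,
     (Tagged (fun i => points (s i)) a == Tagged (fun i => points (s i)) b)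
     ==> (x a == y b)].

Definition perm_id s : perm_hom s s := [ffun c => (agree (am_l c) (am_r c))%:R].

Definition perm_comp s t u (g : perm_hom t u) (f : perm_hom s t) :
    perm_hom s u :=
  [ffun c => \sum_(j : summand t)
     \sum_(W : amalg3 F (s (am_i c)) (t j) (u (am_j c)))
     \sum_(h : embedding (am_ob c) (amalg3_perm W) |
             induced_by (A := tagged c) (amalg3_1 W) (amalg3_3 W) h)
       coef f (amalg3_1 W) (amalg3_2 W) * coef g (amalg3_2 W) (amalg3_3 W) *
       mu h].

Definition perm_one : perm_ob := @PermOb unit (fun=> empty_perm) (fun=> F0).

Definition perm_tens s t : perm_ob :=
  @PermOb (amalgs s t) (@am_ob s t) (fun c => amalg_mem (tagged c)).

Definition perm_tensm s t s' t' (f : perm_hom s t) (f' : perm_hom s' t') :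
    perm_hom (perm_tens s s') (perm_tens t t') :=
  [ffun c : amalgs (perm_tens s s') (perm_tens t t') =>
     coef f (comp_emb (am_l c) (am_l (am_i c)))
            (comp_emb (am_r c) (am_l (am_j c))) *
     coef f' (comp_emb (am_l c) (am_r (am_i c)))
             (comp_emb (am_r c) (am_r (am_j c)))].

(** The structural isomorphisms identify two amalgamations of the same
    permutations: an entry is [1] on an amalgamation in which all the
    corresponding embeddings agree, and [0] otherwise. *)
Definition perm_assoc s t u :
    perm_hom (perm_tens (perm_tens s t) u) (perm_tens s (perm_tens t u)) :=
  [ffun c : amalgs (perm_tens (perm_tens s t) u)
                   (perm_tens s (perm_tens t u)) =>
     let p := am_i c in let q := am_j c in
     [&& agree (fun x : s (am_i (am_i p)) => am_l c (am_l p (am_l (am_i p) x)))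
               (fun x : s (am_i q) => am_r c (am_l q x)),
         agree (fun y : t (am_j (am_i p)) => am_l c (am_l p (am_r (am_i p) y)))
               (fun y : t (am_i (am_j q)) => am_r c (am_r q (am_l (am_j q) y)))
       & agree (fun z : u (am_j p) => am_l c (am_r p z))
               (fun z : u (am_j (am_j q)) => am_r c (am_r q (am_r (am_j q) z)))
     ]%:R].

Definition perm_lunit s : perm_hom (perm_tens perm_one s) s :=
  [ffun c : amalgs (perm_tens perm_one s) s =>
     (agree (fun x : s (am_j (am_i c)) => am_l c (am_r (am_i c) x))
            (am_r c))%:R].

Definition perm_runit s : perm_hom (perm_tens s perm_one) s :=
  [ffun c : amalgs (perm_tens s perm_one) s =>
     (agree (fun x : s (am_i (am_i c)) => am_l c (am_l (am_i c) x))
            (am_r c))%:R].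

Definition perm_braid s t : perm_hom (perm_tens s t) (perm_tens t s) :=
  [ffun c : amalgs (perm_tens s t) (perm_tens t s) =>
     let p := am_i c in let q := am_j c in
     (agree (fun x : s (am_i p) => am_l c (am_l p x))
            (fun x : s (am_j q) => am_r c (am_r q x)) &&
      agree (fun y : t (am_j p) => am_l c (am_r p y))
            (fun y : t (am_i q) => am_r c (am_l q y)))%:R].

Definition perm_data : smc_data k := {|
  ob := perm_ob;
  mor := perm_hom;
  idm := perm_id;
  comp := perm_comp;
  one := perm_one;
  tens := perm_tens;
  tensm := perm_tensm;
  assoc := perm_assoc;
  lunit := perm_lunit;
  runit := perm_runit;
  braid := perm_braid |}.

End Perm.

(* Main.v *)
(** A morphism [Vec_X -> Vec_Y] is a function [f(x, y)] of an embedding [x] of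
    [X] and an embedding [y] of [Y] into a common permutation, depending only on
    the substructure on their images; composition is integration over the middle
    variable with respect to the measure, and axiom (iii) is base change for this
    integral.  Traces are [∫ f(x, x)], so the pairing [tr (g f)] is diagonal in
    the basis of amalgamations [A], with weights [μ(∅ ⊂ A)].

    These weights lie in [{0, 1, -1}]: they are products of values on one-point
    extensions, and such a value is the integral of the indicator of a cell cut
    out by the points of [X], which satisfies quadratic relations coming from the
    quadrants around one and two points of the cell.  Hence on the support the
    trace pairing is perfect over any field.

    Nilpotent endomorphisms have trace zero: in characteristic [p] the cyclic
    group of order [p] acts on the cells of [tr (f^p)], so that
    [tr (f^p) = (tr f)^p]; over the rationals one reduces modulo all primes;
    hence the trace form of the regular representation, an integral matrix, is
    invertible over [Q], so over any field of characteristic zero, and there the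
    trace is the regular trace twisted by a central element.

    A perfect pairing and the vanishing on nilpotents make every morphism [f] of
    the support category von Neumann regular ([f g f = f]), so its Karoubi
    completion is abelian and semi-simple.  Restricting morphisms to the summands
    in the support is a full functor that preserves traces, its kernel is the
    ideal of negligible morphisms, and idempotents lift along it by Fitting's
    lemma. *)
From HB Require Import structures.
From mathcomp Require Import all_boot all_algebra all_fingroup cyclic.
From mathcomp Require Import boolp ring zify.
Require Import Defs.

Set Implicit Arguments.
Unset Strict Implicit.
Unset Printing Implicit Defensive.

Import GRing.Theory.
Local Open Scope ring_scope.

(** * Embeddings and standard permutations *)

Section Embeddings.
Implicit Types X Y Z V W : permutation.

(** An integral is a sum over orbits. A point [x] and the parameters [W] generate a finite
    structure, and an orbit is an isomorphism class of such structures. As permutations have no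
    automorphisms but the identity, any complete list without repetitions computes the sum
    ([integ_index]), and base change, Fubini, composition and trace are comparisons of two such
    lists. The coherence laws need no sums: structural morphisms are graphs of maps of points, and
    composing with a graph is substitution.

    The bound on the weights rests on a constant that does not depend on the cell, the measure [u]
    of the box between two points: integrating chains of three points in two ways shows that a
    quadrant of a cell has measure [0] or [u]. This leaves finitely many arithmetic cases; two of
    them, cells of measure [3] and [-3], are excluded only by relations between three points.

    Duals are arbitrary data in [rigid], so traces must be computed for every candidate unit and
    counit. Both are kernels of two variables, and the zigzag identities say that these kernels are
    mutually inverse. *)

Lemma emb_eq X Y (g h : embedding X Y) : g =1 h -> g = h.
Proof. by move=> H; apply/val_inj/ffunP. Qed.

Lemma mk_embE X Y (f : X -> Y) (fP : is_emb f) : mk_emb fP =1 f.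
Proof. by move=> x; rewrite /emb_fun /= ffunE. Qed.

Lemma comp_embE X Y Z (g : embedding Y Z) (f : embedding X Y) x :
  comp_emb g f x = g (f x).
Proof. exact: mk_embE. Qed.

Lemma emb_inj X Y (h : embedding X Y) : injective h.
Proof. by have /andP[/injectiveP] := valP h. Qed.

Lemma emb_lt1 X Y (h : embedding X Y) x y : lt1 (h x) (h y) = lt1 x y.
Proof. by have /andP[_ /forallP/(_ x)/forallP/(_ y)/andP[/eqP]] := valP h. Qed.

Lemma emb_lt2 X Y (h : embedding X Y) x y : lt2 (h x) (h y) = lt2 x y.
Proof. by have /andP[_ /forallP/(_ x)/forallP/(_ y)/andP[_ /eqP]] := valP h. Qed.

(** Injectivity comes for free: distinct points are comparable, so their images are comparable,
    hence distinct by irreflexivity. *)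
Lemma monotone_is_emb X Y (f : X -> Y) :
  (forall x y, lt1 (f x) (f y) = lt1 x y) ->
  (forall x y, lt2 (f x) (f y) = lt2 x y) -> is_emb f.
Proof.
move=> f1 f2; apply/andP; split; last first.
  by apply/forallP=> x; apply/forallP=> y; rewrite f1 f2 !eqxx.
apply/injectiveP => x y E; apply/eqP; apply/negPn/negP => xy.
have [_ _ T] := lt1_total X; have [irr _ _] := lt1_total Y.
by have := T _ _ xy; rewrite -!f1 E !irr.
Qed.

Lemma is_emb_id X : is_emb (fun x : X => x).
Proof. exact: monotone_is_emb. Qed.

Definition id_emb X : embedding X X := mk_emb (is_emb_id X).

Lemma id_embE X x : id_emb X x = x.
Proof. exact: mk_embE. Qed.

Lemma comp_embA X Y Z V (h : embedding Z V) (g : embedding Y Z)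
    (f : embedding X Y) : comp_emb h (comp_emb g f) = comp_emb (comp_emb h g) f.
Proof. by apply: emb_eq => x; rewrite !comp_embE. Qed.

Lemma comp_id_emb X Y (f : embedding X Y) : comp_emb (id_emb Y) f = f.
Proof. by apply: emb_eq => x; rewrite comp_embE id_embE. Qed.

Lemma comp_emb_id X Y (f : embedding X Y) : comp_emb f (id_emb X) = f.
Proof. by apply: emb_eq => x; rewrite comp_embE id_embE. Qed.

Lemma comp_emb_inj X Y Z (h : embedding Y Z) (f g : embedding X Y) :
  comp_emb h f = comp_emb h g -> f = g.
Proof.
move=> E; apply: emb_eq => x; apply: (@emb_inj _ _ h).
by rewrite -!comp_embE E.
Qed.

Lemma emb_empty_unique X (f g : embedding empty_perm X) : f = g.
Proof. by apply: emb_eq => -[]. Qed.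

(** An embedding reflects both orders, so any set-theoretic lift through [g] is again an
    embedding. *)
Lemma emb_factor U V V' (g : embedding V V') (h : embedding U V') :
  (forall u, exists v, g v = h u) -> exists h', comp_emb g h' = h.
Proof.
move=> /choice[f fE].
have fP : is_emb f.
  by apply: monotone_is_emb => x y; rewrite -(emb_lt1 g, emb_lt2 g) !fE
     (emb_lt1, emb_lt2).
by exists (mk_emb fP); apply: emb_eq => x; rewrite comp_embE mk_embE.
Qed.

Lemma emb_surj_inv U V (g : embedding U V) :
  (forall v, exists u, g u = v) ->
  exists g', comp_emb g g' = id_emb V /\ comp_emb g' g = id_emb U.
Proof.
move=> gs; have [|g' E] := @emb_factor _ _ _ g (id_emb V).
  by move=> v; rewrite id_embE.
exists g'; split=> //; apply: (@comp_emb_inj _ _ _ g).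
by rewrite comp_embA E comp_id_emb comp_emb_id.
Qed.

Lemma emb_surj_bij U V (g : embedding U V) :
  (forall v, exists u, g u = v) -> bijective g.
Proof.
move=> /emb_surj_inv[g' [E E']]; exists g' => x; rewrite -comp_embE ?E ?E' id_embE //.
Qed.

(** * Substructures, ranks and the rigidity of standard permutations *)

Section SubPerm.
Variables (V : permutation) (U : {set V}).

Lemma sub_total (r : rel V) : strict_total r ->
  strict_total (fun x y : {v | v \in U} => r (val x) (val y)).
Proof.
case=> r1 r2 r3; split=> [x|y x z|x y]; [exact: r1 | exact: r2 | move=> xy].
exact: r3.
Qed.

Definition sub_perm : permutation :=
  @Permutation {v | v \in U} _ _ (sub_total (@lt1_total V))
     (sub_total (@lt2_total V)).

Lemma is_emb_val : @is_emb sub_perm V val.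
Proof. exact: monotone_is_emb. Qed.
Definition sub_emb : embedding sub_perm V := mk_emb is_emb_val.
End SubPerm.

Section Rank.
Variables (T : finType) (r : rel T).
Hypothesis rP : strict_total r.

Lemma rank_subproof (x : T) : (#|[pred y | r y x]| < #|T|)%N.
Proof.
have [irr _ _] := rP.
apply/proper_card/properP; split; first by apply/subsetP.
by exists x; rewrite // inE irr.
Qed.

Definition rank x : 'I_#|T| := Ordinal (rank_subproof x).

Lemma rank_lt x y : (rank x < rank y)%N = r x y.
Proof.
have [irr tr tot] := rP.
have mono a b : r a b -> (rank a < rank b)%N.
  move=> ab; apply/proper_card/properP; split.
    by apply/subsetP=> z; rewrite !inE => /tr; apply.
  by exists a; rewrite !inE ?irr.
apply/idP/idP => [|/mono//]; case: (eqVneq x y) => [->|/tot/orP[//|/mono]].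
  by rewrite ltnn.
by move=> H H'; have := ltn_trans H H'; rewrite ltnn.
Qed.

Lemma rank_inj : injective rank.
Proof.
have [irr tr tot] := rP.
move=> x y E; apply/eqP/negPn/negP => /tot.
by rewrite -!rank_lt E ltnn.
Qed.
End Rank.

(** Points are numbered by their rank for the first order; the rank for the second order, read in
    this numbering, is the permutation [s]. *)
Lemma std_iso V : exists (s : 'S_#|V|) (g : embedding (std s) V),
  forall v, exists x, g x = v.
Proof.
have [r1I r2I] := (@rank_inj _ _ (@lt1_total V), @rank_inj _ _ (@lt2_total V)).
have r1B : bijective (rank (@lt1_total V)).
  by apply: inj_card_bij => //; rewrite card_ord.
case: r1B => f K1 K2.
have fI : injective (fun x => rank (@lt2_total V) (f x)).
  by move=> x y /r2I /(can_inj K2).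
pose s : 'S_#|V| := perm fI.
have gP : @is_emb (std s) V f.
  apply: monotone_is_emb => x y /=.
    by rewrite -(rank_lt (@lt1_total V)) !K2.
  by rewrite !permE !rank_lt.
exists s, (mk_emb gP) => v; exists (rank (@lt1_total V) v).
by rewrite mk_embE K1.
Qed.

Lemma std_set V (U : {set V}) : exists (s : 'S_#|U|) (g : embedding (std s) V),
  forall v, (v \in U) <-> exists x, g x = v.
Proof.
have [] := std_iso (sub_perm U).
have -> : #|sub_perm U| = #|U| by rewrite /= card_sig; apply: eq_card.
move=> s [g gs]; exists s, (comp_emb (sub_emb U) g) => v; split.
  move=> vU; have [x gx] := gs (exist _ v vU); exists x.
  by rewrite comp_embE mk_embE gx.
by case=> x <-; rewrite comp_embE mk_embE; exact: (valP (g x)).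
Qed.

(** An embedding is strictly increasing for the first order. Applied also to the inverse, the
    inequality forces the identity in [std_rigid]. *)
Lemma std_leq n (s t : 'S_n) (g : embedding (std s) (std t)) (x : 'I_n) :
  (x <= (g x : 'I_n))%N.
Proof.
case: x => m; elim: m => [//|m IH] mn.
have mn' : (m < n)%N := ltnW mn.
apply: leq_ltn_trans (IH mn') _.
by have := emb_lt1 g (Ordinal mn' : std s) (Ordinal mn : std s); rewrite /= ltnSn.
Qed.

Lemma std_rigid n (s t : 'S_n) (g : embedding (std s) (std t)) :
  s = t /\ forall x, g x = x :> 'I_n.
Proof.
have gs : forall v : std t, exists u : std s, g u = v.
  move=> v; have := inj_card_onto (@emb_inj _ _ g) (leqnn _) v.
  by case/codomP => u ->; exists u.
have gE x : g x = x :> 'I_n.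
  have [g' [E1 E2]] := emb_surj_inv gs.
  apply/val_inj/eqP; rewrite eqn_leq std_leq andbT.
  have := std_leq g' (g x); rewrite -comp_embE E2 id_embE //.
split=> //.
have st x y : (s x < s y)%N = (t x < t y)%N.
  by have := emb_lt2 g x y; rewrite /= !gE.
apply/permP => x; apply: (@rank_inj _ _ (@strict_total_ord n id (@inj_id _))).
apply/val_inj => /=.
(* The value [u x] is the number of values below it, and this number depends only on the order that
   [u] induces. *)
have H (u : 'S_n) : #|[pred y : 'I_n | (y < u x)%N]| =
    #|[pred y : 'I_n | (u y < u x)%N]|.
  rewrite -(card_image (@perm_inj _ u) [pred y : 'I_n | (u y < u x)%N]).
  apply: eq_card => y; rewrite inE.
  apply/idP/imageP => [yx|[z]]; last by rewrite inE => zx ->.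
  by exists ((u^-1)%g y); rewrite ?inE permKV.
by rewrite !H; apply: eq_card => y; rewrite !inE st.
Qed.
End Embeddings.

#[local] Opaque emb_fun comp_emb.

Lemma std_size n m (s : 'S_n) (t : 'S_m) (g : embedding (std s) (std t)) :
  (forall y, exists x, g x = y) -> n = m.
Proof. by move=> /emb_surj_bij /bij_eq_card; rewrite !card_ord. Qed.

(** Two enumerations are usually related only by the existence of an isomorphism, so the bijection
    between them is given as a relation that is total and single-valued both ways. *)
Lemma sum_match (R : nmodType) (I J : finType) (P : pred I) (Q : pred J)
    (rel : I -> J -> bool) (a : I -> R) (b : J -> R) :
  (forall i, P i -> exists j, Q j /\ rel i j) ->
  (forall j, Q j -> exists i, P i /\ rel i j) ->
  (forall i j j', P i -> Q j -> Q j' -> rel i j -> rel i j' -> j = j') ->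
  (forall i i' j, P i -> P i' -> Q j -> rel i j -> rel i' j -> i = i') ->
  (forall i j, P i -> Q j -> rel i j -> a i = b j) ->
  \sum_(i | P i) a i = \sum_(j | Q j) b j.
Proof.
move=> eI eJ uI uJ ab.
transitivity (\sum_(i | P i) \sum_(j | Q j && rel i j) a i).
  apply: eq_bigr => i Pi; have [j [Qj ij]] := eI _ Pi.
  rewrite (big_pred1 j) // => j'; apply/andP/eqP => [[Qj' ij']|-> //].
  exact: (uI i).
rewrite (exchange_big_dep Q) /=; last by move=> i j _ /andP[].
apply: eq_bigr => j Qj; have [i [Pi ij]] := eJ _ Qj.
rewrite (big_pred1 i) ?(ab i j) // => i'.
rewrite /= Qj /=; apply/andP/eqP => [[Pi' ij']|-> //].
exact: (uJ i' i j).
Qed.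

(** * Standard representatives of marked permutations *)

Section Marked.
Variable S : finType.

Lemma mark_surjP (c : marked S) :
  reflect (forall w, exists z, mark c z = w) (mark_surj c).
Proof.
apply: (iffP forallP) => H w; first by have /existsP[z /eqP] := H w; exists z.
by have [z <-] := H w; apply/existsP; exists z.
Qed.

Lemma marked_complete (V : permutation) (m : S -> V) : exists c : marked S,
  mark_surj c /\
  exists g : embedding (marked_perm c) V, forall z, g (mark c z) = m z.
Proof.
pose U := [set m z | z : S].
have [s [g gU]] := std_set U.
have Un : (#|U| < #|S|.+1)%N by rewrite ltnS leq_imset_card.
have /choice[f fE] : forall z, exists x, g x = m z.
  by move=> z; apply/gU/imset_f.
pose c : marked S :=
  @Tagged 'I_#|S|.+1 (Ordinal Un) (fun n : 'I_#|S|.+1 => ('S_n * {ffun S -> 'I_n})%type)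
    (s, [ffun z => f z]).
have mE z : mark c z = f z by rewrite /mark /= ffunE.
exists c; split; last by exists g => z; rewrite mE fE.
apply/mark_surjP => w.
have /gU/imsetP[z _ gw] : exists x, g x = g w by exists w.
by exists z; rewrite mE; apply: (@emb_inj _ _ g); rewrite fE gw.
Qed.

(** Standard permutations have no isomorphism but the identity, so a representative is determined by
    its class. *)
Lemma marked_rigid (c d : marked S) (g : embedding (marked_perm c) (marked_perm d)) :
  mark_surj d -> (forall z, g (mark c z) = mark d z) -> c = d.
Proof.
case: c d g => n [s m] [n' [s' m']] g /mark_surjP sd gm.
have nn' : n = n'.
  apply/val_inj/(@std_size _ _ _ _ g) => y; have [z <-] := sd y.
  by exists (mark (Tagged _ (s, m) : marked S) z).
subst n'; have [ss' gE] := std_rigid g.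
have mm' : m = m' by apply/ffunP => z; rewrite -[LHS](gE (m z)); exact: gm.
by rewrite /= in ss'; rewrite ss' mm'.
Qed.
End Marked.

(** * Completeness of the enumerations of amalgamations *)

Definition hereditary (F : permutation -> Prop) :=
  forall X Y (h : embedding X Y), F Y -> F X.

Section AmalgComplete.
Variable F : permutation -> Prop.
Hypothesis F_her : hereditary F.

Section Amalg.
Variables (Y X Y' : permutation) (i : embedding Y X) (j : embedding Y Y').

Lemma amalg_agree (A : amalg F i j) :
  comp_emb (amalg_l A) i = comp_emb (amalg_r A) j.
Proof.
apply: emb_eq => y; rewrite !comp_embE !mk_embE.
by case/and5P: (valP A) => _ _ _ /forallP/(_ y)/eqP.
Qed.

Lemma amalg_cover (A : amalg F i j) w :
  (exists x, amalg_l A x = w) \/ (exists y, amalg_r A y = w).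
Proof.
case/and5P: (valP A) => _ _ /mark_surjP/(_ w)[[x|y] <-] _ _.
  by left; exists x; rewrite mk_embE.
by right; exists y; rewrite mk_embE.
Qed.

(** The union of the two images inside [V] is the amalgamation; heredity puts it in [F]. *)
Lemma amalg_complete V (a : embedding X V) (b : embedding Y' V) : F V ->
  comp_emb a i = comp_emb b j -> exists (A : amalg F i j)
    (g : embedding (amalg_perm A) V),
    comp_emb g (amalg_l A) = a /\ comp_emb g (amalg_r A) = b.
Proof.
move=> FV ab.
pose m (z : X + Y') := match z with inl x => a x | inr y => b y end.
have [c [cs [g gm]]] := marked_complete m.
have cP : [&& is_emb (fun x => mark c (inl x)), is_emb (fun y => mark c (inr y)),
      mark_surj c, [forall y, mark c (inl (i y)) == mark c (inr (j y))]
      & `[< F (marked_perm c) >] ].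
  rewrite cs /=; apply/and4P; split; last by apply/asboolP/(F_her g).
  - by apply: monotone_is_emb => x y; rewrite -(emb_lt1 g, emb_lt2 g) !gm
      (emb_lt1, emb_lt2).
  - by apply: monotone_is_emb => x y; rewrite -(emb_lt1 g, emb_lt2 g) !gm
      (emb_lt1, emb_lt2).
  - apply/forallP => y; apply/eqP/(@emb_inj _ _ g); rewrite !gm /=.
    by rewrite -!comp_embE ab.
exists (exist _ c cP), g; split; apply: emb_eq => z; rewrite comp_embE mk_embE;
  exact: gm.
Qed.

Lemma amalg_rigid (A B : amalg F i j)
    (g : embedding (amalg_perm A) (amalg_perm B)) :
  comp_emb g (amalg_l A) = amalg_l B -> comp_emb g (amalg_r A) = amalg_r B ->
  A = B.
Proof.
move=> gl gr; apply/val_inj/(@marked_rigid _ (val A) (val B) g).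
  by case/and5P: (valP B).
case=> z.
  by have := congr1 (fun h : embedding _ _ => h z) gl; rewrite comp_embE !mk_embE.
by have := congr1 (fun h : embedding _ _ => h z) gr; rewrite comp_embE !mk_embE.
Qed.
End Amalg.

Section Amalg3.
Variables X Y Z : permutation.

Lemma amalg3_cover (A : amalg3 F X Y Z) w :
  [\/ exists x, amalg3_1 A x = w, exists y, amalg3_2 A y = w |
      exists z, amalg3_3 A z = w].
Proof.
case/and5P: (valP A) => _ _ _ /mark_surjP/(_ w)[[[x|y]|z] <-] _.
- by apply: Or31; exists x; rewrite mk_embE.
- by apply: Or32; exists y; rewrite mk_embE.
- by apply: Or33; exists z; rewrite mk_embE.
Qed.

Lemma amalg3_mem (A : amalg3 F X Y Z) : F (amalg3_perm A).
Proof. by case/and5P: (valP A) => _ _ _ _ /asboolP. Qed.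

Lemma amalg3_complete V (a : embedding X V) (b : embedding Y V)
    (c : embedding Z V) : F V -> exists (A : amalg3 F X Y Z)
    (g : embedding (amalg3_perm A) V),
    [/\ comp_emb g (amalg3_1 A) = a, comp_emb g (amalg3_2 A) = b &
        comp_emb g (amalg3_3 A) = c].
Proof.
move=> FV.
pose m (z : X + Y + Z) :=
  match z with inl (inl x) => a x | inl (inr y) => b y | inr z => c z end.
have [d [ds [g gm]]] := marked_complete m.
have dP : [&& is_emb (fun x => mark d (inl (inl x))),
        is_emb (fun y => mark d (inl (inr y))),
        is_emb (fun z => mark d (inr z)),
        mark_surj d & `[< F (marked_perm d) >] ].
  rewrite ds /=; apply/and4P; split; last by apply/asboolP/(F_her g).
  - by apply: monotone_is_emb => x y; rewrite -(emb_lt1 g, emb_lt2 g) !gm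
      (emb_lt1, emb_lt2).
  - by apply: monotone_is_emb => x y; rewrite -(emb_lt1 g, emb_lt2 g) !gm
      (emb_lt1, emb_lt2).
  - by apply: monotone_is_emb => x y; rewrite -(emb_lt1 g, emb_lt2 g) !gm
      (emb_lt1, emb_lt2).
exists (exist _ d dP), g; split; apply: emb_eq => z; rewrite comp_embE mk_embE;
  exact: gm.
Qed.

Lemma amalg3_rigid (A B : amalg3 F X Y Z)
    (g : embedding (amalg3_perm A) (amalg3_perm B)) :
  comp_emb g (amalg3_1 A) = amalg3_1 B -> comp_emb g (amalg3_2 A) = amalg3_2 B ->
  comp_emb g (amalg3_3 A) = amalg3_3 B -> A = B.
Proof.
move=> g1 g2 g3; apply/val_inj/(@marked_rigid _ (val A) (val B) g).
  by case/and5P: (valP B).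
case=> [[]|] z.
- by have := congr1 (fun h : embedding _ _ => h z) g1; rewrite comp_embE !mk_embE.
- by have := congr1 (fun h : embedding _ _ => h z) g2; rewrite comp_embE !mk_embE.
- by have := congr1 (fun h : embedding _ _ => h z) g3; rewrite comp_embE !mk_embE.
Qed.
End Amalg3.
End AmalgComplete.

(** [amalg F] and [amalg F'] are different types over the same marked permutations, hence the
    matching through [val]. This passes axiom (iii) to a subclass once the other terms vanish. *)
Lemma sum_amalg_sub (R : nmodType) (F F' : permutation -> Prop) Y X Y'
    (i : embedding Y X) (j : embedding Y Y') (phi : forall V, embedding Y' V -> R) :
  (forall V, F' V -> F V) ->
  \sum_(A : amalg F i j | `[< F' (amalg_perm A) >]) phi _ (amalg_r A) =
  \sum_(B : amalg F' i j) phi _ (amalg_r B).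
Proof.
move=> sub; apply: (sum_match (rel := fun A B => val A == val B)).
- case=> c cP /asboolP F'c; have cP' := cP.
  case/and5P: cP' => p1 p2 p3 p4 _.
  have cP' : [&& is_emb (fun x => mark c (inl x)), is_emb (fun y => mark c (inr y)),
      mark_surj c, [forall y, mark c (inl (i y)) == mark c (inr (j y))]
    & `[< F' (marked_perm c) >] ] by apply/and5P; split=> //; apply/asboolP.
  by exists (exist _ c cP').
- case=> c cP _; have /and5P[p1 p2 p3 p4 /asboolP F'c] := cP.
  have cP' : [&& is_emb (fun x => mark c (inl x)), is_emb (fun y => mark c (inr y)),
      mark_surj c, [forall y, mark c (inl (i y)) == mark c (inr (j y))]
    & `[< F (marked_perm c) >] ].
    by apply/and5P; split=> //; apply/asboolP; exact: sub.
  by exists (exist _ c cP'); split=> //; apply/asboolP.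
- by move=> A B B' _ _ _ /eqP AB /eqP AB'; apply: val_inj; rewrite -AB -AB'.
- by move=> A A' B _ _ _ /eqP AB /eqP AB'; apply: val_inj; rewrite AB AB'.
case=> c cP [c' cP'] _ _ /eqP /= E; subst c'; congr (phi _ _).
by apply: emb_eq => y; rewrite /amalg_r !mk_embE.
Qed.

#[local] Opaque amalg_l amalg_r amalg3_1 amalg3_2 amalg3_3 emb_empty.

(** * Integration against a measure *)

(** A functorial family of finite sets [spt V] of "points", each point being
    defined over a finite subset of [V]. *)
Record species := Species {
  spt :> permutation -> finType;
  smap : forall V V', embedding V V' -> spt V -> spt V';
  supp : forall V, spt V -> {set V};
  sbound : nat;
  smap_comp : forall U V W (g : embedding V W) (f : embedding U V) x,
    smap (comp_emb g f) x = smap g (smap f x);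
  smap_inj : forall V V' (g : embedding V V'), injective (smap g);
  supp_map : forall V V' (g : embedding V V') x,
    supp (smap g x) = g @: supp x;
  supp_desc : forall V V' (g : embedding V V') (x : spt V'),
    (forall v, v \in supp x -> exists u, g u = v) -> exists x', smap g x' = x;
  supp_bound : forall V (x : spt V), (#|supp x| <= sbound)%N }.

(** The identity law is not an axiom of [species]: it follows from the composition law and
    injectivity. *)
Lemma smap_id (T : species) V (x : T V) : smap (id_emb V) x = x.
Proof.
by apply: (@smap_inj T _ _ (id_emb V)); rewrite -smap_comp comp_id_emb.
Qed.

Lemma std_complete (V : permutation) (U : {set V}) b : (#|U| <= b)%N ->
  exists (n : 'I_b.+1) (s : 'S_n) (g : embedding (std s) V),
    forall v, (v \in U) <-> exists x, g x = v.
Proof.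
move=> Ub; have Ub' : (#|U| < b.+1)%N by [].
by have [s [g gU]] := std_set U; exists (Ordinal Ub'), s, g.
Qed.

Section Integral.
Variables (R : comPzRingType) (F : permutation -> Prop) (mu : emb_function R).
Hypotheses (F_her : hereditary F) (muP : is_measure F mu).

Lemma measure_surj X Y Z (g : embedding Y Z) (f : embedding X Y) :
  F X -> F Y -> F Z -> (forall z, exists y, g y = z) ->
  mu (comp_emb g f) = mu f.
Proof.
move=> FX FY FZ gs; rewrite (measure_comp muP) // (measure_iso muP) ?mul1r //.
exact: emb_surj_bij.
Qed.

Section Cells.
Variables (W : permutation) (T : species).

(** A structure generated by [W] and one point has at most [#|W| + sbound T] elements; this bound
    makes cells a finite type. The good cells represent the orbits of points of [T] over [W], each
    exactly once. *)
Definition cell :=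
  {n : 'I_(#|W| + sbound T).+1 &
     {s : 'S_n & (embedding W (std s) * T (std s))%type}}.
HB.instance Definition _ := Finite.on cell.

Definition cell_perm (c : cell) : permutation := std (tag (tagged c)).
Definition cell_l (c : cell) : embedding W (cell_perm c) :=
  (tagged (tagged c)).1.
Definition cell_r (c : cell) : T (cell_perm c) := (tagged (tagged c)).2.

Definition gen V (e : embedding W V) (x : T V) : Prop :=
  forall v, (exists w, e w = v) \/ v \in supp x.

Definition good (c : cell) : bool :=
  `[< gen (cell_l c) (cell_r c) /\ F (cell_perm c) >].

Lemma good_gen c : good c -> gen (cell_l c) (cell_r c).
Proof. by move=> /asboolP[]. Qed.
Lemma good_mem c : good c -> F (cell_perm c).
Proof. by move=> /asboolP[]. Qed.

Lemma gen_map V V' (g : embedding V V') (e : embedding W V) (x : T V) :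
  gen (comp_emb g e) (smap g x) -> forall v, exists u, g u = v.
Proof.
move=> H v; case: (H v) => [[w]|].
  by rewrite comp_embE => <-; exists (e w).
by rewrite supp_map => /imsetP[u _ ->]; exists u.
Qed.

Lemma cell_complete V (e : embedding W V) (x : T V) : F V ->
  exists c, good c /\ exists g : embedding (cell_perm c) V,
    comp_emb g (cell_l c) = e /\ smap g (cell_r c) = x.
Proof.
move=> FV; pose U := [set e w | w : W] :|: supp x.
have Ub : (#|U| <= #|W| + sbound T)%N.
  apply: leq_trans (leq_card_setU _ _) _; apply: leq_add (supp_bound _).
  exact: leq_imset_card.
have [n [s [g gU]]] := std_complete Ub.
have [|e' ee'] := @emb_factor _ _ _ g e.
  by move=> w; apply/gU; rewrite inE imset_f.
have [|x' xx'] := @supp_desc T _ _ g x.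
  by move=> v vx; apply/gU; rewrite inE vx orbT.
pose c : cell := Tagged _ (Tagged (fun s : 'S_n => (embedding W (std s) * T (std s))%type) (e', x')).
exists c; split; last by exists g.
apply/asboolP; split; last exact: (F_her g).
move=> v; have : g v \in U by apply/gU; exists v.
rewrite inE => /orP[/imsetP[w _]|]; rewrite -?ee' -?xx' ?comp_embE.
  by move=> /emb_inj ->; left; exists w.
by rewrite supp_map => /imsetP[u ux] /emb_inj ->; right.
Qed.

Lemma cell_rigid c d (g : embedding (cell_perm c) (cell_perm d)) :
  good d -> comp_emb g (cell_l c) = cell_l d -> smap g (cell_r c) = cell_r d ->
  c = d.
Proof.
move=> /good_gen; case: c d g => n [s [e x]] [n' [s' [e' x']]] g gd ge gx.
have gs : forall v, exists u, g u = v.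
  by apply: (@gen_map _ _ g e x); rewrite /= in gx ge *; rewrite gx ge.
have nn' : n = n' by apply/val_inj/(std_size gs).
subst n'; have [ss' gE] := std_rigid g; rewrite /= in ss'; subst s'.
have gi : g = id_emb (std s) by apply: emb_eq => z; rewrite id_embE; exact: gE.
have ee' : e = e' by rewrite -[RHS]ge gi comp_id_emb.
have xx' : x = x' by rewrite -[RHS]gx gi smap_id.
by rewrite ee' xx'.
Qed.
End Cells.

Definition family W (T : species) :=
  forall V : permutation, embedding W V -> T V -> R.

(** Invariance is asked only inside [F]: kernels built with [pselect] take a default value
    elsewhere. *)
Definition natural W (T : species) (phi : family W T) : Prop :=
  forall V V' (g : embedding V V') (e : embedding W V) (x : T V), F V' ->
    phi V' (comp_emb g e) (smap g x) = phi V e x.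

(** The integral over [x] relative to the parameters [W]: each orbit contributes its measure
    [mu (cell_l c)] times the value of [phi] on it. *)
Definition integ W (T : species) (phi : family W T) : R :=
  \sum_(c : cell W T | good c)
    mu (cell_l c) * phi (cell_perm c) (cell_l c) (cell_r c).

(** The value does not depend on how orbits are enumerated: a list of generated pairs that is
    complete and free of repetitions matches the standard cells, and isomorphic cells have equal
    measure by [measure_surj]. *)
Lemma integ_index W (T : species) (phi : family W T) (I : finType) (Q : pred I)
    (P : I -> permutation) (e : forall i, embedding W (P i))
    (x : forall i, T (P i)) :
  F W -> natural phi ->
  (forall i, Q i -> F (P i)) -> (forall i, Q i -> gen (e i) (x i)) ->
  (forall V (a : embedding W V) (b : T V), F V -> exists i, Q i /\
     exists g : embedding (P i) V, comp_emb g (e i) = a /\ smap g (x i) = b) ->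
  (forall i j (g : embedding (P i) (P j)), Q i -> Q j ->
     comp_emb g (e i) = e j -> smap g (x i) = x j -> i = j) ->
  integ phi = \sum_(i | Q i) mu (e i) * phi (P i) (e i) (x i).
Proof.
move=> FW nphi FP geni compl rig.
pose rel (c : cell W T) (i : I) := `[< exists g : embedding (P i) (cell_perm c),
   comp_emb g (e i) = cell_l c /\ smap g (x i) = cell_r c >].
have relP c i : good c -> rel c i -> exists (g : embedding (P i) (cell_perm c))
    (g' : embedding (cell_perm c) (P i)),
    [/\ comp_emb g (e i) = cell_l c, smap g (x i) = cell_r c,
      comp_emb g' (cell_l c) = e i, smap g' (cell_r c) = x i &
      forall v, exists u, g u = v].
  move=> gc /asboolP[g [ge gx]].
  have gs : forall v, exists u, g u = v.
    by apply: (@gen_map _ T _ _ g (e i) (x i)); rewrite ge gx; apply: good_gen.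
  have [g' [_ E]] := emb_surj_inv gs; exists g, g'.
  by rewrite -ge -gx comp_embA -smap_comp E comp_id_emb smap_id.
rewrite /integ; apply: (sum_match (rel := rel)).
- move=> c gc; have [i [Qi H]] := compl _ (cell_l c) (cell_r c) (good_mem gc).
  by exists i; split=> //; apply/asboolP.
- move=> i Qi; have [c [gc [g [gl gr]]]] := cell_complete (e i) (x i) (FP _ Qi).
  have gs : forall v, exists u, g u = v.
    by apply: (@gen_map _ T _ _ g (cell_l c) (cell_r c)); rewrite gl gr; apply: geni.
  have [g' [_ E]] := emb_surj_inv gs.
  exists c; split=> //; apply/asboolP; exists g'.
  by rewrite -gl -gr comp_embA -smap_comp E comp_id_emb smap_id.
- move=> c i j gc Qi Qj /(relP _ _ gc)[g [_ [gl gr _ _ _]]].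
  move=> /(relP _ _ gc)[_ [h' [_ _ hl hr _]]].
  apply: (rig _ _ (comp_emb h' g)) => //; first by rewrite -comp_embA gl.
  by rewrite smap_comp gr.
- move=> c d i gc gd Qi /(relP _ _ gc)[_ [h' [_ _ hl hr _]]].
  move=> /(relP _ _ gd)[g [_ [gl gr _ _ _]]].
  apply: (@cell_rigid _ _ c d (comp_emb g h')) => //.
    by rewrite -comp_embA hl.
  by rewrite smap_comp hr.
move=> c i gc Qi /(relP _ _ gc)[g [_ [gl gr _ _ gs]]].
rewrite -gl -gr nphi ?measure_surj //; [exact: FP| |]; exact: good_mem.
Qed.

Lemma eq_integ W (T : species) (phi psi : family W T) :
  (forall V e x, F V -> phi V e x = psi V e x) -> integ phi = integ psi.
Proof.
by move=> H; apply: eq_bigr => c gc; rewrite H //; apply: good_mem.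
Qed.

Lemma integZ W (T : species) a (phi : family W T) :
  integ (fun V e x => a * phi V e x) = a * integ phi.
Proof. by rewrite mulr_sumr; apply: eq_bigr => c _; rewrite mulrCA. Qed.

Lemma integD W (T : species) (phi psi : family W T) :
  integ (fun V e x => phi V e x + psi V e x) = integ phi + integ psi.
Proof. by rewrite -big_split; apply: eq_bigr => c _; rewrite mulrDr. Qed.

Lemma integ0 W (T : species) : integ (fun V (e : embedding W V) (x : T V) => 0) = 0.
Proof. by rewrite /integ big1 // => c _; rewrite mulr0. Qed.

(** The orbit of [x0] is a single cell: it adds nothing to [W], so its structure map is an
    isomorphism, of measure [1]. *)
Lemma integ_delta W (T : species) (phi : family W T) (x0 : T W) :
  F W -> natural phi ->
  integ (fun V e x => (smap e x0 == x)%:R * phi V e x) = phi W (id_emb W) x0.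
Proof.
move=> FW nphi.
transitivity (\sum_(i : unit | true) phi W (id_emb W) x0); last first.
  by rewrite (big_pred1 tt) // => -[].
rewrite /integ.
under eq_bigr do rewrite mulrCA mulr_natl mulrb.
rewrite -big_mkcondr /=.
pose rel (c : cell W T) (i : unit) := true.
have P c : good c && (smap (cell_l c) x0 == cell_r c) ->
    forall v, exists u, cell_l c u = v.
  move=> /andP[gc /eqP xc].
  apply: (@gen_map W T _ _ (cell_l c) (id_emb W) x0); rewrite comp_emb_id xc.
  exact: good_gen.
apply: (sum_match (rel := rel)); rewrite {}/rel.
- by move=> c _; exists tt.
- move=> _ _; have [c [gc [g [gl gr]]]] := cell_complete (id_emb W) x0 FW.
  exists c; rewrite gc /=; split=> //; apply/eqP/(@smap_inj T _ _ g).
  by rewrite gr -smap_comp gl smap_id.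
- by move=> ? [] [].
- move=> c d _ /[dup] gc /P /emb_surj_inv[g [_ E]] gd _ _ _.
  apply: (@cell_rigid _ _ c d (comp_emb (cell_l d) g)).
  + by case/andP: gd.
  + by rewrite -comp_embA E comp_emb_id.
  case/andP: gc => _ /eqP <-; case/andP: gd => _ /eqP <-.
  by rewrite -smap_comp -comp_embA E comp_emb_id.
move=> c _ /[dup] Pc /andP[gc /eqP <-] _ _.
have FC := good_mem gc.
have := @measure_surj _ _ _ (cell_l c) (id_emb W) FW FW FC (P _ Pc).
rewrite comp_emb_id (measure_iso muP (i := id_emb W)) //; last first.
  by exists id => x; rewrite id_embE.
by move=> ->; rewrite mul1r -{1}(comp_emb_id (cell_l c)) nphi.
Qed.

(** Over [W2], a cell [c] over [W] breaks up into the amalgamations of [cell_l c] with [j]; axiom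
    (iii) says that their measures add up to that of [c]. *)
Lemma integ_basechange W W2 (T : species) (j : embedding W W2) (phi : family W T) :
  F W -> F W2 -> natural phi ->
  integ (fun V (e : embedding W2 V) x => phi V (comp_emb e j) x) = integ phi.
Proof.
move=> FW FW2 nphi.
pose I := {c : cell W T & amalg F (cell_l c) j}.
rewrite (@integ_index W2 T _ I (fun i => good (tag i))
  (fun i => amalg_perm (tagged i)) (fun i => amalg_r (tagged i))
  (fun i => smap (amalg_l (tagged i)) (cell_r (tag i)))) //; first last.
- move=> [c A] [d B] g /= gc gd gr gx.
  (* The images of [c] and of [d] are generated by the same elements of the second amalgamation.
     This gives [c = d], without which the two amalgamations have different types. *)
  have Hf : forall u, exists v, amalg_l B v = comp_emb g (amalg_l A) u.
    move=> u; case: (good_gen gc u) => [[w <-]|ux].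
      exists (cell_l d w); rewrite -!comp_embE.
      by rewrite -comp_embA !amalg_agree comp_embA gr.
    have : comp_emb g (amalg_l A) u \in supp (smap (comp_emb g (amalg_l A)) (cell_r c)).
      by rewrite supp_map imset_f.
    by rewrite smap_comp gx supp_map => /imsetP[v _ ->]; exists v.
  have [k kE] := emb_factor Hf.
  have cd : c = d.
    apply: (@cell_rigid _ _ c d k) => //.
      apply: (@comp_emb_inj _ _ _ (amalg_l B)).
      by rewrite comp_embA kE -comp_embA !amalg_agree comp_embA gr.
    by apply: (@smap_inj T _ _ (amalg_l B)); rewrite -smap_comp kE smap_comp.
  subst d; congr (Tagged _ _); apply: (@amalg_rigid F _ _ _ _ _ A B g) => //.
  have [_ E] := std_rigid k.
  rewrite -kE; apply: emb_eq => z; rewrite comp_embE; congr (amalg_l B _).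
  exact: E.
- move=> V a b FV.
  have [c [gc [g [gl gr]]]] := cell_complete (comp_emb a j) b FV.
  have [A [h [hl hr]]] := amalg_complete F_her FV gl.
  exists (Tagged (fun c => amalg F (cell_l c) j) A); split=> //; exists h.
  by rewrite -smap_comp hl hr.
- move=> [c A] /= gc v; case: (amalg_cover v) => [[u <-]|]; last by left.
  case: (good_gen gc u) => [[w <-]|ux].
    left; exists (j w); rewrite -!comp_embE.
    by rewrite amalg_agree.
  by right; rewrite supp_map imset_f.
- by move=> i _; apply: amalg_mem.
- by move=> V V' g e x FV'; rewrite -comp_embA nphi.
rewrite /I (eq_bigl (fun i : I => good (tag i) && true)); last first.
  by move=> i; rewrite andbT.
rewrite -(sig_big_dep (fun c => good c) (fun _ _ => true) (fun c (A : amalg F (cell_l c) j) =>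
  mu (amalg_r A) * phi (amalg_perm A) (comp_emb (amalg_r A) j)
     (smap (amalg_l A) (cell_r c)))) /=.
apply: eq_bigr => c /good_mem Fc.
rewrite (measure_amalg muP (cell_l c) j) // mulr_suml.
apply: eq_bigr => A _; rewrite -amalg_agree nphi //; exact: amalg_mem.
Qed.

Lemma integ_iso W (T T' : species) (alpha : forall V, T V -> T' V)
    (phi : family W T') :
  F W -> natural phi ->
  (forall V, F V -> bijective (@alpha V)) ->
  (forall V V' (g : embedding V V') x, F V' ->
     alpha V' (smap g x) = smap g (alpha V x)) ->
  (forall V x, F V -> supp (alpha V x) = supp x) ->
  integ phi = integ (fun V e (x : T V) => phi V e (alpha V x)).
Proof.
move=> FW nphi bij nat sup.
rewrite (@integ_index W T' _ (cell W T) (@good W T) (@cell_perm W T) (@cell_l W T)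
  (fun c => alpha _ (cell_r c))) //.
- exact: good_mem.
- move=> c gc v; rewrite sup; [exact: good_gen | exact: good_mem].
- move=> V a b FV; have [f fK Kf] := bij V FV.
  have [c [gc [g [gl gr]]]] := cell_complete a (f b) FV.
  by exists c; split=> //; exists g; rewrite -nat // gr.
- move=> c d g gc gd gl; have Fd := good_mem gd.
  rewrite -nat //; have [f fK _] := bij _ Fd => /(can_inj fK).
  exact: cell_rigid.
Qed.

(** * Pairs of points and iterated integrals *)

Section Product.
Variables T T' : species.

Definition prod_spt V : finType := (T V * T' V)%type.
Definition prod_smap V V' (g : embedding V V') (x : prod_spt V) : prod_spt V' :=
  (smap g x.1, smap g x.2).
Definition prod_supp V (x : prod_spt V) : {set V} := supp x.1 :|: supp x.2.

Fact prod_smap_comp U V W (g : embedding V W) (f : embedding U V) x :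
  prod_smap (comp_emb g f) x = prod_smap g (prod_smap f x).
Proof. by rewrite /prod_smap !smap_comp. Qed.

Fact prod_smap_inj V V' (g : embedding V V') : injective (prod_smap g).
Proof. by move=> [x y] [x' y'] [/smap_inj -> /smap_inj ->]. Qed.

Fact prod_supp_map V V' (g : embedding V V') x :
  prod_supp (prod_smap g x) = g @: prod_supp x.
Proof. by rewrite /prod_supp !supp_map imsetU. Qed.

Fact prod_supp_desc V V' (g : embedding V V') (x : prod_spt V') :
    (forall v, v \in prod_supp x -> exists u, g u = v) ->
  exists x', prod_smap g x' = x.
Proof.
case: x => x y H.
have [|x' <-] := @supp_desc T _ _ g x.
  by move=> v vx; apply: H; rewrite inE vx.
have [|y' <-] := @supp_desc T' _ _ g y.
  by move=> v vx; apply: H; rewrite inE vx orbT.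
by exists (x', y').
Qed.

Fact prod_supp_bound V (x : prod_spt V) :
  (#|prod_supp x| <= sbound T + sbound T')%N.
Proof.
by apply: leq_trans (leq_card_setU _ _) _; apply: leq_add; apply: supp_bound.
Qed.

Definition prod_species := Species prod_smap_comp prod_smap_inj prod_supp_map
  prod_supp_desc prod_supp_bound.
End Product.

(** A cell of pairs is a cell of [x] over [W] followed by a cell of [y] over the structure so
    generated; axiom (ii) multiplies their measures. *)
Lemma integ_Fubini W (T T' : species) (phi : family W (prod_species T T')) :
  F W -> natural phi ->
  integ phi = integ (fun V e (x : T V) =>
    integ (fun V' (e' : embedding V V') (y : T' V') =>
      phi V' (comp_emb e' e) (smap e' x, y))).
Proof.
move=> FW nphi.
pose I := {c : cell W T & cell (cell_perm c) T'}.
rewrite (@integ_index W (prod_species T T') _ I (fun i => good (tag i) && good (tagged i))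
  (fun i => cell_perm (tagged i)) (fun i => comp_emb (cell_l (tagged i)) (cell_l (tag i)))
  (fun i => (smap (cell_l (tagged i)) (cell_r (tag i)), cell_r (tagged i)) : prod_species T T' _)) //; first last.
- move=> [c c'] [d d'] g /= /andP[gc gc'] /andP[gd gd'] gl [gr gr'].
  have Hf : forall u, exists v, cell_l d' v = comp_emb g (cell_l c') u.
    move=> u; case: (good_gen gc u) => [[w <-]|ux].
      exists (cell_l d w); rewrite -!comp_embE -gl.
      by rewrite !comp_embA.
    have : comp_emb g (cell_l c') u \in supp (smap (comp_emb g (cell_l c')) (cell_r c)).
      by rewrite supp_map imset_f.
    by rewrite smap_comp gr supp_map => /imsetP[v _ ->]; exists v.
  have [k kE] := emb_factor Hf.
  have cd : c = d.
    apply: (@cell_rigid _ _ c d k) => //.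
      apply: (@comp_emb_inj _ _ _ (cell_l d')).
      by rewrite comp_embA kE -comp_embA.
    by apply: (@smap_inj T _ _ (cell_l d')); rewrite -smap_comp kE smap_comp.
  subst d; congr (Tagged _ _); apply: (@cell_rigid _ _ c' d' g) => //.
  have [_ E] := std_rigid k.
  rewrite -kE; apply: emb_eq => z; rewrite comp_embE; congr (cell_l d' _).
  exact: E.
- move=> V a [b b'] FV.
  have [c [gc [g [gl gr]]]] := cell_complete a b FV.
  have [c' [gc' [h [hl hr]]]] := cell_complete g b' FV.
  exists (Tagged (fun c : cell W T => cell (cell_perm c) T') c'); rewrite /= gc gc'; split=> //; exists h.
  by rewrite comp_embA hl; split=> //; congr (_, _) => //=; rewrite -smap_comp hl.
- move=> [c c'] /= /andP[gc gc'] v; case: (good_gen gc' v) => [[u <-]|ux].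
    case: (good_gen gc u) => [[w <-]|ux].
      by left; exists w; rewrite comp_embE.
    by right; rewrite inE supp_map imset_f.
  by right; rewrite inE ux orbT.
- by move=> [c c'] /= /andP[gc gc']; apply: good_mem.
rewrite /I -(sig_big_dep (fun c => good c) (fun c c' => good c') (fun c (c' : cell (cell_perm c) T') =>
  mu (comp_emb (cell_l c') (cell_l c)) * phi (cell_perm c') (comp_emb (cell_l c') (cell_l c))
     (smap (cell_l c') (cell_r c), cell_r c'))) /=.
apply: eq_bigr => c gc; rewrite [in RHS]/integ mulr_sumr.
apply: eq_bigr => c' gc'; have [Fc Fc'] := (good_mem gc, good_mem gc').
by rewrite (measure_comp muP) // mulrCA mulrA.
Qed.

Lemma integ_swap W (T T' : species) (phi : forall V, embedding W V -> T V -> T' V -> R) :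
  F W ->
  (forall V V' (g : embedding V V') (e : embedding W V) x y, F V' ->
     phi V' (comp_emb g e) (smap g x) (smap g y) = phi V e x y) ->
  integ (fun V e (x : T V) => integ (fun V' (e' : embedding V V') (y : T' V') =>
    phi V' (comp_emb e' e) (smap e' x) y)) =
  integ (fun V e (y : T' V) => integ (fun V' (e' : embedding V V') (x : T V') =>
    phi V' (comp_emb e' e) x (smap e' y))).
Proof.
move=> FW nphi.
pose psi : family W (prod_species T T') := fun V e x => phi V e x.1 x.2.
pose psi' : family W (prod_species T' T) := fun V e x => phi V e x.2 x.1.
have npsi : natural psi by move=> V V' g e x FV'; rewrite /psi /= nphi.
have npsi' : natural psi' by move=> V V' g e x FV'; rewrite /psi' /= nphi.
transitivity (integ psi); first by rewrite integ_Fubini.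
transitivity (integ psi'); last by rewrite integ_Fubini.
rewrite (@integ_iso W (prod_species T' T) (prod_species T T')
  (fun V x => (x.2, x.1)) psi) //.
- move=> V FV; exists (fun x : prod_species T T' V => (x.2, x.1)) => -[] //.
- by move=> V x _; rewrite /= /prod_supp /= setUC.
Qed.

End Integral.

(** * Points of objects, and morphisms as kernels *)

Section Points.
Variables (F : permutation -> Prop) (F_her : hereditary F).
Variable s : perm_ob F.

Definition pts_spt (V : permutation) : finType :=
  {i : summand s & embedding (s i) V}.
Definition pts_smap V V' (g : embedding V V') (x : pts_spt V) : pts_spt V' :=
  Tagged (fun i => embedding (s i) V') (comp_emb g (tagged x)).
Definition pts_supp V (x : pts_spt V) : {set V} :=
  [set (tagged x : embedding (s (tag x)) V) u | u : s (tag x)].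

Fact pts_smap_comp U V W (g : embedding V W) (f : embedding U V) x :
  pts_smap (comp_emb g f) x = pts_smap g (pts_smap f x).
Proof. by rewrite /pts_smap /= comp_embA. Qed.

Fact pts_smap_inj V V' (g : embedding V V') : injective (pts_smap g).
Proof.
move=> [i x] [j y] E; have ij : i = j := congr1 tag E.
subst j; move/eqP: E; rewrite eq_Tagged /= => /eqP/comp_emb_inj -> //.
Qed.

Fact pts_supp_map V V' (g : embedding V V') x :
  pts_supp (pts_smap g x) = g @: pts_supp x.
Proof.
rewrite /pts_supp -imset_comp; apply: eq_imset => u /=; exact: comp_embE.
Qed.

Fact pts_supp_desc V V' (g : embedding V V') (x : pts_spt V') :
    (forall v, v \in pts_supp x -> exists u, g u = v) ->
  exists x', pts_smap g x' = x.
Proof.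
case: x => i x H; have [|x' <-] := @emb_factor _ _ _ g x.
  by move=> u; apply: H; rewrite imset_f.
by exists (Tagged (fun i => embedding (s i) V) x').
Qed.

Fact pts_supp_bound V (x : pts_spt V) :
  (#|pts_supp x| <= \max_i #|s i|)%N.
Proof.
apply: leq_trans (leq_imset_card _ _) _.
exact: (leq_bigmax (tag x)).
Qed.

Definition pts := Species pts_smap_comp pts_smap_inj pts_supp_map
  pts_supp_desc pts_supp_bound.

Definition pt i V (a : embedding (s i) V) : pts V :=
  Tagged (fun i => embedding (s i) V) a.

Lemma pt_map i V V' (g : embedding V V') (a : embedding (s i) V) :
  smap g (pt a) = pt (comp_emb g a).
Proof. by []. Qed.

Lemma pt_inj i V (a b : embedding (s i) V) : pt a = pt b -> a = b.
Proof. by move/eqP; rewrite eq_Tagged /= => /eqP. Qed.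

(** [agree] is phrased with raw functions; kernels are phrased with points of a species, where
    equality is that of tagged embeddings. *)
Lemma agreeP (i i' : summand s) (V : permutation) (x : s i -> V) (y : s i' -> V)
    (a : embedding (s i) V) (b : embedding (s i') V) :
  x =1 a -> y =1 b -> agree x y = (pt a == pt b).
Proof.
move=> xa yb; rewrite /agree; case: eqP => [E|ne] /=; last first.
  by apply/esym/eqP => /(congr1 tag).
subst i'; apply/forallP/eqP => [H|/pt_inj ab u].
  congr (Tagged _ _); apply: emb_eq => u.
  by have := forallP (H u) u; rewrite eqxx /= xa yb => /eqP.
apply/forallP => v; apply/implyP => /eqP E.
have -> : u = v by move/eqP: E; rewrite eq_Tagged /= => /eqP.
by rewrite xa yb ab.
Qed.

Lemma agree_pts V (x y : pts V) (f : s (tag x) -> V) (g : s (tag y) -> V) :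
  f =1 (tagged x : embedding (s (tag x)) V) ->
  g =1 (tagged y : embedding (s (tag y)) V) -> agree f g = (x == y).
Proof.
by case: x f => i x f; case: y g => j y g fx gy; rewrite (agreeP fx gy).
Qed.
End Points.

Section Amalgs.
Variables (F : permutation -> Prop) (F_her : hereditary F).
Implicit Types s t : perm_ob F.

Definition lp s t (c : amalgs s t) : pts s (am_ob c) := pt (am_l c).
Definition rp s t (c : amalgs s t) : pts t (am_ob c) := pt (am_r c).

Lemma am_mem s t (c : amalgs s t) : F (am_ob c).
Proof. exact: amalg_mem. Qed.

Lemma am_jointly_surj s t (c : amalgs s t) (v : am_ob c) :
  (exists x, am_l c x = v) \/ (exists y, am_r c y = v).
Proof.
exact: (@amalg_cover F empty_perm (s (tag c).1) (t (tag c).2) (emb_empty _)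
  (emb_empty _) (tagged c) v).
Qed.

Lemma am_cover s t (c : amalgs s t) v : v \in supp (lp c) \/ v \in supp (rp c).
Proof.
have [[x xv]|[y yv]] := am_jointly_surj v; [left|right].
  by apply/imsetP; exists x.
by apply/imsetP; exists y.
Qed.

Lemma amalgs_complete s t V (x : pts s V) (y : pts t V) : F V ->
  exists (c : amalgs s t) (h : embedding (am_ob c) V),
    smap h (lp c) = x /\ smap h (rp c) = y.
Proof.
case: x y => i x [j y] FV.
have xy : comp_emb x (emb_empty (s i)) = comp_emb y (emb_empty (t j)).
  exact: emb_empty_unique.
have [A [h [hl hr]]] := amalg_complete F_her FV xy.
exists (Tagged (fun ij => amalg0 F (s ij.1) (t ij.2)) (A : amalg0 F (s (i, j).1) (t (i, j).2))), h.
by rewrite !pt_map /am_l /am_r /= hl hr.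
Qed.

Lemma amalgs_rigid s t (c d : amalgs s t) (g : embedding (am_ob c) (am_ob d)) :
  smap g (lp c) = lp d -> smap g (rp c) = rp d -> c = d.
Proof.
case: c d g => [[i j] A] [[i' j'] B] g gl gr.
have ii' : i = i' := congr1 tag gl.
have jj' : j = j' := congr1 tag gr.
subst i' j'; congr (Tagged _ _).
apply: (@amalg_rigid F _ _ _ _ _ A B g).
  exact: (@pt_inj F s _ _ _ _ gl).
exact: (@pt_inj F t _ _ _ _ gr).
Qed.

Lemma emb_am_eq s t (c : amalgs s t) V (g h : embedding (am_ob c) V) :
  smap g (lp c) = smap h (lp c) -> smap g (rp c) = smap h (rp c) -> g = h.
Proof.
move=> gl gr; have El : comp_emb g (am_l c) = comp_emb h (am_l c) := pt_inj gl.
have Er : comp_emb g (am_r c) = comp_emb h (am_r c) := pt_inj gr.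
apply: emb_eq => v.
have [[x <-]|[y <-]] := am_jointly_surj v.
  by rewrite -(comp_embE g (am_l c)) El comp_embE.
by rewrite -(comp_embE g (am_r c)) Er comp_embE.
Qed.

(** * Points of a tensor product are pairs of points *)

Section Tensor.
Variables s t : perm_ob F.

Definition tp1 V (x : pts (perm_tens s t) V) : pts s V :=
  smap (tagged x) (lp (tag x)).
Definition tp2 V (x : pts (perm_tens s t) V) : pts t V :=
  smap (tagged x) (rp (tag x)).

Lemma tp1_map V V' (g : embedding V V') x : tp1 (smap g x) = smap g (tp1 x).
Proof. by rewrite /tp1 -smap_comp. Qed.
Lemma tp2_map V V' (g : embedding V V') x : tp2 (smap g x) = smap g (tp2 x).
Proof. by rewrite /tp2 -smap_comp. Qed.

(** Both amalgamations have as image in [V] the union of the supports of the two points, so they are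
    isomorphic, hence equal. *)
Lemma pt_tens_inj V (c d : amalgs s t) (g : embedding (am_ob c) V)
    (h : embedding (am_ob d) V) :
  smap g (lp c) = smap h (lp d) -> smap g (rp c) = smap h (rp d) ->
  @pt F (perm_tens s t) c V g = @pt F (perm_tens s t) d V h.
Proof.
move=> El Er.
have Hf : forall u, exists v, h v = g u.
  move=> u; case: (am_cover u) => H.
    have : g u \in supp (smap g (lp c)) by rewrite supp_map imset_f.
    by rewrite El supp_map => /imsetP[v _ ->]; exists v.
  have : g u \in supp (smap g (rp c)) by rewrite supp_map imset_f.
  by rewrite Er supp_map => /imsetP[v _ ->]; exists v.
have [k kE] := emb_factor Hf; have cd : c = d.
  apply: (@amalgs_rigid _ _ c d k).
    by apply: (@smap_inj (pts s) _ _ h); rewrite -smap_comp kE.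
  by apply: (@smap_inj (pts t) _ _ h); rewrite -smap_comp kE.
by subst d; rewrite (emb_am_eq El Er).
Qed.

Lemma tp_inj V (x y : pts (perm_tens s t) V) :
  tp1 x = tp1 y -> tp2 x = tp2 y -> x = y.
Proof. case: x y => [c g] [d h]; exact: pt_tens_inj. Qed.

Lemma tpair_ex V (x : pts s V) (y : pts t V) : F V ->
  exists z : pts (perm_tens s t) V, tp1 z = x /\ tp2 z = y.
Proof.
move=> FV; have [c [h [<- <-]]] := amalgs_complete x y FV.
by exists (@pt F (perm_tens s t) c V h).
Qed.

Lemma tp_supp V (x : pts (perm_tens s t) V) :
  supp x = supp (tp1 x) :|: supp (tp2 x).
Proof.
case: x => c h; rewrite /tp1 /tp2 !supp_map -imsetU.
apply/setP => v; apply/imsetP/imsetP => -[u uP ->]; exists u => //.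
by rewrite inE; apply/orP/am_cover.
Qed.

(** The proof [FV] is an argument because a summand of the tensor product must be an amalgamation
    inside [F], and heredity derives this from [V]. *)
Definition tpair V (FV : F V) (x : pts s V) (y : pts t V) :
  pts (perm_tens s t) V := projT1 (cid (tpair_ex x y FV)).

Lemma tp1_pair V (FV : F V) x y : tp1 (tpair FV x y) = x.
Proof. by rewrite /tpair; case: cid => z []. Qed.
Lemma tp2_pair V (FV : F V) x y : tp2 (tpair FV x y) = y.
Proof. by rewrite /tpair; case: cid => z []. Qed.
End Tensor.

Section One.
Hypothesis F0 : F empty_perm.

Definition pt1 V : pts (perm_one F0) V := @pt F (perm_one F0) tt V (emb_empty V).

Lemma pt1_eq V (x : pts (perm_one F0) V) : x = pt1 V.
Proof. by case: x => -[] x; rewrite (emb_empty_unique x (emb_empty V)). Qed.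
End One.

(** If both legs of [A] map into the image of [g], so does all of [A], because its legs cover it. *)
Lemma coef_natural (k : fieldType) s t (f : perm_hom k s t) V V'
    (g : embedding V V') i j (a : embedding (s i) V) (b : embedding (t j) V) :
  coef f (comp_emb g a) (comp_emb g b) = coef f a b.
Proof.
apply: eq_bigl => A; apply/existsP/existsP => -[h /andP[/forallP H /forallP H']].
  have [|h' E] := @emb_factor _ _ _ g h.
    move=> u; case: (amalg_cover u) => -[w <-].
      by exists (a w); rewrite (eqP (H w)) comp_embE.
    by exists (b w); rewrite (eqP (H' w)) comp_embE.
  exists h'; apply/andP; split; apply/forallP => w; apply/eqP/(@emb_inj _ _ g).
    by rewrite -comp_embE E (eqP (H w)) comp_embE.
  by rewrite -comp_embE E (eqP (H' w)) comp_embE.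
exists (comp_emb g h); apply/andP; split; apply/forallP => w.
  by rewrite !comp_embE (eqP (H w)).
by rewrite !comp_embE (eqP (H' w)).
Qed.

Section Kernel.
Variables (k : fieldType) (s t : perm_ob F).
Implicit Types f g : perm_hom k s t.

Definition ev f V (x : pts s V) (y : pts t V) : k :=
  coef f (tagged x) (tagged y).

Lemma ev_map f V V' (g : embedding V V') x y :
  ev f (smap g x) (smap g y) = ev f x y.
Proof. exact: coef_natural. Qed.

Lemma evE f (c : amalgs s t) : ev f (lp c) (rp c) = f c.
Proof.
rewrite /ev /coef /=; case: c => [[i j] A] /=.
rewrite (big_pred1 A) // => B; apply/existsP/eqP => [|->].
  case=> h /andP[/forallP H /forallP H'].
  apply: (@amalg_rigid F _ _ _ _ _ B A h); apply: emb_eq => w; rewrite comp_embE.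
    by rewrite (eqP (H w)).
  by rewrite (eqP (H' w)).
by exists (id_emb _); apply/andP; split; apply/forallP => w; rewrite id_embE.
Qed.

Lemma ev_map_am f (c : amalgs s t) V (h : embedding (am_ob c) V) :
  ev f (smap h (lp c)) (smap h (rp c)) = f c.
Proof. by rewrite ev_map evE. Qed.

Lemma ev_ext f g :
  (forall V (x : pts s V) (y : pts t V), F V -> ev f x y = ev g x y) -> f = g.
Proof.
by move=> H; apply/ffunP => c; rewrite -!evE H //; apply: am_mem.
Qed.

Lemma evD f g V (x : pts s V) (y : pts t V) : ev (f + g) x y = ev f x y + ev g x y.
Proof. by rewrite /ev /coef -big_split; apply: eq_bigr => A _; rewrite ffunE. Qed.

Lemma evZ a f V (x : pts s V) (y : pts t V) : ev (a *: f) x y = a * ev f x y.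
Proof. by rewrite /ev /coef mulr_sumr; apply: eq_bigr => A _; rewrite ffunE. Qed.

Lemma ev0 V (x : pts s V) (y : pts t V) : ev (0 : perm_hom k s t) x y = 0.
Proof. by rewrite /ev /coef big1 // => A _; rewrite ffunE. Qed.

Definition natural_kernel (phi : forall V, pts s V -> pts t V -> k) :=
  forall V V' (g : embedding V V') x y, F V' ->
    phi V' (smap g x) (smap g y) = phi V x y.

Definition of_kernel (phi : forall V, pts s V -> pts t V -> k) : perm_hom k s t :=
  [ffun c => phi (am_ob c) (lp c) (rp c)].

Lemma ev_of_kernel phi V (x : pts s V) (y : pts t V) :
  natural_kernel phi -> F V -> ev (of_kernel phi) x y = phi V x y.
Proof.
move=> nphi FV; have [c [h [<- <-]]] := amalgs_complete x y FV.
by rewrite ev_map_am ffunE nphi.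
Qed.
End Kernel.
End Amalgs.

(** * Composition of kernels is integration *)

Section Composition.
Variables (k : fieldType) (F : permutation -> Prop) (mu : emb_function k).
Hypotheses (F_her : hereditary F) (muP : is_measure F mu).
Variables s t u : perm_ob F.
Variables (g : perm_hom k t u) (f : perm_hom k s t).

(** The triple sum of [perm_comp] as a single sum over a finite type, the form to which
    [integ_index] applies. *)
Definition comp_index (c : amalgs s u) :=
  {j : summand t & {W : amalg3 F (s (am_i c)) (t j) (u (am_j c)) &
     embedding (am_ob c) (amalg3_perm W)}}.
HB.instance Definition _ c := Finite.on (comp_index c).

Section Index.
Variable c : amalgs s u.
Implicit Type i : comp_index c.

Definition ci_W i := tag (tagged i).
Definition ci_perm i : permutation := amalg3_perm (ci_W i).
Definition ci_h i : embedding (am_ob c) (ci_perm i) := tagged (tagged i).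
Definition ci_pt i : pts t (ci_perm i) := pt (amalg3_2 (ci_W i)).
Definition ci_ok i : bool :=
  induced_by (A := tagged c) (amalg3_1 (ci_W i)) (amalg3_3 (ci_W i)) (ci_h i).

Lemma ci_okP i : reflect
  (comp_emb (ci_h i) (am_l c) = amalg3_1 (ci_W i) /\
   comp_emb (ci_h i) (am_r c) = amalg3_3 (ci_W i)) (ci_ok i).
Proof.
apply: (iffP idP) => [|[H H']].
  rewrite /ci_ok /induced_by => /andP[/forallP H /forallP H'].
  split; apply: emb_eq => w; rewrite comp_embE; apply/eqP; [exact: H|exact: H'].
by rewrite /ci_ok /induced_by -H -H'; apply/andP; split; apply/forallP => w; rewrite comp_embE.
Qed.
End Index.

Lemma perm_compE (c : amalgs s u) : perm_comp mu g f c =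
  \sum_(i : comp_index c | ci_ok i) mu (ci_h i) *
    (ev f (smap (ci_h i) (lp c)) (ci_pt i) * ev g (ci_pt i) (smap (ci_h i) (rp c))).
Proof.
rewrite ffunE.
pose J j := {W : amalg3 F (s (am_i c)) (t j) (u (am_j c)) &
     embedding (am_ob c) (amalg3_perm W)}.
pose ci j (i : J j) : comp_index c := existT _ j i.
pose ci' j W h : J j := existT _ W h.
pose G (i : comp_index c) := mu (ci_h i) *
    (ev f (smap (ci_h i) (lp c)) (ci_pt i) * ev g (ci_pt i) (smap (ci_h i) (rp c))).
rewrite (eq_bigl (fun i : comp_index c => true && ci_ok (ci _ (tagged i)))); last first.
  by case.
rewrite [RHS](eq_bigr (fun i : comp_index c => G (ci _ (tagged i)))); last by case.
rewrite -(sig_big_dep (fun j => true) (fun j i => ci_ok (ci j i))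
  (fun j i => G (ci j i))) /=.
apply: eq_bigr => j _.
rewrite (eq_bigl (fun i : J j => true && ci_ok (ci j (ci' _ _ (tagged i))))); last first.
  by case.
rewrite [RHS](eq_bigr (fun i : J j => G (ci j (ci' _ _ (tagged i))))); last by case.
rewrite -(sig_big_dep (fun W => true) (fun W h => ci_ok (ci j (ci' j W h)))
  (fun W h => G (ci j (ci' j W h)))) /=.
apply: eq_bigr => W _; apply: eq_big => // h hP.
have /ci_okP[Hl Hr] : ci_ok (ci j (ci' j W h)) by [].
by rewrite mulrC /G /lp /rp !pt_map Hl Hr.
Qed.

Definition comp_kernel W (x : pts s W) (z : pts u W) : family k W (pts t) :=
  fun V e y => ev f (smap e x) y * ev g y (smap e z).

Lemma comp_kernel_natural W (x : pts s W) (z : pts u W) :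
  natural F (comp_kernel x z).
Proof. by move=> V V' h e y FV'; rewrite /comp_kernel !smap_comp !ev_map. Qed.

Lemma perm_comp_integ (c : amalgs s u) :
  perm_comp mu g f c = integ F mu (comp_kernel (lp c) (rp c)).
Proof.
rewrite perm_compE (@integ_index k F mu F_her muP _ _ _ (comp_index c) (@ci_ok c)
  (@ci_perm c) (@ci_h c) (@ci_pt c)) //.
- exact: am_mem.
- exact: comp_kernel_natural.
- by move=> i _; apply: amalg3_mem.
- move=> i /ci_okP[hl hr] v.
  have [[w <-]|[w <-]|[w <-]] := @amalg3_cover F _ _ _ (ci_W i) v.
  + by left; exists (am_l c w); rewrite -comp_embE hl.
  + by right; apply/imsetP; exists w.
  + by left; exists (am_r c w); rewrite -comp_embE hr.
- move=> V a [j b] FV.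
  have [W [h [h1 h2 h3]]] := amalg3_complete F_her (comp_emb a (am_l c)) b
    (comp_emb a (am_r c)) FV.
  have [|a' aE] := @emb_factor _ _ _ h a.
    move=> w; case: (am_jointly_surj w) => -[v <-].
      by exists (amalg3_1 W v); rewrite -!comp_embE h1.
    by exists (amalg3_3 W v); rewrite -!comp_embE h3.
  exists (existT _ j (existT _ W a')); split.
    apply/ci_okP; rewrite /ci_h /ci_W /=.
    by split; apply: (@comp_emb_inj _ _ _ h); rewrite comp_embA aE ?h1 ?h3.
  exists h; split=> //.
  by rewrite /ci_pt pt_map h2.
move=> [j [W h]] [j' [W' h']] e.
rewrite /ci_pt /ci_h /ci_perm /ci_W /= => /ci_okP[hl hr] /ci_okP[hl' hr'] eh ep.
rewrite /ci_pt /ci_h /ci_perm /ci_W /= in hl hr hl' hr'.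
have jj' : j = j' := congr1 tag ep; subst j'.
have e2 : comp_emb e (amalg3_2 W) = amalg3_2 W' := pt_inj ep.
have WW' : W = W'.
  apply: (@amalg3_rigid F _ _ _ W W' e) => //.
    by rewrite -hl -hl' comp_embA eh.
  by rewrite -hr -hr' comp_embA eh.
subst W'; suff -> : h = h' by [].
apply: emb_am_eq; first by rewrite /lp !pt_map hl hl'.
by rewrite /rp !pt_map hr hr'.
Qed.

(** Composition is defined on the generated structure [am_ob c]; base change carries it to any [W]
    that contains the two points. *)
Lemma ev_comp W (x : pts s W) (z : pts u W) : F W ->
  ev (perm_comp mu g f) x z = integ F mu (comp_kernel x z).
Proof.
move=> FW; have [c [h [<- <-]]] := amalgs_complete F_her x z FW.
rewrite ev_map_am perm_comp_integ.
have FC := am_mem c; have N := @comp_kernel_natural (am_ob c) (lp c) (rp c).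
rewrite -(@integ_basechange k F mu F_her muP (am_ob c) W (pts t) h _ FC FW N).
by apply: eq_integ => V e y _; rewrite /comp_kernel !smap_comp.
Qed.
End Composition.

(** * The laws of a symmetric monoidal category *)

Section Laws.
Variables (k : fieldType) (F : permutation -> Prop) (F0 : F empty_perm).
Variable mu : emb_function k.
Hypotheses (F_her : hereditary F) (muP : is_measure F mu).
Implicit Types s t u v : perm_ob F.

Lemma natb_inj (b c : bool) : b%:R = c%:R :> k -> b = c.
Proof.
by case: b c => [] [] // /eqP; rewrite ?oner_eq0 // eq_sym oner_eq0.
Qed.

Lemma natbM (b c : bool) : b%:R * c%:R = (b && c)%:R :> k.
Proof. by case: b; rewrite ?mul1r ?mul0r. Qed.

Lemma tp_eq s t V (x y : pts (perm_tens s t) V) :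
  (x == y) = (tp1 x == tp1 y) && (tp2 x == tp2 y).
Proof.
apply/eqP/andP => [->//|[/eqP H /eqP H']]; exact: tp_inj.
Qed.

Lemma tpairK s t V (FV : F V) (x : pts (perm_tens s t) V) :
  tpair F_her FV (tp1 x) (tp2 x) = x.
Proof. by apply: tp_inj; rewrite ?tp1_pair ?tp2_pair. Qed.

Lemma smap_tpair s t V V' (FV : F V) (FV' : F V') (g : embedding V V')
    (x : pts s V) (y : pts t V) :
  smap g (tpair F_her FV x y) = tpair F_her FV' (smap g x) (smap g y).
Proof.
by apply: tp_inj;
  rewrite ?tp1_map ?tp2_map ?tp1_pair ?tp2_pair.
Qed.

Lemma ev_bool s t (f : perm_hom k s t)
    (p : forall V, pts s V -> pts t V -> bool) :
  (forall c, f c = (p _ (lp c) (rp c))%:R) ->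
  (forall V V' (g : embedding V V') x y, p V' (smap g x) (smap g y) = p V x y) ->
  forall V x y, F V -> ev f x y = (p V x y)%:R.
Proof.
move=> fp np V x y FV; have [c [h [<- <-]]] := amalgs_complete F_her x y FV.
by rewrite ev_map_am fp np.
Qed.

Lemma smap_eq (T : species) V V' (g : embedding V V') (x y : T V) :
  (smap g x == smap g y) = (x == y).
Proof. exact/inj_eq/smap_inj. Qed.

Lemma ev_id s V (x y : pts s V) : F V -> ev (perm_id k s) x y = (x == y)%:R.
Proof.
apply: (ev_bool (p := fun V (x y : pts s V) => x == y)) => [c|*]; last exact: smap_eq.
by rewrite ffunE; congr (nat_of_bool _)%:R; apply: agreeP.
Qed.

Lemma ev_tensm s t s' t' (f : perm_hom k s t) (f' : perm_hom k s' t') V x y :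
  F V -> ev (perm_tensm f f') x y
    = ev f (tp1 x : pts s V) (tp1 y) * ev f' (tp2 x) (tp2 y).
Proof.
move=> FV; have [c [h [<- <-]]] := amalgs_complete F_her x y FV.
by rewrite ev_map_am ffunE !tp1_map !tp2_map !ev_map.
Qed.

Lemma ev_assoc s t u V x y : F V -> ev (perm_assoc k s t u) x y =
  [&& tp1 (tp1 x : pts (perm_tens s t) V) == tp1 y,
      tp2 (tp1 x : pts (perm_tens s t) V) == tp1 (tp2 y)
    & tp2 x == tp2 (tp2 y : pts (perm_tens t u) V)]%:R.
Proof.
apply: (ev_bool (p := fun V x y => [&& tp1 (tp1 x : pts (perm_tens s t) V) == tp1 y,
      tp2 (tp1 x : pts (perm_tens s t) V) == tp1 (tp2 y)
    & tp2 x == tp2 (tp2 y : pts (perm_tens t u) V)])) => [c|V0 V' g x0 y0]; last first.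
  by rewrite !(tp1_map, tp2_map) !smap_eq.
rewrite ffunE; congr (nat_of_bool _)%:R; congr [&& _, _ & _].
- apply: (agree_pts (x := tp1 (tp1 (lp c))) (y := tp1 (rp c))) => w; [exact: esym (etrans (comp_embE _ _ _) (comp_embE _ _ _)) | exact: esym (comp_embE _ _ _)].
- apply: (agree_pts (x := tp2 (tp1 (lp c))) (y := tp1 (tp2 (rp c)))) => w; [exact: esym (etrans (comp_embE _ _ _) (comp_embE _ _ _)) | exact: esym (etrans (comp_embE _ _ _) (comp_embE _ _ _))].
- apply: (agree_pts (x := tp2 (lp c)) (y := tp2 (tp2 (rp c)))) => w; [exact: esym (comp_embE _ _ _) | exact: esym (etrans (comp_embE _ _ _) (comp_embE _ _ _))].
Qed.

Lemma ev_braid s t V x y : F V -> ev (perm_braid k s t) x y =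
  ((tp1 x == tp2 y :> pts s V) && (tp2 x == tp1 y :> pts t V))%:R.
Proof.
apply: (ev_bool (p := fun V x y => (tp1 x == tp2 y :> pts s V) &&
    (tp2 x == tp1 y :> pts t V))) => [c|V0 V' g x0 y0]; last first.
  by rewrite !(tp1_map, tp2_map) !smap_eq.
rewrite ffunE; congr (nat_of_bool _)%:R; congr (_ && _).
- apply: (agree_pts (x := tp1 (lp c)) (y := tp2 (rp c))) => w; [exact: esym (comp_embE _ _ _) | exact: esym (comp_embE _ _ _)].
- apply: (agree_pts (x := tp2 (lp c)) (y := tp1 (rp c))) => w; [exact: esym (comp_embE _ _ _) | exact: esym (comp_embE _ _ _)].
Qed.

Lemma ev_lunit s V x y : F V -> ev (perm_lunit k F0 s) x y =
  (tp2 x == y :> pts s V)%:R.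
Proof.
apply: (ev_bool (p := fun V x y => tp2 x == y :> pts s V)) => [c|V0 V' g x0 y0].
  rewrite ffunE; congr (nat_of_bool _)%:R.
  apply: (agree_pts (x := tp2 (lp c)) (y := rp c)) => w; [exact: esym (comp_embE _ _ _) | exact: erefl].
by rewrite !tp2_map !smap_eq.
Qed.

Lemma ev_runit s V x y : F V -> ev (perm_runit k F0 s) x y =
  (tp1 x == y :> pts s V)%:R.
Proof.
apply: (ev_bool (p := fun V x y => tp1 x == y :> pts s V)) => [c|V0 V' g x0 y0].
  rewrite ffunE; congr (nat_of_bool _)%:R.
  apply: (agree_pts (x := tp1 (lp c)) (y := rp c)) => w; [exact: esym (comp_embE _ _ _) | exact: erefl].
by rewrite !tp1_map !smap_eq.
Qed.

(** [f] is the graph of a map of points; in [is_codelta], of a map in the other direction. All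
    structural morphisms are both. *)
Definition is_delta s t (f : perm_hom k s t)
    (a : forall V, F V -> pts s V -> pts t V) :=
  forall V (FV : F V) x y, ev f x y = (a V FV x == y)%:R.

Definition is_codelta s t (f : perm_hom k s t)
    (b : forall V, F V -> pts t V -> pts s V) :=
  forall V (FV : F V) x y, ev f x y = (b V FV y == x)%:R.

Lemma delta_natural s t (f : perm_hom k s t) a : is_delta f a ->
  forall V V' (FV : F V) (FV' : F V') (g : embedding V V') x,
    a V' FV' (smap g x) = smap g (a V FV x).
Proof.
move=> fa V V' FV FV' g x; apply/eqP.
apply: (@natb_inj _ true).
by rewrite -fa ev_map fa eqxx.
Qed.

Lemma codelta_natural s t (f : perm_hom k s t) b : is_codelta f b ->
  forall V V' (FV : F V) (FV' : F V') (g : embedding V V') x,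
    b V' FV' (smap g x) = smap g (b V FV x).
Proof.
move=> fb V V' FV FV' g x; apply/eqP.
apply: (@natb_inj _ true).
by rewrite -fb ev_map fb eqxx.
Qed.

Lemma natural_ev_r s t (f : perm_hom k s t) W (z : pts t W) :
  natural F (fun V (e : embedding W V) (x : pts s V) => ev f x (smap e z)).
Proof. by move=> V V' g e x FV'; rewrite smap_comp ev_map. Qed.

Lemma natural_ev_l s t (f : perm_hom k s t) W (z : pts s W) :
  natural F (fun V (e : embedding W V) (x : pts t V) => ev f (smap e z) x).
Proof. by move=> V V' g e x FV'; rewrite smap_comp ev_map. Qed.

Lemma delta_compl s t u (g : perm_hom k t u) (f : perm_hom k s t) a :
  is_delta f a -> forall V (FV : F V) x z,
    ev (perm_comp mu g f) x z = ev g (a V FV x) z.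
Proof.
move=> fa V FV x z; rewrite ev_comp //.
rewrite -[z in RHS](smap_id (V := V)).
rewrite -(@integ_delta k F mu F_her muP V (pts t)
  (fun V' e y => ev g y (smap e z))) //; last exact: natural_ev_r.
apply: eq_integ => V' e y FV'.
by rewrite /comp_kernel (fa _ FV') (delta_natural fa FV).
Qed.

Lemma codelta_compr s t u (g : perm_hom k t u) (f : perm_hom k s t) b :
  is_codelta g b -> forall V (FV : F V) x z,
    ev (perm_comp mu g f) x z = ev f x (b V FV z).
Proof.
move=> gb V FV x z; rewrite ev_comp //.
rewrite -[x in RHS](smap_id (V := V)).
rewrite -(@integ_delta k F mu F_her muP V (pts t)
  (fun V' e y => ev f (smap e x) y)) //; last exact: natural_ev_l.
apply: eq_integ => V' e y FV'.
by rewrite /comp_kernel (gb _ FV') (codelta_natural gb FV) mulrC.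
Qed.

Definition transpose s t (f : perm_hom k s t) : perm_hom k t s :=
  of_kernel (fun V (y : pts t V) (x : pts s V) => ev f x y).

Lemma ev_transpose s t (f : perm_hom k s t) V (x : pts s V) (y : pts t V) :
  F V -> ev (transpose f) y x = ev f x y.
Proof.
by move=> FV; rewrite ev_of_kernel // => V0 V' g y0 x0 _; rewrite ev_map.
Qed.

(** A morphism that is a graph in both directions is the graph of a bijection, and the transposed
    graph inverts it. *)
Lemma delta_inverse s t (f : perm_hom k s t) a b :
  is_delta f a -> is_codelta f b ->
  perm_comp mu (transpose f) f = perm_id k s /\
  perm_comp mu f (transpose f) = perm_id k t.
Proof.
move=> fa fb; split; apply: ev_ext => V x z FV; rewrite ev_id //.
  rewrite (delta_compl _ fa FV) ev_transpose // (fa _ FV).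
  congr (nat_of_bool _)%:R; apply/eqP/eqP => [E|->//].
  have H y : b V FV (a V FV y) = y.
    by apply/eqP/(@natb_inj _ true); rewrite -(fb V FV) (fa V FV) eqxx.
  by rewrite -(H x) -E H.
rewrite (codelta_compr _ fb FV) ev_transpose // (fb _ FV).
congr (nat_of_bool _)%:R; apply/eqP/eqP => [E|->//].
have H y : a V FV (b V FV y) = y.
  by apply/eqP/(@natb_inj _ true); rewrite -(fa V FV) (fb V FV) eqxx.
by rewrite -(H x) E H.
Qed.

Definition assoc_pt s t u V (FV : F V) (x : pts (perm_tens (perm_tens s t) u) V) :
    pts (perm_tens s (perm_tens t u)) V :=
  tpair F_her FV (tp1 (tp1 x)) (tpair F_her FV (tp2 (tp1 x)) (tp2 x)).
Definition assoc_inv_pt s t u V (FV : F V) (x : pts (perm_tens s (perm_tens t u)) V) :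
    pts (perm_tens (perm_tens s t) u) V :=
  tpair F_her FV (tpair F_her FV (tp1 x) (tp1 (tp2 x))) (tp2 (tp2 x)).
Definition braid_pt s t V (FV : F V) (x : pts (perm_tens s t) V) :
  pts (perm_tens t s) V := tpair F_her FV (tp2 x) (tp1 x).
Definition lunit_pt s V (FV : F V) (x : pts (perm_tens (perm_one F0) s) V) :
  pts s V := tp2 x.
Definition lunit_inv_pt s V (FV : F V) (x : pts s V) :
  pts (perm_tens (perm_one F0) s) V := tpair F_her FV (pt1 F0 V) x.
Definition runit_pt s V (FV : F V) (x : pts (perm_tens s (perm_one F0)) V) :
  pts s V := tp1 x.
Definition runit_inv_pt s V (FV : F V) (x : pts s V) :
  pts (perm_tens s (perm_one F0)) V := tpair F_her FV x (pt1 F0 V).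

Lemma assoc_delta s t u : is_delta (perm_assoc k s t u) (@assoc_pt s t u).
Proof.
move=> V FV x y; rewrite ev_assoc // /assoc_pt [in RHS]tp_eq tp1_pair tp2_pair.
by rewrite [_ == tp2 y]tp_eq tp1_pair tp2_pair.
Qed.

Lemma assoc_codelta s t u : is_codelta (perm_assoc k s t u) (@assoc_inv_pt s t u).
Proof.
move=> V FV x y; rewrite ev_assoc // /assoc_inv_pt [in RHS]tp_eq tp1_pair tp2_pair.
rewrite [_ == tp1 x]tp_eq tp1_pair tp2_pair andbA.
by congr (nat_of_bool (_ && _ && _))%:R; exact: eq_sym.
Qed.

Lemma braid_delta s t : is_delta (perm_braid k s t) (@braid_pt s t).
Proof.
move=> V FV x y; rewrite ev_braid // /braid_pt [in RHS]tp_eq tp1_pair tp2_pair.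
by rewrite andbC.
Qed.

Lemma braid_codelta s t : is_codelta (perm_braid k s t) (@braid_pt t s).
Proof.
move=> V FV x y; rewrite ev_braid // /braid_pt [in RHS]tp_eq tp1_pair tp2_pair.
by congr (nat_of_bool (_ && _))%:R; exact: eq_sym.
Qed.

Lemma lunit_delta s : is_delta (perm_lunit k F0 s) (@lunit_pt s).
Proof. by move=> V FV x y; rewrite ev_lunit. Qed.

Lemma lunit_codelta s : is_codelta (perm_lunit k F0 s) (@lunit_inv_pt s).
Proof.
move=> V FV x y; rewrite ev_lunit // [in RHS]tp_eq /lunit_inv_pt tp1_pair tp2_pair.
by rewrite [tp1 x]pt1_eq eqxx eq_sym.
Qed.

Lemma runit_delta s : is_delta (perm_runit k F0 s) (@runit_pt s).
Proof. by move=> V FV x y; rewrite ev_runit. Qed.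

Lemma runit_codelta s : is_codelta (perm_runit k F0 s) (@runit_inv_pt s).
Proof.
move=> V FV x y; rewrite ev_runit // [in RHS]tp_eq /runit_inv_pt tp1_pair tp2_pair.
by rewrite [tp2 x]pt1_eq eqxx andbT eq_sym.
Qed.

Lemma id_delta s : is_delta (perm_id k s) (fun V _ x => x).
Proof. by move=> V FV x y; rewrite ev_id. Qed.

Lemma id_codelta s : is_codelta (perm_id k s) (fun V _ x => x).
Proof. by move=> V FV x y; rewrite ev_id // eq_sym. Qed.

Lemma comp_kernel_basechange s t u (g : perm_hom k t u) (f : perm_hom k s t) V V'
    (e : embedding V V') (x : pts s V) (z : pts u V) :
  F V -> F V' ->
  integ F mu (comp_kernel g f (smap e x) (smap e z)) = integ F mu (comp_kernel g f x z).
Proof. by move=> FV FV'; rewrite -!ev_comp // ev_map. Qed.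

(** Both sides are the same double integral over the two middle points, taken in the two orders. *)
Lemma perm_compA s t u v (h : perm_hom k u v) (g : perm_hom k t u)
    (f : perm_hom k s t) :
  perm_comp mu h (perm_comp mu g f) = perm_comp mu (perm_comp mu h g) f.
Proof.
apply: ev_ext => V x z FV; rewrite !ev_comp //.
transitivity (integ F mu (fun V1 (e1 : embedding V V1) (y : pts u V1) =>
  integ F mu (fun V2 (e2 : embedding V1 V2) (y' : pts t V2) =>
    ev f (smap (comp_emb e2 e1) x) y' * ev g y' (smap e2 y) *
      ev h (smap e2 y) (smap (comp_emb e2 e1) z)))).
  apply: eq_integ => V1 e1 y FV1; rewrite /comp_kernel ev_comp // mulrC -integZ.
  apply: eq_integ => V2 e2 y' FV2; rewrite /comp_kernel !smap_comp ev_map.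
  by rewrite mulrC.
rewrite (@integ_swap k F mu F_her muP V (pts u) (pts t) (fun V2 e y y' => ev f (smap e x) y' * ev g y' y *
  ev h y (smap e z))) //; last first.
  by move=> V1 V2 e' e y y' _; rewrite !smap_comp !ev_map.
apply: eq_integ => V1 e1 y FV1; rewrite /comp_kernel ev_comp // -integZ.
apply: eq_integ => V2 e2 y' FV2; rewrite /comp_kernel !smap_comp ev_map.
by rewrite mulrA.
Qed.

(** [tpair] exists only inside [F]; the default [0] is never met, since the cells of an integral lie
    in [F]. *)
Lemma integ_tens W s t (phi : family k W (pts (perm_tens s t))) :
  F W -> natural F phi ->
  integ F mu phi = integ F mu (fun V e (x : pts s V) => integ F mu
    (fun V' (e' : embedding V V') (y : pts t V') =>
      if pselect (F V') is left FV' then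
        phi V' (comp_emb e' e) (tpair F_her FV' (smap e' x) y) else 0)).
Proof.
move=> FW nphi.
pose psi : family k W (prod_species (pts s) (pts t)) := fun V e x =>
  if pselect (F V) is left FV then phi V e (tpair F_her FV x.1 x.2) else 0.
have npsi : natural F psi.
  move=> V V' g e x FV'; rewrite /psi; case: pselect => // FV0.
  case: pselect => [FV|/(_ (F_her g FV'))//].
  by rewrite -(smap_tpair FV) nphi.
transitivity (integ F mu psi); last by rewrite integ_Fubini.
rewrite [RHS](@integ_iso k F mu F_her muP W (pts (perm_tens s t)) (prod_species (pts s) (pts t))
  (fun V x => (tp1 x, tp2 x))) //.
- apply: eq_integ => V e x FV; rewrite /psi; case: pselect => // FV0.
  by rewrite tpairK.
- move=> V FV; exists (fun x : prod_species (pts s) (pts t) V => tpair F_her FV x.1 x.2).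
    by move=> x; rewrite tpairK.
  by move=> [x y]; rewrite /= tp1_pair tp2_pair.
- by move=> V V' g x _; rewrite tp1_map tp2_map.
- by move=> V x FV; exact: esym (tp_supp x).
Qed.

Lemma perm_tensm_comp s t u s' t' u' (g : perm_hom k t u) (f : perm_hom k s t)
    (g' : perm_hom k t' u') (f' : perm_hom k s' t') :
  perm_tensm (perm_comp mu g f) (perm_comp mu g' f') =
  perm_comp mu (perm_tensm g g') (perm_tensm f f').
Proof.
apply: ev_ext => V x z FV; rewrite ev_tensm // !ev_comp //.
rewrite integ_tens //; last exact: comp_kernel_natural.
rewrite mulrC -integZ; apply: eq_integ => V1 e1 y FV1.
rewrite mulrC -(comp_kernel_basechange g' f' e1) // /comp_kernel -integZ.
apply: eq_integ => V2 e2 y' FV2; case: pselect => // FV2'.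
rewrite !ev_tensm // tp1_pair tp2_pair !tp1_map !tp2_map !smap_comp !ev_map.
by rewrite mulrACA.
Qed.

Lemma perm_tensm1 s t :
  perm_tensm (perm_id k s) (perm_id k t) = perm_id k (perm_tens s t).
Proof.
apply: (@ev_ext F k (perm_tens s t) (perm_tens s t)) => V x y FV.
rewrite (ev_tensm _ _ _ _ FV) (ev_id (tp1 x) _ FV) (ev_id (tp2 x) _ FV).
by rewrite (ev_id x y FV) (tp_eq x y) natbM.
Qed.

Lemma perm_comp1m s t (f : perm_hom k s t) : perm_comp mu (perm_id k t) f = f.
Proof.
by apply: ev_ext => V x y FV; rewrite (codelta_compr _ (id_codelta (s:=t)) FV).
Qed.

Lemma perm_compm1 s t (f : perm_hom k s t) : perm_comp mu f (perm_id k s) = f.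
Proof.
by apply: ev_ext => V x y FV; rewrite (delta_compl _ (id_delta (s:=s)) FV).
Qed.

Lemma perm_comp_linear s t u (g : perm_hom k t u) :
  linear (fun f : perm_hom k s t => perm_comp mu g f).
Proof.
move=> a f f'; apply: ev_ext => V x z FV.
rewrite evD evZ !ev_comp // -integZ -integD; apply: eq_integ => V' e y FV'.
by rewrite /comp_kernel evD evZ mulrDl mulrA.
Qed.

Lemma perm_comp_linearl s t u (f : perm_hom k s t) :
  linear (fun g : perm_hom k t u => perm_comp mu g f).
Proof.
move=> a g g'; apply: ev_ext => V x z FV.
rewrite evD evZ !ev_comp // -integZ -integD; apply: eq_integ => V' e y FV'.
by rewrite /comp_kernel evD evZ mulrDr mulrCA.
Qed.

Lemma perm_tensm_linear s t s' t' (f : perm_hom k s t) :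
  linear (fun f' : perm_hom k s' t' => perm_tensm f f').
Proof.
move=> a g g'; apply: ev_ext => V x y FV.
by rewrite evD evZ !ev_tensm // evD evZ mulrDr mulrCA.
Qed.

Lemma perm_tensm_linearl s t s' t' (f' : perm_hom k s' t') :
  linear (fun f : perm_hom k s t => perm_tensm f f').
Proof.
move=> a g g'; apply: ev_ext => V x y FV.
by rewrite evD evZ !ev_tensm // evD evZ mulrDl mulrA.
Qed.

Lemma perm_assoc_nat s t u s' t' u' (f : perm_hom k s s')
    (g : perm_hom k t t') (h : perm_hom k u u') :
  perm_comp mu (perm_assoc k s' t' u') (perm_tensm (perm_tensm f g) h) =
  perm_comp mu (perm_tensm f (perm_tensm g h)) (perm_assoc k s t u).
Proof.
apply: ev_ext => V x y FV.
rewrite (codelta_compr _ (@assoc_codelta _ _ _) FV) (delta_compl _ (@assoc_delta _ _ _) FV).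
by rewrite !ev_tensm // /assoc_pt /assoc_inv_pt !(tp1_pair, tp2_pair) mulrA.
Qed.

Lemma perm_lunit_nat s t (f : perm_hom k s t) :
  perm_comp mu (perm_lunit k F0 t) (perm_tensm (perm_id k (perm_one F0)) f) =
  perm_comp mu f (perm_lunit k F0 s).
Proof.
apply: ev_ext => V x y FV.
rewrite (codelta_compr _ (@lunit_codelta _) FV) (delta_compl _ (@lunit_delta _) FV).
rewrite ev_tensm // ev_id // /lunit_inv_pt /lunit_pt tp1_pair tp2_pair.
by rewrite [tp1 x]pt1_eq eqxx mul1r.
Qed.

Lemma perm_runit_nat s t (f : perm_hom k s t) :
  perm_comp mu (perm_runit k F0 t) (perm_tensm f (perm_id k (perm_one F0))) =
  perm_comp mu f (perm_runit k F0 s).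
Proof.
apply: ev_ext => V x y FV.
rewrite (codelta_compr _ (@runit_codelta _) FV) (delta_compl _ (@runit_delta _) FV).
rewrite ev_tensm // ev_id // /runit_inv_pt /runit_pt tp1_pair tp2_pair.
by rewrite [tp2 x]pt1_eq eqxx mulr1.
Qed.

Lemma perm_braid_nat s t s' t' (f : perm_hom k s s') (g : perm_hom k t t') :
  perm_comp mu (perm_braid k s' t') (perm_tensm f g) =
  perm_comp mu (perm_tensm g f) (perm_braid k s t).
Proof.
apply: ev_ext => V x y FV.
rewrite (codelta_compr _ (@braid_codelta _ _) FV) (delta_compl _ (@braid_delta _ _) FV).
by rewrite !ev_tensm // /braid_pt !(tp1_pair, tp2_pair) mulrC.
Qed.

Lemma perm_braid_sym s t :
  perm_comp mu (perm_braid k t s) (perm_braid k s t) = perm_id k (perm_tens s t).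
Proof.
apply: ev_ext => V x y FV.
rewrite (codelta_compr _ (@braid_codelta _ _) FV) (braid_delta FV) ev_id //.
by rewrite [in RHS]tp_eq [in LHS]tp_eq /braid_pt !(tp1_pair, tp2_pair) andbC.
Qed.

Lemma perm_pentagon s t u v :
  perm_comp mu (perm_assoc k s t (perm_tens u v)) (perm_assoc k (perm_tens s t) u v) =
  perm_comp mu (perm_comp mu (perm_tensm (perm_id k s) (perm_assoc k t u v))
    (perm_assoc k s (perm_tens t u) v)) (perm_tensm (perm_assoc k s t u) (perm_id k v)).
Proof.
apply: ev_ext => V x y FV.
rewrite (delta_compl _ (@assoc_delta _ _ _) FV) (assoc_delta FV).
rewrite -perm_compA (codelta_compr _ (b := fun V FV y => tpair F_her FV (tp1 y) (assoc_inv_pt FV (tp2 y)))); last first.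
  move=> V' FV' x' y'; rewrite ev_tensm // ev_id // (assoc_codelta FV') natbM [in RHS]tp_eq.
  by rewrite !(tp1_pair, tp2_pair) eq_sym.
rewrite (codelta_compr _ (@assoc_codelta _ _ _) FV) ev_tensm // ev_id // (assoc_delta FV) natbM.
congr (nat_of_bool _)%:R.
rewrite ![in LHS]tp_eq ![in RHS]tp_eq /assoc_pt /assoc_inv_pt !(tp1_pair, tp2_pair).
by rewrite ?tp_eq ?(tp1_pair, tp2_pair) ?andbA.
Qed.

Lemma perm_triangle s t :
  perm_comp mu (perm_tensm (perm_id k s) (perm_lunit k F0 t)) (perm_assoc k s (perm_one F0) t) =
  perm_tensm (perm_runit k F0 s) (perm_id k t).
Proof.
apply: ev_ext => V x y FV.
rewrite (delta_compl _ (@assoc_delta _ _ _) FV) !ev_tensm // !ev_id // ev_lunit // ev_runit //.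
by rewrite !natbM /assoc_pt !(tp1_pair, tp2_pair).
Qed.

Lemma perm_hexagon s t u :
  perm_comp mu (perm_comp mu (perm_assoc k t u s) (perm_braid k s (perm_tens t u)))
    (perm_assoc k s t u) =
  perm_comp mu (perm_comp mu (perm_tensm (perm_id k t) (perm_braid k s u))
    (perm_assoc k t s u)) (perm_tensm (perm_braid k s t) (perm_id k u)).
Proof.
apply: ev_ext => V x y FV.
rewrite (delta_compl _ (@assoc_delta _ _ _) FV) (delta_compl _ (@braid_delta _ _) FV) (assoc_delta FV).
rewrite (delta_compl _ (a := fun V FV x => tpair F_her FV (braid_pt FV (tp1 x)) (tp2 x))); last first.
  move=> V' FV' x' y'; rewrite ev_tensm // ev_id // (braid_delta FV') natbM.
  by rewrite [in RHS]tp_eq !(tp1_pair, tp2_pair).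
rewrite (delta_compl _ (@assoc_delta _ _ _) FV) ev_tensm // ev_id // (braid_delta FV) natbM.
congr (nat_of_bool _)%:R.
rewrite [in LHS]tp_eq /assoc_pt /braid_pt !(tp1_pair, tp2_pair).
by rewrite ?tp_eq ?(tp1_pair, tp2_pair).
Qed.

Lemma perm_laws : smc_laws (perm_data F0 mu).
Proof.
split.
- exact: perm_compA.
- exact: perm_comp1m.
- exact: perm_compm1.
- exact: perm_comp_linear.
- exact: perm_comp_linearl.
- exact: perm_tensm1.
- exact: perm_tensm_comp.
- exact: perm_tensm_linear.
- exact: perm_tensm_linearl.
- move=> s t u; exists (transpose (perm_assoc k s t u)).
  exact: delta_inverse (@assoc_delta s t u) (@assoc_codelta s t u).
- exact: perm_assoc_nat.
- move=> s; exists (transpose (perm_lunit k F0 s)).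
  exact: delta_inverse (@lunit_delta s) (@lunit_codelta s).
- exact: perm_lunit_nat.
- move=> s; exists (transpose (perm_runit k F0 s)).
  exact: delta_inverse (@runit_delta s) (@runit_codelta s).
- exact: perm_runit_nat.
- exact: perm_braid_nat.
- exact: perm_braid_sym.
- exact: perm_pentagon.
- exact: perm_triangle.
- exact: perm_hexagon.
Qed.
End Laws.

(** * Duals and traces *)

Section Trace.
Variables (k : fieldType) (F : permutation -> Prop) (F0 : F empty_perm).
Variable mu : emb_function k.
Hypotheses (F_her : hereditary F) (muP : is_measure F mu).
Implicit Types s t u v : perm_ob F.

Let one : perm_ob F := perm_one F0.
Let pone V : pts one V := pt1 F0 V.

Lemma integ_tens_comp W s t (psi : forall V, embedding W V -> pts s V -> pts t V -> k) :
  F W -> (forall V V' (g : embedding V V') (e : embedding W V) x y, F V' ->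
    psi V' (comp_emb g e) (smap g x) (smap g y) = psi V e x y) ->
  integ F mu (fun V e (z : pts (perm_tens s t) V) => psi V e (tp1 z) (tp2 z)) =
  integ F mu (fun V e (x : pts s V) => integ F mu
    (fun V' (e' : embedding V V') (y : pts t V') => psi V' (comp_emb e' e) (smap e' x) y)).
Proof.
move=> FW npsi; rewrite (integ_tens F_her muP) //; last first.
  by move=> V V' g e x FV'; rewrite tp1_map tp2_map npsi.
apply: eq_integ => V e x FV; apply: eq_integ => V' e' y FV'.
by case: pselect => // FV2; rewrite tp1_pair tp2_pair.
Qed.

(** Morphisms [1 -> s ⊗ t] and [s ⊗ t -> 1] are kernels of two variables just like morphisms
    [s -> t]; this is self-duality in terms of kernels. *)
Definition curry_out s t (c : perm_hom k one (perm_tens s t)) : perm_hom k s t :=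
  of_kernel (fun V x y =>
    if pselect (F V) is left FV then ev c (pone V) (tpair F_her FV x y) else 0).

Definition curry_in s t (c : perm_hom k (perm_tens s t) one) : perm_hom k s t :=
  of_kernel (fun V x y =>
    if pselect (F V) is left FV then ev c (tpair F_her FV x y) (pone V) else 0).

Definition uncurry_out s t (f : perm_hom k s t) : perm_hom k one (perm_tens s t) :=
  of_kernel (fun V _ y => ev f (tp1 y) (tp2 y)).

Definition uncurry_in s t (f : perm_hom k s t) : perm_hom k (perm_tens s t) one :=
  of_kernel (fun V y _ => ev f (tp1 y) (tp2 y)).

Lemma ev_curry_out s t (c : perm_hom k one (perm_tens s t)) V (x : pts one V) y :
  F V -> ev c x y = ev (curry_out c) (tp1 y) (tp2 y).
Proof.
move=> FV; rewrite ev_of_kernel // => [|V1 V2 g x1 y1 F2].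
  by case: pselect => // FV'; rewrite tpairK [x]pt1_eq.
case: pselect => // F2'; case: pselect => [F1|/(_ (F_her g F2))//].
by rewrite -(smap_tpair F_her F1) -[pone V2](pt1_eq (smap g (pone V1))) ev_map.
Qed.

Lemma ev_curry_in s t (c : perm_hom k (perm_tens s t) one) V x (y : pts one V) :
  F V -> ev c x y = ev (curry_in c) (tp1 x) (tp2 x).
Proof.
move=> FV; rewrite ev_of_kernel // => [|V1 V2 g x1 y1 F2].
  by case: pselect => // FV'; rewrite tpairK [y]pt1_eq.
case: pselect => // F2'; case: pselect => [F1|/(_ (F_her g F2))//].
by rewrite -(smap_tpair F_her F1) -[pone V2](pt1_eq (smap g (pone V1))) ev_map.
Qed.

Lemma ev_uncurry_out s t (f : perm_hom k s t) V (x : pts one V) y : F V ->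
  ev (uncurry_out f) x y = ev f (tp1 y) (tp2 y).
Proof.
move=> FV; rewrite ev_of_kernel // => V1 V2 g x1 y1 _.
by rewrite tp1_map tp2_map ev_map.
Qed.

Lemma ev_uncurry_in s t (f : perm_hom k s t) V x (y : pts one V) : F V ->
  ev (uncurry_in f) x y = ev f (tp1 x) (tp2 x).
Proof.
move=> FV; rewrite ev_of_kernel // => V1 V2 g x1 y1 _.
by rewrite tp1_map tp2_map ev_map.
Qed.

Lemma uncurry_outK s t (f : perm_hom k s t) : curry_out (uncurry_out f) = f.
Proof.
apply: ev_ext => V x y FV.
rewrite -[x in LHS](tp1_pair F_her FV x y) -[y in X in ev _ _ X = _](tp2_pair F_her FV x y).
by rewrite -(ev_curry_out _ (pone V)) // ev_uncurry_out // tp1_pair tp2_pair.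
Qed.

Lemma uncurry_inK s t (f : perm_hom k s t) : curry_in (uncurry_in f) = f.
Proof.
apply: ev_ext => V x y FV.
rewrite -[x in LHS](tp1_pair F_her FV x y) -[y in X in ev _ _ X = _](tp2_pair F_her FV x y).
by rewrite -(ev_curry_in _ _ (pone V)) // ev_uncurry_in // tp1_pair tp2_pair.
Qed.

(** Kept general in [c] and [e]: the zigzags of any candidate dual compute the two composites of the
    curried kernels, so duality data amount to a pair of inverse kernels. Here the composite appears
    transposed, with [z] first. *)
Lemma ev_zigzag s d (c : perm_hom k one (perm_tens s d))
    (e : perm_hom k (perm_tens d s) one) V x z : F V ->
  ev (perm_comp mu (perm_comp mu (perm_comp mu (perm_runit k F0 s)
        (perm_tensm (perm_id k s) e)) (perm_assoc k s d s))
      (perm_tensm c (perm_id k s))) x z =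
  ev (perm_comp mu (curry_in e) (curry_out c)) z (tp2 x : pts s V).
Proof.
move=> FV; rewrite ev_comp //.
pose psi1 := fun V1 (h : embedding V V1) (w : pts (perm_tens s d) V1) (y : pts s V1) =>
    (smap h (tp2 x) == y)%:R * (ev (curry_out c) (tp1 w) (tp2 w) *
     (smap h z == tp1 w)%:R * ev (curry_in e) (tp2 w) y).
transitivity (integ F mu (fun V1 (h : embedding V V1) (y : pts (perm_tens (perm_tens s d) s) V1) =>
  psi1 V1 h (tp1 y) (tp2 y))).
  apply: eq_integ => V1 h y F1; rewrite /psi1 /comp_kernel.
  rewrite (delta_compl F_her muP _ (@assoc_delta _ _ F_her _ _ _) F1).
  rewrite (codelta_compr F_her muP _ (@runit_codelta _ _ F0 F_her _) F1).
  rewrite !(ev_tensm F_her) // (ev_id k F_her) // ev_curry_out // ev_curry_in // (ev_id k F_her) //.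
  rewrite /assoc_pt /runit_inv_pt !(tp1_pair, tp2_pair) tp2_map.
  by rewrite [_ == smap h z]eq_sym; ring.
apply: etrans (integ_tens_comp (psi := psi1) FV _) _.
  by move=> V1 V2 g h w y F2; rewrite /psi1 !smap_comp !smap_eq !tp1_map !tp2_map smap_eq !ev_map.
pose psi2 := fun V1 (h : embedding V V1) (w : pts s V1) (y : pts d V1) =>
    (smap h z == w)%:R * (ev (curry_out c) w y * ev (curry_in e) y (smap h (tp2 x))).
transitivity (integ F mu (fun V1 (h : embedding V V1) (w : pts (perm_tens s d) V1) =>
  psi2 V1 h (tp1 w) (tp2 w))).
  apply: eq_integ => V1 h w F1; rewrite /psi1; rewrite /psi2.
  pose phi : family k V1 (pts s) := fun V2 h' y => ev (curry_out c) (smap h' (tp1 w)) (smap h' (tp2 w)) *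
     (smap h' (smap h z) == smap h' (tp1 w))%:R * ev (curry_in e) (smap h' (tp2 w)) y.
  have nphi : natural F phi.
    by move=> V2 V3 g h' y F3; rewrite /phi !smap_comp !ev_map !smap_eq.
  transitivity (phi V1 (id_emb V1) (smap h (tp2 x))); last first.
    by rewrite /phi !smap_id; ring.
  rewrite -(integ_delta F_her muP _ F1 nphi); apply: eq_integ => V2 h' y F2.
  by rewrite /phi !smap_comp tp1_map tp2_map.
apply: etrans (integ_tens_comp (psi := psi2) FV _) _.
  by move=> V1 V2 g h w y F2; rewrite /psi2 !smap_comp !smap_eq !ev_map.
pose phi : family k V (pts s) := fun V1 h w => integ F mu (comp_kernel (curry_in e) (curry_out c)
  w (smap h (tp2 x))).
have nphi : natural F phi.
  move=> V1 V2 g h w F2; rewrite /phi smap_comp comp_kernel_basechange //.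
  exact: F_her g F2.
transitivity (phi V (id_emb V) z); last by rewrite /phi smap_id ev_comp.
rewrite -(integ_delta F_her muP z FV nphi).
apply: eq_integ => V1 h w F1; rewrite /psi2; rewrite /phi -integZ; apply: eq_integ => V2 h' y F2.
by rewrite /comp_kernel !smap_comp smap_eq.
Qed.

Lemma ev_zagzig s d (c : perm_hom k one (perm_tens s d))
    (e : perm_hom k (perm_tens d s) one) V x z : F V ->
  ev (perm_comp mu (perm_comp mu (perm_comp mu (perm_lunit k F0 d)
        (perm_tensm e (perm_id k d))) (transpose (perm_assoc k d s d)))
      (perm_tensm (perm_id k d) c)) x z =
  ev (perm_comp mu (curry_out c) (curry_in e)) (tp1 x : pts d V) z.
Proof.
move=> FV; rewrite ev_comp //.
pose psi3 := fun V1 (h : embedding V V1) (y : pts d V1) (w : pts (perm_tens s d) V1)  =>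
    (smap h (tp1 x) == y)%:R * (ev (curry_out c) (tp1 w) (tp2 w) *
     (smap h z == tp2 w)%:R * ev (curry_in e) y (tp1 w)).
transitivity (integ F mu (fun V1 (h : embedding V V1) (y : pts (perm_tens d (perm_tens s d)) V1) =>
  psi3 V1 h (tp1 y) (tp2 y))).
  apply: eq_integ => V1 h y F1; rewrite /psi3 /comp_kernel.
  rewrite (delta_compl F_her muP _ (a := @assoc_inv_pt _ F_her _ _ _) _ F1); last first.
    by move=> V2 F2 x2 y2; rewrite ev_transpose // (assoc_codelta k F_her F2).
  rewrite (codelta_compr F_her muP _ (@lunit_codelta _ _ F0 F_her _) F1).
  rewrite !(ev_tensm F_her) // (ev_id k F_her) // ev_curry_out // ev_curry_in // (ev_id k F_her) //.
  rewrite /assoc_inv_pt /lunit_inv_pt !(tp1_pair, tp2_pair) tp1_map.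
  by rewrite [_ == smap h z]eq_sym; ring.
apply: etrans (integ_tens_comp (psi := psi3) FV _) _.
  by move=> V1 V2 g h w y F2; rewrite /psi3 !smap_comp !smap_eq !tp1_map !tp2_map smap_eq !ev_map.
pose phi : family k V (pts d) := fun V1 h w => integ F mu (comp_kernel (curry_out c) (curry_in e)
  w (smap h z)).
have nphi : natural F phi.
  move=> V1 V2 g h w F2; rewrite /phi smap_comp comp_kernel_basechange //.
  exact: F_her g F2.
transitivity (phi V (id_emb V) (tp1 x)); last by rewrite /phi smap_id ev_comp.
rewrite -(integ_delta F_her muP (tp1 x) FV nphi).
apply: eq_integ => V1 h w F1; rewrite /psi3; rewrite /phi -integZ.
pose psi4 := fun V2 (h' : embedding V1 V2) (y : pts s V2) (y' : pts d V2) =>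
    (smap h (tp1 x) == w)%:R * ((smap h' (smap h z) == y')%:R *
      (ev (curry_out c) y y' * ev (curry_in e) (smap h' w) y)).
transitivity (integ F mu (fun V2 (h' : embedding V1 V2) (w' : pts (perm_tens s d) V2) =>
  psi4 V2 h' (tp1 w') (tp2 w'))).
  apply: eq_integ => V2 h' y F2; rewrite /psi4 !smap_comp smap_eq; ring.
apply: etrans (integ_tens_comp (psi := psi4) F1 _) _.
  by move=> V2 V3 g h' y y' F3; rewrite /psi4 !smap_comp !smap_eq !ev_map.
apply: eq_integ => V2 h' y F2; rewrite /psi4.
rewrite integZ; congr (_ * _).
pose chi : family k V2 (pts d) := fun V3 g y' =>
  ev (curry_out c) (smap g y) y' * ev (curry_in e) (smap (comp_emb g h') w) (smap g y).
have nchi : natural F chi.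
  by move=> V3 V4 g' g y' F4; rewrite /chi -comp_embA !smap_comp !ev_map.
transitivity (chi V2 (id_emb V2) (smap h' (smap h z))).
  rewrite -(integ_delta F_her muP _ F2 nchi); apply: eq_integ => V3 g y' F3.
  by rewrite /chi !smap_comp.
by rewrite /chi /comp_kernel smap_id comp_id_emb mulrC.
Qed.

Definition itr s (f : perm_hom k s s) : k :=
  integ F mu (fun V (e : embedding empty_perm V) (x : pts s V) => ev f x x).

Lemma itr_comp s t (g : perm_hom k t s) (f : perm_hom k s t) :
  itr (perm_comp mu g f) =
  integ F mu (fun V (e : embedding empty_perm V) (x : prod_species (pts s) (pts t) V) =>
     ev f x.1 x.2 * ev g x.2 x.1).
Proof.
rewrite integ_Fubini //; last first.
  by move=> V V' h e x F'; rewrite /= !ev_map.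
by apply: eq_integ => V e x FV; rewrite ev_comp.
Qed.

Lemma itrC s t (g : perm_hom k t s) (f : perm_hom k s t) :
  itr (perm_comp mu g f) = itr (perm_comp mu f g).
Proof.
rewrite !itr_comp.
rewrite (@integ_iso k F mu F_her muP _ (prod_species (pts t) (pts s)) (prod_species (pts s) (pts t))
  (fun V x => (x.2, x.1))) //.
- by apply: eq_integ => V e x FV; rewrite mulrC.
- by move=> V V' h e x F'; rewrite /= !ev_map.
- by move=> V FV; exists (fun x : prod_species (pts s) (pts t) V => (x.2, x.1)) => -[].
- by move=> V x _; rewrite /= /prod_supp /= setUC.
Qed.

(* The trace pairing is diagonal in the basis of amalgamations. *)
Lemma itr_amalgs s t (g : perm_hom k t s) (f : perm_hom k s t) :
  itr (perm_comp mu g f) = \sum_(c : amalgs s t)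
    mu (emb_empty (am_ob c)) * (f c * ev g (rp c) (lp c)).
Proof.
rewrite itr_comp (@integ_index k F mu F_her muP _ _ _ (amalgs s t) predT
  (fun c => am_ob c) (fun c => emb_empty (am_ob c))
  (fun c => (lp c, rp c) : prod_species (pts s) (pts t) (am_ob c))) //.
- by apply: eq_bigr => c _; rewrite evE.
- by move=> V V' h e x F'; rewrite /= !ev_map.
- by move=> c _; apply: am_mem.
- by move=> c _ v; right; rewrite inE; apply/orP/am_cover.
- move=> V a [x y] FV; have [c [h [hx hy]]] := amalgs_complete F_her x y FV.
  exists c; split=> //; exists h; split; first exact: emb_empty_unique.
  by rewrite -hx -hy.
move=> c d h _ _ _ E.
have El : smap h (lp c) = lp d :=
  congr1 (fun x : prod_species (pts s) (pts t) (am_ob d) => x.1) E.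
have Er : smap h (rp c) = rp d :=
  congr1 (fun x : prod_species (pts s) (pts t) (am_ob d) => x.2) E.
exact: amalgs_rigid El Er.
Qed.

Definition delta_hom s t (c : amalgs s t) : perm_hom k s t := [ffun d => (d == c)%:R].

Lemma itr_delta s t (c : amalgs s t) (f : perm_hom k s t) :
  itr (perm_comp mu (transpose (delta_hom c)) f) = mu (emb_empty (am_ob c)) * f c.
Proof.
rewrite itr_amalgs (bigD1 c) //= big1 => [|d dc].
  by rewrite (ev_transpose F_her) ?evE ?ffunE ?eqxx ?mulr1 ?addr0 //; exact: am_mem.
by rewrite (ev_transpose F_her) ?evE ?ffunE ?(negbTE dc) ?mulr0 //; exact: am_mem.
Qed.

(** For arbitrary [e] and [c] the categorical formula is the integral trace twisted by their
    composite kernel. For a duality the zigzag makes this composite the identity, so every choice of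
    dual gives [itr]. *)
Lemma ev_trace s d (c : perm_hom k one (perm_tens s d))
    (e : perm_hom k (perm_tens d s) one) (f : perm_hom k s s) :
  ev (perm_comp mu (perm_comp mu (perm_comp mu e (perm_braid k s d))
     (perm_tensm f (perm_id k d))) c) (pone empty_perm) (pone empty_perm) =
  itr (perm_comp mu (transpose (perm_comp mu (curry_in e) (curry_out c))) f).
Proof.
rewrite ev_comp //.
pose psi5 := fun V (h : embedding empty_perm V) (x : pts s V) (y : pts d V) =>
    ev (curry_out c) x y * integ F mu (comp_kernel (transpose (curry_in e)) f x y).
transitivity (integ F mu (fun V (h : embedding empty_perm V) (w : pts (perm_tens s d) V) =>
  psi5 V h (tp1 w) (tp2 w))).
  apply: eq_integ => V h w FV; rewrite /psi5 /comp_kernel ev_curry_out //; congr (_ * _).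
  rewrite ev_comp //.
  pose psi6 := fun V1 (h1 : embedding V V1) (x : pts s V1) (y : pts d V1) =>
      (smap h1 (tp2 w) == y)%:R * (ev f (smap h1 (tp1 w)) x * ev (curry_in e) y x).
  transitivity (integ F mu (fun V1 (h1 : embedding V V1) (w' : pts (perm_tens s d) V1) =>
    psi6 V1 h1 (tp1 w') (tp2 w'))).
    apply: eq_integ => V1 h1 w' F1; rewrite /psi6 /comp_kernel (ev_tensm F_her) // (ev_id k F_her) //.
    rewrite (delta_compl F_her muP _ (@braid_delta _ _ F_her _ _) F1) ev_curry_in //.
    rewrite /braid_pt tp1_pair tp2_pair tp1_map tp2_map; ring.
  apply: etrans (integ_tens_comp (psi := psi6) FV _) _.
    by move=> V2 V3 g h' y y' F3; rewrite /psi6 !smap_comp !smap_eq !ev_map.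
  apply: eq_integ => V1 h1 x F1; rewrite /psi6.
  pose chi : family k V1 (pts d) := fun V2 g y' =>
    ev f (smap g (smap h1 (tp1 w))) (smap g x) * ev (curry_in e) y' (smap g x).
  have nchi : natural F chi.
    by move=> V3 V4 g' g y' F4; rewrite /chi !smap_comp !ev_map.
  transitivity (chi V1 (id_emb V1) (smap h1 (tp2 w))).
    rewrite -(integ_delta F_her muP _ F1 nchi); apply: eq_integ => V3 g y' F3.
    by rewrite /chi !smap_comp.
  by rewrite /chi !smap_id ev_transpose.
apply: etrans (integ_tens_comp (psi := psi5) F0 _) _.
  move=> V2 V3 g h' y y' F3; rewrite /psi5 ev_map comp_kernel_basechange //.
  exact: F_her g F3.
apply: eq_integ => V h x FV; rewrite /psi5; rewrite ev_comp //.
transitivity (integ F mu (fun V1 (h1 : embedding V V1) (y : pts d V1) =>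
  integ F mu (fun V2 (h2 : embedding V1 V2) (x' : pts s V2) =>
    (fun V2 (h2 : embedding V V2) (y : pts d V2) (x' : pts s V2) =>
    ev (curry_out c) (smap h2 x) y * (ev f (smap h2 x) x' * ev (curry_in e) y x')) V2
       (comp_emb h2 h1) (smap h2 y) x'))).
  apply: eq_integ => V1 h1 y F1; rewrite -integZ; apply: eq_integ => V2 h2 x' F2.
  by rewrite /comp_kernel smap_comp ev_map ev_transpose.
rewrite (integ_swap F_her muP (phi := (fun V2 (h2 : embedding V V2) (y : pts d V2) (x' : pts s V2) =>
    ev (curry_out c) (smap h2 x) y * (ev f (smap h2 x) x' * ev (curry_in e) y x')))) //; last first.
  by move=> V2 V3 g h' y y' F3; rewrite !smap_comp !ev_map.
apply: eq_integ => V1 h1 x' F1; rewrite /comp_kernel ev_transpose // ev_comp // -integZ.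
apply: eq_integ => V2 h2 y F2; rewrite /comp_kernel !smap_comp ev_map; ring.
Qed.

Lemma ev_one_const (f : perm_hom k one one) V (x y : pts one V) :
  ev f x y = ev f (pone empty_perm) (pone empty_perm).
Proof.
rewrite [x]pt1_eq [y]pt1_eq -(ev_map f (emb_empty V)).
by rewrite [smap _ _]pt1_eq.
Qed.

Lemma one_scalar (f : perm_hom k one one) :
  f = ev f (pone empty_perm) (pone empty_perm) *: perm_id k one.
Proof.
apply: ev_ext => V x y FV; rewrite evZ (ev_id k F_her) // [x]pt1_eq [y]pt1_eq eqxx mulr1.
exact: ev_one_const.
Qed.

Lemma perm_comp_transpose s t u (g : perm_hom k t u) (f : perm_hom k s t) :
  transpose (perm_comp mu g f) = perm_comp mu (transpose f) (transpose g).
Proof.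
apply: ev_ext => V z x FV; rewrite ev_transpose // !ev_comp //.
by apply: eq_integ => V' e y F'; rewrite /comp_kernel !ev_transpose // mulrC.
Qed.

Lemma transposeK s t (f : perm_hom k s t) : transpose (transpose f) = f.
Proof. by apply: ev_ext => V x y FV; rewrite !ev_transpose. Qed.

Lemma transpose_id s : transpose (perm_id k s) = perm_id k s.
Proof.
by apply: ev_ext => V x y FV; rewrite ev_transpose // !(ev_id k F_her) // eq_sym.
Qed.
End Trace.

(** * Integer-valued measures take values in [{0, 1, -1}] *)

Section Configurations.

Definition same_order (T : Type) (V V' : permutation) (f : T -> V) (f' : T -> V') :=
  forall a b, lt1 (f a) (f b) = lt1 (f' a) (f' b) /\
              lt2 (f a) (f b) = lt2 (f' a) (f' b).

Lemma same_order_inj (T : Type) (V V' : permutation) (f : T -> V) (f' : T -> V') a b :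
  same_order f f' -> f a = f b -> f' a = f' b.
Proof.
move=> so E; apply/eqP/negPn/negP => ne.
have [irr _ _] := lt1_total V; have [_ _ tot] := lt1_total V'.
by have := tot _ _ ne; rewrite -!(so _ _).1 E irr.
Qed.

Lemma config_emb (T : Type) (V V' : permutation) (f : T -> V) (f' : T -> V') :
  (forall v, exists a, f a = v) -> same_order f f' ->
  exists h : embedding V V', forall a, h (f a) = f' a.
Proof.
move=> /choice[r rK] so; have hP : is_emb (fun v => f' (r v)).
  by apply: monotone_is_emb => x y; [rewrite -(so _ _).1 | rewrite -(so _ _).2];
    rewrite !rK.
by exists (mk_emb hP) => a; rewrite mk_embE; apply: (same_order_inj so).
Qed.

(** The images of the two configurations are isomorphic substructures, and by naturality [psi] sees
    nothing outside them. *)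
Lemma config_const (T : finType) (R : Type) (psi : forall V : permutation, (T -> V) -> R)
    (V V' : permutation) (f : T -> V) (f' : T -> V') :
  (forall V V' (g : embedding V V') f, psi V' (fun a => g (f a)) = psi V f) ->
  same_order f f' -> psi V f = psi V' f'.
Proof.
move=> npsi so; pose U := [set f a | a : T].
have fU a : f a \in U by apply: imset_f.
pose f0 a : sub_perm U := exist _ (f a) (fU a).
have Ef : (fun a => sub_emb U (f0 a)) = f by apply/funext => a; rewrite mk_embE.
have [||h hE] := @config_emb T (sub_perm U) V' f0 f'; last first.
- by rewrite -[in LHS]Ef npsi -(npsi _ _ h) (funext hE).
- by move=> a b; exact: so a b.
move=> [v vU]; have /imsetP[a _ va] := vU.
by exists a; apply/val_inj; rewrite /= va.
Qed.

Definition elt_smap V V' (g : embedding V V') (x : points V) : points V' := g x.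

Fact elt_smap_comp U V W (g : embedding V W) (f : embedding U V) x :
  elt_smap (comp_emb g f) x = elt_smap g (elt_smap f x).
Proof. exact: comp_embE. Qed.
Fact elt_smap_inj V V' (g : embedding V V') : injective (elt_smap g).
Proof. exact: emb_inj. Qed.
Fact elt_supp_map V V' (g : embedding V V') x : [set elt_smap g x] = g @: [set x].
Proof. by rewrite imset_set1. Qed.
Fact elt_supp_desc V V' (g : embedding V V') (x : points V') :
  (forall v, v \in [set x] -> exists u, g u = v) -> exists x', elt_smap g x' = x.
Proof. by move=> /(_ x); rewrite inE eqxx => /(_ isT). Qed.
Fact elt_supp_bound V (x : points V) : (#|[set x]| <= 1)%N.
Proof. by rewrite cards1. Qed.

Definition elt : species := Species elt_smap_comp elt_smap_inj elt_supp_map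
  elt_supp_desc elt_supp_bound.

End Configurations.

(** * Measures of cells for an integer-valued measure *)

Section Values.
Variable mu : emb_function int.
Hypothesis muP : is_measure all_perms mu.

Let all_her : hereditary all_perms. Proof. by []. Qed.

Let Int W (phi : forall V, embedding W V -> V -> int) : int :=
  integ all_perms mu (phi : family int W elt).

Let nat1 W (phi : forall V, embedding W V -> V -> int) :=
  forall V V' (g : embedding V V') e x, phi V' (comp_emb g e) (g x) = phi V e x.

Lemma Int_eq W (phi psi : forall V, embedding W V -> V -> int) :
  (forall V e x, phi V e x = psi V e x) -> Int phi = Int psi.
Proof. by move=> H; apply: eq_integ => V e x _; apply: H. Qed.

Lemma IntD W (phi psi : forall V, embedding W V -> V -> int) :
  Int (fun V e x => phi V e x + psi V e x) = Int phi + Int psi.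
Proof. exact: integD. Qed.

Lemma IntZ W a (phi : forall V, embedding W V -> V -> int) :
  Int (fun V e x => a * phi V e x) = a * Int phi.
Proof. exact: integZ. Qed.

Lemma Int_basechange W W2 (j : embedding W W2) (phi : forall V, embedding W V -> V -> int) :
  nat1 phi -> Int (fun V (e : embedding W2 V) x => phi V (comp_emb e j) x) = Int phi.
Proof.
by move=> nphi; apply: (integ_basechange all_her muP).
Qed.

Lemma Int_swap W (phi : forall V, embedding W V -> V -> V -> int) :
  (forall V V' (g : embedding V V') e x y,
     phi V' (comp_emb g e) (g x) (g y) = phi V e x y) ->
  Int (fun V e x => Int (fun V' (e' : embedding V V') y => phi V' (comp_emb e' e) (e' x) y)) =
  Int (fun V e y => Int (fun V' (e' : embedding V V') x => phi V' (comp_emb e' e) x (e' y))).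
Proof.
move=> nphi.
by apply: (@integ_swap int all_perms mu all_her muP W elt elt phi).
Qed.

Lemma Int_delta W (phi : forall V, embedding W V -> V -> int) (x0 : W) :
  nat1 phi -> Int (fun V e x => (e x0 == x)%:R * phi V e x) = phi W (id_emb W) x0.
Proof.
move=> nphi.
apply: (@integ_delta int all_perms mu all_her muP W elt (phi : family int W elt) x0) => //.
Qed.

Definition dlt1 (a : bool) V (x y : V : permutation) := if a then lt1 x y else lt1 y x.
Definition dlt2 (a : bool) V (x y : V : permutation) := if a then lt2 x y else lt2 y x.

(** [true] is the increasing direction in each order, so negating both signs gives the opposite
    quadrant. *)
Definition quad (a b : bool) (V : permutation) (x y : V) : bool :=
  dlt1 a x y && dlt2 b x y.

Lemma quad_map a b V V' (g : embedding V V') x y : quad a b (g x) (g y) = quad a b x y.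
Proof. by rewrite /quad /dlt1 /dlt2 !emb_lt1 !emb_lt2. Qed.

Lemma quad_opp a b V (x y : V : permutation) : quad (~~ a) (~~ b) x y = quad a b y x.
Proof. by case: a b => [] []. Qed.

Lemma dlt_trans V (x y z : V : permutation) a b :
  (dlt1 a x y -> dlt1 a y z -> dlt1 a x z) /\ (dlt2 b x y -> dlt2 b y z -> dlt2 b x z).
Proof.
have [_ t1 _] := lt1_total V; have [_ t2 _] := lt2_total V.
split; rewrite /dlt1 /dlt2; [case: a | case: b].
- exact: t1.
- by move=> *; apply: (t1 y).
- exact: t2.
- by move=> *; apply: (t2 y).
Qed.

Lemma dlt1N a V (x y : V : permutation) : dlt1 a x y -> ~~ dlt1 (~~ a) x y.
Proof.
have [irr tr _] := lt1_total V.
by move=> H; apply/negP; case: a H => /= H H'; have := tr _ _ _ H H'; rewrite irr.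
Qed.

Lemma dlt2N a V (x y : V : permutation) : dlt2 a x y -> ~~ dlt2 (~~ a) x y.
Proof.
have [irr tr _] := lt2_total V.
by move=> H; apply/negP; case: a H => /= H H'; have := tr _ _ _ H H'; rewrite irr.
Qed.

Lemma quad_trans a b V (x y z : V : permutation) :
  quad a b x y -> quad a b y z -> quad a b x z.
Proof.
move=> /andP[x1 x2] /andP[y1 y2]; apply/andP.
have [t1 t2] := dlt_trans x y z a b.
by split; [apply: t1 | apply: t2].
Qed.

Lemma quad_split V (x y : V : permutation) :
  ((x == y) + (quad true true x y + quad false false x y) +
   (quad true false x y + quad false true x y))%N = 1%N.
Proof.
have [irr1 tr1 tot1] := lt1_total V; have [irr2 tr2 tot2] := lt2_total V.
have N1 : lt1 x y -> lt1 y x -> False.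
  by move=> H H'; have := tr1 _ _ _ H H'; rewrite irr1.
have N2 : lt2 x y -> lt2 y x -> False.
  by move=> H H'; have := tr2 _ _ _ H H'; rewrite irr2.
rewrite /quad /dlt1 /dlt2; case: eqVneq => [->|ne]; first by rewrite !irr1.
move: (tot1 _ _ ne) (tot2 _ _ ne) N1 N2.
case: (lt1 x y) (lt1 y x) (lt2 x y) (lt2 y x) => [] [] [] [] //= _ _ H H';
  by [case: (H isT isT) | case: (H' isT isT)].
Qed.

Lemma quad_splitR a b V (x y : V : permutation) :
  1 = (x == y)%:R + ((quad a b x y)%:R + (quad (~~ a) (~~ b) x y)%:R) +
      ((quad a (~~ b) x y)%:R + (quad (~~ a) b x y)%:R) :> int.
Proof.
have := quad_split x y; case: a b => [] [] /=.
all: by case: (x == y) (quad true true x y) (quad true false x y)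
  (quad false true x y) (quad false false x y) => [] [] [] [] [].
Qed.

Lemma quadE a b V (x y : V : permutation) : quad a b x y ->
  [/\ lt1 x y = a, lt1 y x = ~~ a, lt2 x y = b & lt2 y x = ~~ b].
Proof.
move=> /andP[x1 x2]; have n1 := dlt1N x1; have n2 := dlt2N x2; move: n1 n2 x1 x2.
rewrite /dlt1 /dlt2; case: a b => [] [] /= /negbTE -> /negbTE -> -> ->; by split.
Qed.

Definition same_cut (V V' : permutation) (x y : V) (x' y' : V') :=
  [/\ lt1 x y = lt1 x' y', lt1 y x = lt1 y' x', lt2 x y = lt2 x' y' &
      lt2 y x = lt2 y' x'].

Lemma quad_same_cut a b (V V' : permutation) (x y : V) (x' y' : V') :
  quad a b x y -> quad a b x' y' -> same_cut x y x' y'.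
Proof. by move=> /quadE[e1 e2 e3 e4] /quadE[e1' e2' e3' e4']; split; congruence. Qed.

Definition ext (T : Type) (V : Type) (f : T -> V) (z : V) (o : option T) :=
  if o is Some t then f t else z.

Lemma same_order_ext (T : Type) (V V' : permutation) (f : T -> V) (f' : T -> V') z z' :
  same_order f f' -> (forall t, same_cut (f t) z (f' t) z') ->
  same_order (ext f z) (ext f' z').
Proof.
have [irr1 _ _] := lt1_total V; have [irr2 _ _] := lt2_total V.
have [irr1' _ _] := lt1_total V'; have [irr2' _ _] := lt2_total V'.
move=> so cut [a|] [b|] /=.
- exact: (so a b).
- by have [-> _ -> _] := cut a.
- by have [_ -> _ ->] := cut b.
- by rewrite irr1 irr2 irr1' irr2'.
Qed.

(** All configurations satisfying [P] are isomorphic, so a natural function has one value on them;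
    if there are none, [0] serves as the constant. *)
Lemma config_constant (T : finType) (P : forall V : permutation, (T -> V) -> Prop)
    (psi : forall V : permutation, (T -> V) -> int) :
  (forall V V' (g : embedding V V') f, psi V' (fun a => g (f a)) = psi V f) ->
  (forall V V' f f', P V f -> P V' f' -> same_order f f') ->
  exists c, forall V f, P V f -> psi V f = c.
Proof.
move=> npsi PP; case: (pselect (exists V f, P V f)) => [[V [f Pf]]|H].
  exists (psi V f) => V' f' Pf'; apply: config_const => //; exact: PP.
by exists 0 => V f Pf; case: H; exists V, f.
Qed.

(** ** Constants attached to a cell *)

Definition between a b V (z w y : V : permutation) := quad a b z y && quad a b y w.

Lemma between_map a b V V' (g : embedding V V') z w y :
  between a b (g z) (g w) (g y) = between a b z w y.
Proof. by rewrite /between !quad_map. Qed.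

(** All pairs in a given quadrant relation are isomorphic, so all their boxes have the same measure;
    for other pairs the box is empty by transitivity. The constant refers to no cell, and this gives
    [s_dich] its strength. *)
Lemma between_const a b : exists u : int, forall V (z w : V : permutation),
  Int (fun V' (g : embedding V V') y => (between a b (g z) (g w) y)%:R) =
  u * (quad a b z w)%:R.
Proof.
pose psi V (f : bool -> V : permutation) := Int (fun V' (g : embedding V V') y =>
  (between a b (g (f true)) (g (f false)) y)%:R).
have [||u uE] := @config_constant _ (fun V f => quad a b (f true) (f false)) psi.
- move=> V V' g f; rewrite /psi -(Int_basechange g); last first.
    by move=> V1 V2 h e x; rewrite !comp_embE between_map.
  by apply: Int_eq => V1 e x; rewrite !comp_embE.
- move=> V V' f f' /quadE[e1 e2 e3 e4] /quadE[e1' e2' e3' e4'].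
  have [irr1 _ _] := lt1_total V; have [irr2 _ _] := lt2_total V.
  have [irr1' _ _] := lt1_total V'; have [irr2' _ _] := lt2_total V'.
  by case=> -[]; rewrite ?irr1 ?irr2 ?irr1' ?irr2' ?e1 ?e2 ?e3 ?e4 ?e1' ?e2' ?e3' ?e4'.
exists u => V z w; case: (boolP (quad a b z w)) => zw.
  by rewrite mulr1 -(uE V (fun i => if i then z else w)).
rewrite mulr0 -[RHS](mul0r (Int (fun V' (_ : embedding V V') _ => 0))) -IntZ.
apply: Int_eq => V' e y; rewrite mul0r /between.
case: (boolP (quad a b (e z) y)) => //= zy; case: (boolP (quad a b y (e w))) => // yw.
by have := quad_trans zy yw; rewrite quad_map (negbTE zw).
Qed.

Definition u_ a b : int := projT1 (cid (between_const a b)).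

Lemma u_E a b V (z w : V : permutation) :
  Int (fun V' (g : embedding V V') y => (between a b (g z) (g w) y)%:R) =
  u_ a b * (quad a b z w)%:R.
Proof. by rewrite /u_; case: cid. Qed.

Section Cell.
Variables (X : permutation) (c1 c2 : X -> bool).

(** The signs [c1] and [c2] prescribe on which side of each point of [X] the point [y] lies;
    choosing such a cell is choosing a one-point extension of [X]. *)
Definition in_cell (V : permutation) (f : X -> V) (y : V) : bool :=
  [forall t, quad (c1 t) (c2 t) (f t) y].

Lemma in_cell_map V V' (g : embedding V V') (f : X -> V) y :
  in_cell (fun t => g (f t)) (g y) = in_cell f y.
Proof. by apply: eq_forallb => t; rewrite quad_map. Qed.

Lemma in_cell_ext V (f f' : X -> V : permutation) y : f =1 f' -> in_cell f y = in_cell f' y.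
Proof. by move=> ff'; apply: eq_forallb => t; rewrite ff'. Qed.

(** Cells are convex: in each order, one of the corners [z] and [w] lies between [f t] and [y], and
    transitivity through that corner gives the sign of [y]. *)
Lemma between_cell a b V (f : X -> V : permutation) z w y :
  in_cell f z -> in_cell f w -> between a b z w y -> in_cell f y.
Proof.
move=> /forallP Cz /forallP Cw /andP[/andP[z1 z2] /andP[w1 w2]].
apply/forallP => t; have /andP[f1 f2] := Cz t; have /andP[g1 g2] := Cw t.
apply/andP; split.
  case: (eqVneq (c1 t) a) => [E|ne]; [rewrite -E in z1 |].
    by have [tr _] := dlt_trans (f t) z y (c1 t) true; apply: tr.
  have [tr _] := dlt_trans (f t) w y (c1 t) true; apply: tr => //.
  by case: (c1 t) a ne w1 {f1 g1 z1} => [] [].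
case: (eqVneq (c2 t) b) => [E|ne]; [rewrite -E in z2 |].
  by have [_ tr] := dlt_trans (f t) z y true (c2 t); apply: tr.
have [_ tr] := dlt_trans (f t) w y true (c2 t); apply: tr => //.
by case: (c2 t) b ne w2 {f2 g2 z2} => [] [].
Qed.

Definition cel V (e : embedding X V) (y : V) : bool := in_cell e y.

Lemma cel_map V V' (g : embedding V V') (e : embedding X V) y :
  cel (comp_emb g e) (g y) = cel e y.
Proof.
by rewrite /cel -(in_cell_map g); apply: in_cell_ext => t; rewrite comp_embE.
Qed.

Lemma cel_same_order V V' (e : embedding X V) (e' : embedding X V') z z' :
  cel e z -> cel e' z' -> same_order (ext e z) (ext e' z').
Proof.
move=> /forallP Cz /forallP Cz'; apply: same_order_ext => [a b|t].
  by rewrite !emb_lt1 !emb_lt2.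
exact: quad_same_cut (Cz t) (Cz' t).
Qed.

Definition v_ : int := Int (fun V (e : embedding X V) z => (cel e z)%:R).

Lemma nat_cel : nat1 (fun V (e : embedding X V) z => (cel e z)%:R).
Proof. by move=> V V' g e x; rewrite cel_map. Qed.

Lemma v_E V (e : embedding X V) :
  Int (fun V' (g : embedding V V') z => (cel (comp_emb g e) z)%:R) = v_.
Proof. exact: Int_basechange nat_cel. Qed.

(** This is the measure of a quadrant of the cell seen from one of its points; it is constant
    because any two points of the cell are isomorphic over [X]. *)
Lemma s_const a b : exists s : int, forall V (e : embedding X V) z,
  Int (fun V' (g : embedding V V') y => (cel e z && cel (comp_emb g e) y && quad a b (g z) y)%:R) =
  s * (cel e z)%:R.
Proof.
pose psi V (f : option X -> V : permutation) := Int (fun V' (g : embedding V V') y =>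
  (in_cell (fun t => g (f (Some t))) y && quad a b (g (f None)) y)%:R).
have [||s sE] := @config_constant _ (fun V f => exists (e : embedding X V) z,
  cel e z /\ f = ext e z) psi.
- move=> V V' g f; rewrite /psi -(Int_basechange g); last first.
    move=> V1 V2 h e x; rewrite !comp_embE quad_map -(in_cell_map h).
    by congr (nat_of_bool (_ && _))%:R; apply: in_cell_ext => t; rewrite comp_embE.
  apply: Int_eq => V1 e x; rewrite !comp_embE.
  by congr (nat_of_bool (_ && _))%:R; apply: in_cell_ext => t; rewrite comp_embE.
- by move=> V V' f f' [e [z [Cz ->]]] [e' [z' [Cz' ->]]]; apply: cel_same_order.
exists s => V e z; case: (boolP (cel e z)) => Cz; last first.
  by rewrite mulr0 /=; apply: integ0.
rewrite mulr1 -(sE V (ext e z)); last by exists e, z.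
apply: Int_eq => V' g y /=; congr (nat_of_bool (_ && _))%:R.
by apply: in_cell_ext => t; rewrite comp_embE.
Qed.

Definition s_ a b : int := projT1 (cid (s_const a b)).

Lemma s_E a b V (e : embedding X V) z :
  Int (fun V' (g : embedding V V') y => (cel e z && cel (comp_emb g e) y && quad a b (g z) y)%:R) =
  s_ a b * (cel e z)%:R.
Proof. by rewrite /s_; case: cid. Qed.

(** Once the quadrant of [z2] seen from [z1] is fixed, the pair has one isomorphism type over [X],
    so the part of the cell cut out by a quadrant at each of the two points has constant measure. *)
Lemma l_const a b a1 b1 a2 b2 : exists l : int, forall V (e : embedding X V) z1 z2,
  Int (fun V' (g : embedding V V') y => ([&& cel e z1, cel e z2 & quad a b z1 z2] &&
    [&& cel (comp_emb g e) y, quad a1 b1 (g z1) y & quad a2 b2 (g z2) y])%:R) =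
  l * [&& cel e z1, cel e z2 & quad a b z1 z2]%:R.
Proof.
pose psi V (f : option (option X) -> V : permutation) := Int (fun V' (g : embedding V V') y =>
  [&& in_cell (fun t => g (f (Some (Some t)))) y, quad a1 b1 (g (f (Some None))) y &
   quad a2 b2 (g (f None)) y]%:R).
have [||l lE] := @config_constant _ (fun V f => exists (e : embedding X V) z1 z2,
  [&& cel e z1, cel e z2 & quad a b z1 z2] /\ f = ext (ext e z1) z2) psi.
- move=> V V' g f; rewrite /psi -(Int_basechange g); last first.
    move=> V1 V2 h e x; rewrite !comp_embE !quad_map -(in_cell_map h).
    by congr (nat_of_bool (_ && _))%:R; apply: in_cell_ext => t; rewrite comp_embE.
  apply: Int_eq => V1 e x; rewrite !comp_embE.
  by congr (nat_of_bool (_ && _))%:R; apply: in_cell_ext => t; rewrite comp_embE.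
- move=> V V' f f' [e [z1 [z2 [/and3P[C1 C2 q] ->]]]] [e' [z1' [z2' [/and3P[C1' C2' q'] ->]]]].
  apply: same_order_ext; first exact: cel_same_order.
  case=> [t|] /=; last exact: quad_same_cut q q'.
  exact: quad_same_cut (forallP C2 t) (forallP C2' t).
exists l => V e z1 z2; case: (boolP [&& cel e z1, cel e z2 & quad a b z1 z2]) => C; last first.
  by rewrite mulr0 /=; apply: integ0.
rewrite mulr1 -(lE V (ext (ext e z1) z2)); last by exists e, z1, z2.
apply: Int_eq => V' g y /=; congr (nat_of_bool (_ && _))%:R.
by apply: in_cell_ext => t; rewrite comp_embE.
Qed.

Definition l_ a b a1 b1 a2 b2 : int := projT1 (cid (l_const a b a1 b1 a2 b2)).

Lemma l_E a b a1 b1 a2 b2 V (e : embedding X V) z1 z2 :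
  Int (fun V' (g : embedding V V') y => ([&& cel e z1, cel e z2 & quad a b z1 z2] &&
    [&& cel (comp_emb g e) y, quad a1 b1 (g z1) y & quad a2 b2 (g z2) y])%:R) =
  l_ a b a1 b1 a2 b2 * [&& cel e z1, cel e z2 & quad a b z1 z2]%:R.
Proof. by rewrite /l_; case: cid. Qed.

(** The term [1] is the point [z] itself; all other points fall into its four quadrants, grouped
    here in opposite pairs. *)
Lemma Int_split W (B : forall V, embedding W V -> V -> bool) (z : W) a b :
  (forall V V' (g : embedding V V') e x, B V' (comp_emb g e) (g x) = B V e x) ->
  B W (id_emb W) z ->
  Int (fun V e y => (B V e y)%:R) = 1 +
   (Int (fun V e y => (B V e y && quad a b (e z) y)%:R) +
    Int (fun V e y => (B V e y && quad (~~ a) (~~ b) (e z) y)%:R)) +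
   (Int (fun V e y => (B V e y && quad a (~~ b) (e z) y)%:R) +
    Int (fun V e y => (B V e y && quad (~~ a) b (e z) y)%:R)).
Proof.
move=> nB Bz.
have E : Int (fun V (e : embedding W V) y => (e z == y)%:R * (B V e y)%:R) = 1.
  by rewrite (Int_delta (phi := fun V e y => (B V e y)%:R)) ?Bz // => V V' g e x; rewrite nB.
rewrite -[X in _ = X + _ + _]E -!IntD; apply: Int_eq => V e y.
case: (B V e y) => /=; rewrite ?mulr0 ?addr0 // mulr1; exact: quad_splitR.
Qed.

Lemma Int0 W : Int (fun V (e : embedding W V) y => 0) = 0.
Proof. exact: integ0. Qed.

(** * Relations between the constants of a cell of nonzero measure *)

Section Nonzero.
Hypothesis v0 : v_ != 0.

Lemma cel_ex : exists V (e : embedding X V) z, cel e z.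
Proof.
have [[V [e [z H]]]|H] := pselect (exists V (e : embedding X V) z, cel e z).
  by exists V, e, z.
case/eqP: v0; rewrite /v_ -[RHS](Int0 X); apply: Int_eq => V e z.
by case: (boolP (cel e z)) => // Cz; case: H; exists V, e, z.
Qed.

Lemma cel2_ex a b : s_ a b != 0 ->
  exists V (e : embedding X V) z w, [&& cel e z, cel e w & quad a b z w].
Proof.
move=> s0.
have [[V [e [z [w H]]]]|H] := pselect (exists V (e : embedding X V) z w,
  [&& cel e z, cel e w & quad a b z w]); first by exists V, e, z, w.
have [V [e [z Cz]]] := cel_ex.
case/eqP: s0; rewrite -[s_ a b]mulr1 -[1]/((true)%:R) -Cz -s_E -[RHS](Int0 V).
apply: Int_eq => V' g w; case: andP => // -[/andP[_ Cw] zw].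
by case: H; exists V', (comp_emb g e), (g z), w; rewrite cel_map Cz Cw.
Qed.

Lemma v_split : v_ = 1 + (s_ true true + s_ false false) + (s_ true false + s_ false true).
Proof.
have [V [e [z Cz]]] := cel_ex.
rewrite -(v_E e) (@Int_split V (fun V' g y => cel (comp_emb g e) y) z true true) /=.
- have sE a b : Int (fun V' (g : embedding V V') y => (cel (comp_emb g e) y && quad a b (g z) y)%:R) = s_ a b.
    rewrite -[RHS]mulr1 -[1]/((true)%:R) -Cz -s_E; apply: Int_eq => V' g y.
    by rewrite Cz.
  by rewrite !sE.
- by move=> V1 V2 g e' x; rewrite -comp_embA cel_map.
- by rewrite comp_id_emb.
Qed.

(** Integrating over the pairs in this relation in the two orders gives the two sides, each times
    the measure [v_] of the cell. *)
Lemma s_opp a b : s_ (~~ a) (~~ b) = s_ a b.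
Proof.
apply: (mulIf v0).
pose phi V (e : embedding X V) x y := ([&& cel e x, cel e y & quad a b x y])%:R : int.
transitivity (Int (fun V (e : embedding X V) y => Int (fun V' (e' : embedding V V') x =>
    phi V' (comp_emb e' e) x (e' y)))).
  rewrite -IntZ; apply: Int_eq => V e y; rewrite -s_E; apply: Int_eq => V' e' x.
  by rewrite /phi cel_map quad_opp andbCA andbA.
rewrite -(Int_swap (phi := phi)) => [|V V' g e x y]; last first.
  by rewrite /phi !cel_map quad_map.
rewrite -IntZ; apply: Int_eq => V e y; rewrite -s_E; apply: Int_eq => V' e' x.
by rewrite /phi cel_map andbA.
Qed.

Let phi3 := forall V, embedding X V -> V -> V -> V -> int.
Let nat3 (phi : phi3) := forall V V' (g : embedding V V') e x y z,
  phi V' (comp_emb g e) (g x) (g y) (g z) = phi V e x y z.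
(** Triple integrals: permuting the variables of one configuration is what compares the
    constants. *)
Let Int3 (phi : phi3) : int :=
  Int (fun V (e : embedding X V) x => Int (fun V1 (e1 : embedding V V1) y =>
    Int (fun V2 (e2 : embedding V1 V2) z =>
      phi V2 (comp_emb (comp_emb e2 e1) e) ((comp_emb e2 e1) x) (e2 y) z))).

Lemma Int3_swap23 (phi : phi3) : nat3 phi ->
  Int3 phi = Int3 (fun V e x y z => phi V e x z y).
Proof.
move=> nphi; apply: Int_eq => V e x.
apply: (Int_swap (phi := fun V2 (h : embedding V V2) y z => phi V2 (comp_emb h e) (h x) y z)).
by move=> V1 V2 g h y z; rewrite comp_embE -comp_embA nphi.
Qed.

Lemma Int3_swap12 (phi : phi3) : nat3 phi ->
  Int3 phi = Int3 (fun V e x y z => phi V e y x z).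
Proof.
move=> nphi.
pose psi V (e : embedding X V) x y := Int (fun V2 (e2 : embedding V V2) z =>
   phi V2 (comp_emb e2 e) (e2 x) (e2 y) z).
have npsi V V' (g : embedding V V') e x y : psi V' (comp_emb g e) (g x) (g y) = psi V e x y.
  rewrite /psi -(Int_basechange g (phi := fun V2 (e2 : embedding V V2) z =>
   phi V2 (comp_emb e2 e) (e2 x) (e2 y) z)).
    by apply: Int_eq => V2 e2 z; rewrite comp_embA !comp_embE.
  by move=> V1 V2 h e' z; rewrite -comp_embA !comp_embE nphi.
transitivity (Int (fun V e x => Int (fun V' (e' : embedding V V') y => psi V' (comp_emb e' e) (e' x) y))).
  apply: Int_eq => V e x; apply: Int_eq => V1 e1 y; apply: Int_eq => V2 e2 z.
  by rewrite comp_embA comp_embE.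
rewrite (Int_swap npsi).
apply: Int_eq => V e x; apply: Int_eq => V1 e1 y; apply: Int_eq => V2 e2 z.
by rewrite comp_embA comp_embE.
Qed.

Lemma Int3_l a b a1 b1 a2 b2 :
  Int3 (fun V e z1 z2 y => ([&& cel e z1, cel e z2 & quad a b z1 z2] &&
    [&& cel e y, quad a1 b1 z1 y & quad a2 b2 z2 y])%:R) =
  l_ a b a1 b1 a2 b2 * s_ a b * v_.
Proof.
rewrite -IntZ; apply: Int_eq => V e z1.
rewrite -mulrA -s_E -IntZ; apply: Int_eq => V1 e1 z2.
rewrite -andbA -(cel_map e1) -l_E; apply: Int_eq => V2 e2 y.
by rewrite -comp_embA comp_embE !cel_map !quad_map.
Qed.

(** Take chains [x], [y], [z] in direction [(a, b)]. Integrating the last point innermost gives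
    [s * s * v]; integrating the middle one innermost gives [u * s * v], since by convexity it fills
    the whole box. *)
Lemma s_dich a b : s_ a b = 0 \/ s_ a b = u_ a b.
Proof.
have [->|s0] := eqVneq (s_ a b) 0; [by left | right].
apply: (mulIf v0); apply: (mulIf s0).
pose phi V (e : embedding X V) x y z : int :=
  ([&& cel e x, cel e y & quad a b x y] && (cel e z && quad a b y z))%:R.
have nphi V V' (g : embedding V V') e x y z :
    phi V' (comp_emb g e) (g x) (g y) (g z) = phi V e x y z.
  by rewrite /phi !cel_map !quad_map.
transitivity (Int3 phi).
  rewrite -mulrA [v_ * _]mulrC mulrA -IntZ; apply: Int_eq => V e x.
  rewrite -mulrA -s_E -IntZ; apply: Int_eq => V1 e1 y.
  rewrite -andbA -(cel_map e1).
  transitivity (Int (fun V2 (e2 : embedding V1 V2) z =>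
      (phi V2 (comp_emb e2 (comp_emb e1 e)) (e2 (e1 x)) (e2 y) z))); last first.
    by apply: Int_eq => V2 e2 z; rewrite comp_embA comp_embE.
  case: (boolP [&& _, _ & _]) => C; last first.
    rewrite mulr0 -[LHS](Int0 V1); apply: Int_eq => V2 e2 z.
    by rewrite /phi !cel_map !quad_map -(cel_map e1) (negbTE C).
  have Cy : cel (comp_emb e1 e) y by case/and3P: C.
  rewrite -Cy -s_E; apply: Int_eq => V2 e2 z.
  by rewrite /phi !cel_map !quad_map -(cel_map e1) C Cy.
rewrite Int3_swap23 // -mulrA [v_ * _]mulrC mulrA -IntZ; apply: Int_eq => V e x.
rewrite -mulrA -s_E -IntZ; apply: Int_eq => V1 e1 w.
rewrite -andbA -(cel_map e1); set C := [&& _, _ & _].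
transitivity (Int (fun V2 (e2 : embedding V1 V2) y => C%:R * (between a b (e2 (e1 x)) (e2 w) y)%:R)).
  apply: Int_eq => V2 e2 y; rewrite -comp_embA comp_embE /phi -natrM mulnb /between.
  congr (nat_of_bool _)%:R; rewrite {}/C -(cel_map e2 (comp_emb e1 e) (e1 x)) -(cel_map e2 (comp_emb e1 e) w) -(quad_map a b e2 (e1 x)).
  set e' := comp_emb e2 _; set x' := e2 _; set w' := e2 _.
  apply/idP/idP.
    move=> /andP[/and3P[Cx Cy xy] /andP[Cw yw]]; rewrite Cx Cw xy yw.
    by rewrite (quad_trans xy yw).
  move=> /andP[/and3P[Cx Cw xw] /andP[xy yw]]; rewrite Cx Cw xy yw !andbT.
  by apply: (between_cell (a := a) (b := b) Cx Cw); rewrite /between xy.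
rewrite IntZ u_E /C mulrCA -natrM mulnb; congr (_ * (nat_of_bool _)%:R).
by case: (quad a b (e1 x) w); rewrite ?andbT ?andbF.
Qed.

(** Exchanging [z2] and [y] turns one configuration into the other. *)
Lemma l_swap a b : l_ a b a b a (~~ b) * s_ a b = l_ a b a b (~~ a) b * s_ a b.
Proof.
apply: (mulIf v0); rewrite -!Int3_l Int3_swap23; last first.
  by move=> V V' g e x y z; rewrite !cel_map !quad_map.
apply: Int_eq => V e x; apply: Int_eq => V1 e1 y; apply: Int_eq => V2 e2 z.
rewrite -(quad_opp a (~~ b)) negbK.
by do ?[case: (cel _ _)]; do ?[case: (quad _ _ _ _)].
Qed.

Lemma s_val a b V (e : embedding X V) z : cel e z ->
  Int (fun V' (g : embedding V V') y => (cel (comp_emb g e) y && quad a b (g z) y)%:R) = s_ a b.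
Proof.
move=> Cz; have := s_E a b e z; rewrite Cz mulr1 => <-.
by apply: Int_eq => V' g y; rewrite andTb.
Qed.

Lemma u_val a b V (z w : V : permutation) : quad a b z w ->
  Int (fun V' (g : embedding V V') y => (between a b (g z) (g w) y)%:R) = u_ a b.
Proof. by move=> zw; rewrite u_E zw mulr1. Qed.

Lemma l_value a b a1 b1 a2 b2 V (e : embedding X V) z1 z2 :
  [&& cel e z1, cel e z2 & quad a b z1 z2] ->
  Int (fun V' (g : embedding V V') y =>
    [&& cel (comp_emb g e) y, quad a1 b1 (g z1) y & quad a2 b2 (g z2) y]%:R) =
  l_ a b a1 b1 a2 b2.
Proof.
move=> C; have := l_E a b a1 b1 a2 b2 e z1 z2; rewrite C mulr1 => <-.
by apply: Int_eq => V' g y; rewrite andTb.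
Qed.

(** The quadrant [(a, b)] of [z1] is split at [z2]: the same quadrant of [z2] has measure [s] again,
    the opposite one is the box between [z1] and [z2], and [s] cancels. *)
Lemma l_quadrant a b : s_ a b != 0 ->
  1 + u_ a b + l_ a b a b a (~~ b) + l_ a b a b (~~ a) b = 0.
Proof.
move=> s0; have [V [e [z1 [z2 C]]]] := cel2_ex s0; have /and3P[C1 C2 z12] := C.
have E := @Int_split V (fun V' g y => cel (comp_emb g e) y && quad a b (g z1) y) z2 a b.
rewrite -/(~~ a) in E.
have {}E := E _ _.
have E1 := s_val a b C1.
have E2 : Int (fun V' (g : embedding V V') y =>
    (cel (comp_emb g e) y && quad a b (g z1) y && quad a b (g z2) y)%:R) = s_ a b.
  rewrite -(s_val a b C2); apply: Int_eq => V' g y.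
  congr (nat_of_bool _)%:R; case: (cel _ y) => //=.
  case: (boolP (quad a b (g z2) y)) => [H|]; rewrite ?andbF // andbT.
  by apply: (quad_trans (y := g z2)) => //; rewrite quad_map.
have E3 : Int (fun V' (g : embedding V V') y =>
    (cel (comp_emb g e) y && quad a b (g z1) y && quad (~~ a) (~~ b) (g z2) y)%:R) = u_ a b.
  rewrite -(u_val z12); apply: Int_eq => V' g y.
  rewrite quad_opp -andbA; congr (nat_of_bool _)%:R; apply/andP/idP => [[] //|H]; split=> //.
  by apply: between_cell H; rewrite -/(cel (comp_emb g e) _) cel_map.
have E4 a' b' : Int (fun V' (g : embedding V V') y =>
    (cel (comp_emb g e) y && quad a b (g z1) y && quad a' b' (g z2) y)%:R) = l_ a b a b a' b'.
  by rewrite -(l_value _ _ _ _ C); apply: Int_eq => V' g y; rewrite -!andbA.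
move: E; rewrite E1 E2 E3 !E4 => E.
have := E _ _ ; rewrite comp_id_emb C2 id_embE z12 => {}E.
have {}E : s_ a b = 1 + (s_ a b + u_ a b) + (l_ a b a b a (~~ b) + l_ a b a b (~~ a) b).
  by apply: E => // V1 V2 g e' x; rewrite -comp_embA cel_map comp_embE quad_map.
lia.
Qed.

Lemma l_val a b : s_ a b != 0 ->
  l_ a b a b a (~~ b) * 2 = - 1 - u_ a b /\ l_ a b a b (~~ a) b * 2 = - 1 - u_ a b.
Proof.
move=> s0; have := l_quadrant s0; have := mulIf s0 (l_swap a b); lia.
Qed.

(** Seen from [w], a point in quadrant [(a, ~~ b)] of [z] is certainly on the [~~ b] side in the
    second order; only its side in the first order is open. *)
Lemma s_split a b : s_ a b != 0 ->
  s_ a (~~ b) = l_ a b a (~~ b) (~~ a) (~~ b) + l_ a b a (~~ b) a (~~ b).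
Proof.
move=> s0; have [V [e [z [w C]]]] := cel2_ex s0; have /and3P[Cz Cw zw] := C.
rewrite -(s_val a (~~ b) Cz) -!(l_value _ _ _ _ C) -IntD; apply: Int_eq => V' g y.
have zw' : quad a b (g z) (g w) by rewrite quad_map.
case: (cel _ y) => //=; case: (boolP (quad a (~~ b) (g z) y)) => //= zy.
have [irr1 tr1 tot1] := lt1_total V'.
have wy2 : dlt2 (~~ b) (g w) y.
  have /andP[_ wz] : quad (~~ a) (~~ b) (g w) (g z) by rewrite quad_opp.
  have /andP[_ zy2] := zy.
  by have [_ tr] := dlt_trans (g w) (g z) y true (~~ b); apply: tr.
have ne : g w != y.
  apply: contraTneq zy => <-; have /andP[_ /dlt2N H] := zw'.
  by rewrite /quad negb_and H orbT.
have := tot1 _ _ ne; have n1 : ~~ (lt1 (g w) y && lt1 y (g w)).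
  by apply/negP => /andP[H /(tr1 _ _ _ H)]; rewrite irr1.
rewrite /quad wy2 !andbT /dlt1; move: n1; clear.
by case: a; case: (lt1 (g w) y); case: (lt1 y (g w)).
Qed.

Lemma l_delta a b : s_ a b != 0 ->
  l_ a b a (~~ b) (~~ a) (~~ b) = l_ (~~ a) (~~ b) (~~ a) (~~ b) a (~~ b).
Proof.
move=> s0; have [V [e [z [w C]]]] := cel2_ex s0; have /and3P[Cz Cw zw] := C.
have C' : [&& cel e w, cel e z & quad (~~ a) (~~ b) w z] by rewrite Cz Cw quad_opp.
rewrite -(l_value _ _ _ _ C) -(l_value _ _ _ _ C'); apply: Int_eq => V' g y.
by congr (nat_of_bool _)%:R; congr (_ && _); rewrite andbC.
Qed.

Lemma Int3_rot (phi : phi3) : nat3 phi ->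
  Int3 phi = Int3 (fun V e x y z => phi V e y z x).
Proof.
by move=> nphi; rewrite (Int3_swap23 nphi) Int3_swap12.
Qed.

(** Times [v_], both sides integrate the same three-point configuration, with the points met in a
    different order. The same holds for [l_kappa]. *)
Lemma l_alpha a b : l_ a b a (~~ b) a (~~ b) * s_ a b = l_ (~~ a) b (~~ a) b a b * s_ (~~ a) b.
Proof.
apply: (mulIf v0); rewrite -!Int3_l Int3_rot; last first.
  by move=> V V' g e x y z; rewrite !cel_map !quad_map.
apply: Int_eq => V e x; apply: Int_eq => V1 e1 y; apply: Int_eq => V2 e2 z.
rewrite -!(quad_opp a (~~ b)) !negbK.
by congr (nat_of_bool _)%:R; do ?[case: (cel _ _)]; do ?[case: (quad _ _ _ _)].
Qed.

Lemma l_kappa a b : l_ a b a b a (~~ b) * s_ a b =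
  l_ a (~~ b) (~~ a) (~~ b) (~~ a) (~~ b) * s_ a (~~ b).
Proof.
apply: (mulIf v0); rewrite -!Int3_l [RHS]Int3_rot; last first.
  by move=> V V' g e x y z; rewrite !cel_map !quad_map.
apply: Int_eq => V e x; apply: Int_eq => V1 e1 y; apply: Int_eq => V2 e2 z.
rewrite !quad_opp.
by congr (nat_of_bool _)%:R; do ?[case: (cel _ _)]; do ?[case: (quad _ _ _ _)].
Qed.

End Nonzero.

End Cell.

Definition pair_perm_fun (b : bool) (x : 'I_2) : 'I_2 := if b then x else rev_ord x.
Lemma pair_perm_inj b : injective (pair_perm_fun b).
Proof. by case: b => x y //= /rev_ord_inj. Qed.

Lemma pair_ex a b : exists (X : permutation) (z w : X),
  quad a b z w /\ forall x, x = z \/ x = w.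
Proof.
have X2 (x : 'I_2) : x = ord0 \/ x = lift ord0 ord0.
  by case: x => [[|[|//]]] p; [left|right]; apply: val_inj.
exists (std (perm (@pair_perm_inj (a == b)))).
exists (if a then ord0 else lift ord0 ord0), (if a then lift ord0 ord0 else ord0).
split; first by case: a b => [] []; rewrite /quad /dlt1 /dlt2 /= !permE.
by case: a => x; case: (X2 x) => ->; auto.
Qed.

Lemma u_opp a b : u_ (~~ a) (~~ b) = u_ a b.
Proof.
have [X [z [w [zw _]]]] := pair_ex a b.
rewrite -(u_val zw) -(@u_val _ _ _ w z) ?quad_opp //; apply: Int_eq => V g y.
by rewrite /between !quad_opp andbC.
Qed.

(** A box is itself a cell, with its two corners as [X]. Its measure is [u], and so is that of the
    quadrant of an inner point towards a corner, so [v_split] becomes a recursion; [t] is the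
    measure of a transverse quadrant. *)
Lemma u_rec a b : u_ a b != 0 -> exists t : int,
  u_ a b = 1 + (u_ a b + u_ a b) + (t + t) /\ (t = 0 \/ t = u_ a (~~ b)).
Proof.
have [X [z [w [zw X2]]]] := pair_ex a b => u0.
have zw' : z != w.
  apply: contraTneq zw => ->; have [irr _ _] := lt1_total X.
  by rewrite /quad /dlt1; case: (a); rewrite irr.
pose c1 t := if t == z then a else ~~ a.
pose c2 t := if t == z then b else ~~ b.
have celE V (e : embedding X V) y : cel c1 c2 e y = between a b (e z) (e w) y.
  rewrite /between -(quad_opp a b (e w)).
  apply/forallP/andP => [H|[H1 H2] x].
    by have := H z; have := H w; rewrite /c1 /c2 eqxx eq_sym (negbTE zw').
  by case: (X2 x) => ->; rewrite /c1 /c2 ?eqxx // eq_sym (negbTE zw').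
have vE : v_ c1 c2 = u_ a b.
  by rewrite -(u_val zw); apply: Int_eq => V e y; rewrite celE.
have v0 : v_ c1 c2 != 0 by rewrite vE.
have sE : s_ c1 c2 a b = u_ a b.
  have [V [e [x Cx]]] := cel_ex v0.
  have := Cx; rewrite celE => /andP[zx xw].
  rewrite -(s_val a b Cx) -(u_val xw); apply: Int_eq => V' g y.
  rewrite celE /between !comp_embE; congr (nat_of_bool _)%:R.
  have zx' : quad a b (g (e z)) (g x) by rewrite quad_map.
  case: (boolP (quad a b (g x) y)) => [xy|]; rewrite ?andbF // andbT.
  by rewrite (quad_trans zx' xy).
exists (s_ c1 c2 a (~~ b)); split; last exact: s_dich.
rewrite -[LHS]vE (v_split v0).
have := s_opp v0 a b; have := s_opp v0 a (~~ b); rewrite negbK -sE.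
by case: (a) (b) => [] [] /= -> ->; lia.
Qed.

(** With [s1], [s2] the measures of the two kinds of quadrants, [v = 1 + 2 s1 + 2 s2], each [s] is
    [0] or its [u], and each nonzero [u] is [-1] or [-1 - 2 u'] for the other constant [u'].
    Integrality excludes [u = u' = -1/3]; the remaining bad values are [v = 3] and [v = -3]. *)
Lemma v_small (X : permutation) (c1 c2 : X -> bool) :
  [\/ v_ c1 c2 = 0, v_ c1 c2 = 1 | v_ c1 c2 = -1].
Proof.
have [->|v0] := eqVneq (v_ c1 c2) 0; first by apply: Or31.
have V := v_split v0.
have so1 := s_opp v0 true true; have so2 := s_opp v0 true false.
have uo1 := u_opp true true; have uo2 := u_opp true false.
have d1 := s_dich v0 true true; have d2 := s_dich v0 true false.
have ur1 := @u_rec true true; have ur2 := @u_rec true false.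
have k1 := l_kappa v0 true true; have k2 := l_kappa v0 true false.
rewrite /= in so1 so2 uo1 uo2 ur1 ur2 k1 k2.
have [s1|s1] := eqVneq (s_ c1 c2 true true) 0;
  have [s2|s2] := eqVneq (s_ c1 c2 true false) 0.
- by apply: Or32; lia.
- case: d2 => d2; first by lia.
  have u2 : u_ true false != 0 by lia.
  have [t [t1 [t2|t2]]] := ur2 u2; first by apply: Or33; lia.
  have [l1 _] := l_val v0 s2; rewrite /= in l1.
  have [u1|u1] := eqVneq (u_ true true) 0; first by apply: Or33; lia.
  have [t' [t1' [t2'|t2']]] := ur1 u1; last by lia.
  (* Now [u_ true true = -1] and [u_ true false = 1], so [v] would be [3]. By [l_kappa] the product
     of [l = -1] with the nonzero [s] equals a multiple of the [s] that is zero. *)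
  have L : l_ c1 c2 true false true false true true = - 1 by lia.
  by rewrite L s1 mulr0 in k2; lia.
- case: d1 => d1; first by lia.
  have u1 : u_ true true != 0 by lia.
  have [t [t1 [t2|t2]]] := ur1 u1; first by apply: Or33; lia.
  have [l1 _] := l_val v0 s1; rewrite /= in l1.
  have [u2|u2] := eqVneq (u_ true false) 0; first by apply: Or33; lia.
  have [t' [t1' [t2'|t2']]] := ur2 u2; last by lia.
  have L : l_ c1 c2 true true true true true false = - 1 by lia.
  by rewrite L s2 mulr0 in k1; lia.
- case: d1 => d1; first by lia.
  case: d2 => d2; first by lia.
  have u1 : u_ true true != 0 by lia.
  have u2 : u_ true false != 0 by lia.
  have [t [t1 t2]] := ur1 u1; have [t' [t1' t2']] := ur2 u2.
  have [E|E] := eqVneq (u_ true true + u_ true false) 0; first by apply: Or32; lia.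
  (* Both [u] are [-1] and [v] would be [-3]. Then the constants with [2 l = -1 - u] vanish, and
     through [l_delta] and [l_alpha] both terms of [s_split] vanish with them, so a quadrant of
     nonzero measure would have measure [0]. *)
  have e1 : u_ true true = -1 by lia.
  have e2 : u_ true false = -1 by lia.
  have S := s_split v0 s1; have D := l_delta v0 s1; have A := l_alpha v0 true true.
  have sff : s_ c1 c2 false false != 0 by rewrite so1.
  have sft : s_ c1 c2 false true != 0 by rewrite so2.
  have [_ l1] := l_val v0 sff; have [_ l2] := l_val v0 sft.
  rewrite /= in S D A l1 l2.
  have D0 : l_ c1 c2 false false false false true false = 0 by lia.
  have A0 : l_ c1 c2 false true false true true true = 0 by lia.
  rewrite A0 mul0r in A; have/eqP := A; rewrite mulf_eq0 (negbTE s1) orbF => /eqP A1.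
  by lia.
Qed.

(** ** Values on embeddings *)

(** The cell in which the new point lies is a single orbit, so its measure is the value of [mu] on
    the extension. *)
Lemma mu_one_point (X Y : permutation) (i : embedding X Y) (p : Y) :
  (forall y, y = p \/ exists x, i x = y) -> (forall x, i x != p) ->
  [\/ mu i = 0, mu i = 1 | mu i = -1].
Proof.
move=> Yp ip; have [irr1 tr1 tot1] := lt1_total Y; have [irr2 tr2 tot2] := lt2_total Y.
pose c1 x := lt1 (i x) p; pose c2 x := lt2 (i x) p.
have Cp : cel c1 c2 i p.
  apply/forallP => x; rewrite /quad /dlt1 /dlt2 /c1 /c2.
  have := tot1 _ _ (ip x); have := tot2 _ _ (ip x).
  by case: (lt1 (i x) p) (lt2 (i x) p) => [] [] /= h2 h1; rewrite ?h1 ?h2.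
suff <- : v_ c1 c2 = mu i by apply: v_small.
transitivity (\sum_(t : unit | true) mu i); last by rewrite (big_pred1 tt) // => -[].
rewrite /v_ /Int /integ.
under eq_bigr do rewrite mulr_natr mulrb.
rewrite -big_mkcondr /=.
have H (c d : cell X elt) : cel c1 c2 (cell_l c) (cell_r c) -> good all_perms c ->
    forall V (e : embedding X V) y, cel c1 c2 e y ->
    exists h : embedding (cell_perm c) V, comp_emb h (cell_l c) = e /\ h (cell_r c) = y.
  move=> Cc gc V e y Cy.
  have [||h hE] := @config_emb (option X) (cell_perm c) V
     (ext (cell_l c) (cell_r c)) (ext e y).
  - move=> v; case: (good_gen gc v) => [[w <-]|]; first by exists (Some w).
    by rewrite inE => /eqP ->; exists None.
  - exact: cel_same_order Cc Cy.
  exists h; split; last exact: (hE None).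
  by apply: emb_eq => x; rewrite comp_embE; apply: (hE (Some x)).
apply: (@sum_match _ _ _ _ _ (fun c t => true)).
- by move=> c _; exists tt.
- move=> t _; have [c [gc [g [gl gr]]]] := @cell_complete all_perms all_her X elt Y i p I.
  exists c; rewrite gc /= -(cel_map c1 c2 g) gl.
  by have -> : g (cell_r c) = p by exact: gr.
- by move=> c [] [].
- move=> c d _ /andP[gc Cc] /andP[gd Cd] _ _ _.
  have [h [hl hr]] := H c c Cc gc _ _ _ Cd.
  by apply: (cell_rigid (g := h) gd hl); exact: hr.
move=> c _ /andP[gc Cc] _ _.
have [h [hl hr]] := H c c Cc gc _ _ _ Cp.
rewrite -hl; apply/esym; apply: (measure_surj muP) => // y.
case: (Yp y) => [->|[x <-]]; first by exists (cell_r c).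
by exists (cell_l c x); rewrite -comp_embE hl.
Qed.

(** Points are removed one at a time, and the values multiply by axiom (ii). *)
Lemma mu_empty_small (X : permutation) :
  [\/ mu (emb_empty X) = 0, mu (emb_empty X) = 1 | mu (emb_empty X) = -1].
Proof.
have [n] := ubnP #|X|; elim: n X => // n IH X Xn.
have [p _|X0] := pickP (predT : pred X); last first.
  apply: Or32; apply: (measure_iso muP) => //.
  by apply: emb_surj_bij => x; have := X0 x.
pose Y := sub_perm (~: [set p]).
have Yn : (#|Y| < n)%N.
  rewrite card_sig (eq_card (B := ~: [set p])) // cardsC1.
  by rewrite -ltnS; apply: leq_trans Xn; rewrite ltnS prednK //; apply/card_gt0P; exists p.
have -> : emb_empty X = comp_emb (sub_emb _) (emb_empty Y) by apply: emb_empty_unique.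
rewrite (measure_comp muP) //.
have K1 := IH Y Yn.
have K2 : [\/ mu (sub_emb (~: [set p])) = 0, mu (sub_emb (~: [set p])) = 1 |
    mu (sub_emb (~: [set p])) = -1].
  apply: (mu_one_point (p := p)) => [y|x]; last first.
    by rewrite mk_embE; have := valP x; rewrite !inE.
  have [->|yp] := eqVneq y p; [by left | right].
  have yY : y \in ~: [set p] by rewrite !inE.
  by exists (exist _ y yY); rewrite mk_embE.
by case: K1 => ->; case: K2 => ->; rewrite ?mulr0 ?mul0r ?mul1r ?mulr1 ?mulrNN ?mulr1;
  do ?[by apply: Or31|by apply: Or32|by apply: Or33].
Qed.
End Values.

(** * Traces of nilpotent endomorphisms *)

Section TupleSpecies.
Variables (T : species) (n : nat).

Definition tup_spt V : finType := n.-tuple (T V).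
Definition tup_smap V V' (g : embedding V V') (x : tup_spt V) : tup_spt V' :=
  map_tuple (smap g) x.
Definition tup_supp V (x : tup_spt V) : {set V} := \bigcup_(i < n) supp (tnth x i).

Fact tup_smap_comp U V W (g : embedding V W) (f : embedding U V) x :
  tup_smap (comp_emb g f) x = tup_smap g (tup_smap f x).
Proof. by apply: eq_from_tnth => i; rewrite !tnth_map smap_comp. Qed.

Fact tup_smap_inj V V' (g : embedding V V') : injective (tup_smap g).
Proof.
move=> x y E; apply: eq_from_tnth => i; apply: (@smap_inj T _ _ g).
by have := congr1 (fun t : tup_spt V' => tnth t i) E; rewrite !tnth_map.
Qed.

Fact tup_supp_map V V' (g : embedding V V') x :
  tup_supp (tup_smap g x) = g @: tup_supp x.
Proof.
apply/setP => v; apply/bigcupP/imsetP.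
  case=> i _; rewrite tnth_map supp_map => /imsetP[u ux ->].
  by exists u => //; apply/bigcupP; exists i.
case=> u /bigcupP[i _ ux] ->; exists i => //.
by rewrite tnth_map supp_map imset_f.
Qed.

Fact tup_supp_desc V V' (g : embedding V V') (x : tup_spt V') :
    (forall v, v \in tup_supp x -> exists u, g u = v) ->
  exists x', tup_smap g x' = x.
Proof.
move=> H; have /choice[y yE] : forall i, exists y, smap g y = tnth x i.
  move=> i; apply: supp_desc => v vx; apply: H.
  by apply/bigcupP; exists i.
by exists [tuple y i | i < n]; apply: eq_from_tnth => i; rewrite tnth_map tnth_mktuple.
Qed.

Fact tup_supp_bound V (x : tup_spt V) : (#|tup_supp x| <= n * sbound T)%N.
Proof.
rewrite /tup_supp; apply: leq_trans (_ : \sum_(i < n) #|supp (tnth x i)| <= _)%N.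
  elim/big_ind2: _ => [|A a B b Aa Bb|//]; first by rewrite cards0.
  by apply: leq_trans (leq_card_setU _ _) _; apply: leq_add.
rewrite -[X in (_ <= X * _)%N]card_ord -sum_nat_const; apply: leq_sum => i _.
exact: supp_bound.
Qed.

Definition tup_species := Species tup_smap_comp tup_smap_inj tup_supp_map
  tup_supp_desc tup_supp_bound.
End TupleSpecies.

Lemma tup_supp_cons (T : species) n V (x : T V) (t : tup_spt T n V) :
  tup_supp ([tuple of x :: t] : tup_spt T n.+1 V) = supp x :|: tup_supp t.
Proof.
rewrite /tup_supp big_ord_recl; congr (_ :|: _).
by apply: eq_bigr => i _; rewrite (tnth_nth x) (tnth_nth x).
Qed.

Lemma tup_suppP (T : species) n V (t : tup_spt T n V) v :
  reflect (exists2 x, x \in t & v \in supp x) (v \in tup_supp t).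
Proof.
apply: (iffP bigcupP) => [[i _ vx]|[x /tnthP[i ->] vx]]; last by exists i.
by exists (tnth t i); rewrite ?mem_tnth.
Qed.

Lemma rot1_fixed (T : Type) n (x : n.-tuple T) : (0 < n)%N ->
  rot 1 x = x -> exists y, x = [tuple of nseq n y].
Proof.
case: n x => // n x _; case/tupleP: x => y u; rewrite [LHS]rot1_cons => E.
have H (v : seq T) z : rcons v z = z :: v -> v = nseq (size v) z.
  by elim: v z => //= w v IH z [-> /IH {1}->].
by exists y; apply: val_inj; rewrite /= {1}(H _ _ E) size_tuple.
Qed.

Lemma rot1_nseq (T : Type) n (y : T) : rot 1 (nseq n y) = nseq n y.
Proof.
case: n => // n; rewrite (_ : nseq n.+1 y = y :: nseq n y) // rot1_cons.
by elim: n => //= n ->.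
Qed.

(** * Orbits of a cyclic group of prime order *)

Section FixedPoints.
Variables (k : fieldType) (p : nat) (pk : p \in [pchar k]).

(* In characteristic [p] the orbits of length [p] do not contribute. *)
Lemma sum_fixed (I : finType) (g : I -> I) (P : pred I) (w : I -> k) :
  injective g -> (forall i, iter p g i = i) -> (forall i, P (g i) = P i) ->
  (forall i, w (g i) = w i) ->
  \sum_(i | P i) w i = \sum_(i | P i && (g i == i)) w i.
Proof.
move=> gI gp Pg wg; have pp : prime p by case/andP: pk.
rewrite (bigID (fun i => g i == i)) /= -[RHS]addr0; congr (_ + _).
pose s := perm gI; pose G := <[s]>%g.
have sE n i : (s ^+ n)%g i = iter n g i.
  by elim: n => [|n IH]; rewrite ?perm1 // expgSr permM IH permE.
pose D := [set i | P i && (g i != i)].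
have act : [acts G, on D | 'P].
  rewrite cycle_subG; apply/astabsP => i /=.
  by rewrite apermE permE !inE Pg (inj_eq gI).
have wG i j : j \in orbit 'P G i -> w j = w i.
  case/orbitP => x /cycleP[n ->] <-; rewrite /= apermE sE.
  by elim: n => //= n; rewrite wg.
rewrite (eq_bigl (mem D)); last by move=> i; rewrite !inE.
rewrite (set_partition_big _ (orbit_partition act)) /=.
apply: big1 => A /imsetP[i iD ->].
rewrite (eq_bigr (fun=> w i)); last by move=> j; apply: wG.
rewrite sumr_const.
have : (#|orbit 'P G i| %| p)%N.
  apply: dvdn_trans (dvdn_orbit _ _ _) _; rewrite -/(order s) order_dvdn.
  by apply/eqP/permP => j; rewrite sE gp perm1.
case/primeP: pp => _ H /H /orP[/eqP c1|/eqP ->]; last first.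
  by rewrite -mulr_natr (pcharf0 pk) mulr0.
have : g i \in orbit 'P G i.
  by apply/orbitP; exists s; rewrite ?cycle_id //= apermE permE.
move/eqP: c1 => /cards1P[x Ex]; have := orbit_refl 'P G i.
rewrite Ex !inE => /eqP <- /eqP gi.
by move: iD; rewrite inE gi eqxx andbF.
Qed.
End FixedPoints.

(** * Powers as integrals over paths, and the Frobenius identity for traces *)

Section Powers.
Variables (k : fieldType) (F : permutation -> Prop) (F0 : F empty_perm).
Variable mu : emb_function k.
Hypotheses (F_her : hereditary F) (muP : is_measure F mu).
Variable s : perm_ob F.
Variable f : perm_hom k s s.

Definition kpow n : perm_hom k s s := iter n (perm_comp mu f) (perm_id k s).

Lemma kpowSr n : kpow n.+1 = perm_comp mu (kpow n) f.
Proof.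
elim: n => [|n IH]; first by rewrite /kpow /= (perm_comp1m F_her muP) (perm_compm1 F_her muP).
transitivity (perm_comp mu f (perm_comp mu (kpow n) f)); first by rewrite -IH.
by rewrite (perm_compA F_her muP).
Qed.

Fixpoint pathprod V (x : pts s V) (t : seq (pts s V)) (y : pts s V) : k :=
  if t is z :: t' then ev f x z * pathprod z t' y else ev f x y.

Lemma pathprod_cons V (x z y : pts s V) t :
  pathprod x (z :: t) y = ev f x z * pathprod z t y.
Proof. by []. Qed.

Lemma pathprod_map V V' (g : embedding V V') x t y :
  pathprod (smap g x) (map (smap g) t) (smap g y) = pathprod x t y.
Proof.
elim: t x => [|z t IH] x; first exact: ev_map.
by rewrite map_cons !pathprod_cons ev_map IH.
Qed.

Lemma pathprod_rcons V x t z (y : pts s V) :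
  pathprod x (rcons t z) y = pathprod x t z * ev f z y.
Proof.
elim: t x => [|u t IH] x; first by [].
by rewrite rcons_cons !pathprod_cons IH mulrA.
Qed.

Lemma pathprod_nseq V (x : pts s V) n : pathprod x (nseq n x) x = ev f x x ^+ n.+1.
Proof.
elim: n => [|n IH]; first by rewrite expr1.
by rewrite (_ : nseq n.+1 x = x :: nseq n x) // pathprod_cons IH -exprS.
Qed.

Lemma integ_cons W n (phi : family k W (tup_species (pts s) n.+1)) :
  F W -> natural F phi ->
  integ F mu phi = integ F mu (fun V e (x : pts s V) => integ F mu
    (fun V' (e' : embedding V V') (t : tup_species (pts s) n V') =>
       phi V' (comp_emb e' e) [tuple of smap e' x :: t])).
Proof.
move=> FW nphi.
rewrite (@integ_iso k F mu F_her muP W (prod_species (pts s) (tup_species (pts s) n))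
  (tup_species (pts s) n.+1) (fun V x => [tuple of x.1 :: x.2])) //.
- rewrite integ_Fubini // => V V' g e x FV'.
  rewrite -(nphi V V' g e [tuple of x.1 :: x.2] FV').
  by congr phi; apply: val_inj.
- move=> V FV; exists (fun t : n.+1.-tuple (pts s V) => (thead t, [tuple of behead t])).
    by move=> [x t]; rewrite theadE; congr (_, _); apply: val_inj.
  by move=> t; rewrite /= [RHS]tuple_eta.
- by move=> V V' g x FV'; apply: val_inj.
- by move=> V x FV; rewrite /= tup_supp_cons.
Qed.

(** Unfolding the composition leaves one integration for each of the [n] intermediate points;
    [integ_cons] gathers them into one tuple. *)
Lemma ev_kpow n W (x y : pts s W) : F W ->
  ev (kpow n.+1) x y = integ F mu (fun V e (t : tup_species (pts s) n V) =>
    pathprod (smap e x) t (smap e y)).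
Proof.
elim: n W x y => [|n IH] W x y FW.
  rewrite /kpow /= (perm_compm1 F_her muP).
  pose phi : family k W (tup_species (pts s) 0) := fun V e t => ev f (smap e x) (smap e y).
  have nphi : natural F phi by move=> V V' g e t FV'; rewrite /phi !smap_comp ev_map.
  rewrite -[LHS]/(ev f x y) -[x in LHS]smap_id -[y in LHS]smap_id.
  rewrite -[LHS]/(phi W (id_emb W) [tuple]) -(integ_delta F_her muP _ FW nphi).
  apply: eq_integ => V e t FV; rewrite /phi.
  have /eqP -> : smap e ([tuple] : tup_species (pts s) 0 W) = t.
    by rewrite [t]tuple0; apply: val_inj.
  by rewrite mul1r [t]tuple0.
rewrite kpowSr ev_comp // integ_cons //; last first.
  by move=> V V' g e t FV'; rewrite !smap_comp pathprod_map.
apply: eq_integ => V e z FV; rewrite /comp_kernel IH // -integZ.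
apply: eq_integ => V' e' t FV'; rewrite !smap_comp.
by apply/esym/(etrans (pathprod_cons _ _ _ _)); rewrite ev_map.
Qed.

Definition cycprod V (t : seq (pts s V)) : k :=
  if t is x :: t' then pathprod x t' x else 1.

Lemma cycprod_rot V (t : seq (pts s V)) : cycprod (rot 1 t) = cycprod t.
Proof.
case: t => [|x [|z t]] //; rewrite rot1_cons rcons_cons /cycprod.
by rewrite pathprod_rcons pathprod_cons mulrC.
Qed.

Lemma cycprod_nseq V (x : pts s V) n : cycprod (nseq n x) = ev f x x ^+ n.
Proof. by case: n => [|n]; rewrite ?expr0 //; apply: pathprod_nseq. Qed.

Lemma cycprod_map V V' (g : embedding V V') t : cycprod (map (smap g) t) = cycprod t.
Proof. by case: t => // x t; apply: pathprod_map. Qed.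

Lemma itr_kpow n : itr mu (kpow n.+1) =
  integ F mu (fun V (e : embedding empty_perm V) (t : tup_species (pts s) n.+1 V) => cycprod t).
Proof.
rewrite integ_cons //; last by move=> V V' g e t FV'; rewrite cycprod_map.
by apply: eq_integ => V e x FV; rewrite ev_kpow.
Qed.

Variables (p : nat) (pk : p \in [pchar k]).
Hypothesis mu_int : forall X Y (h : embedding X Y), exists z : int, mu h = z%:~R.

Let tcell := cell empty_perm (tup_species (pts s) p).

(** The rotation leaves the standard permutation untouched and moves only the tuple, so it is an
    honest permutation of the finite type [tcell]. *)
Definition rot_cell (c : tcell) : tcell :=
  existT _ (tag c) (existT _ (tag (tagged c)) (cell_l c, rot_tuple 1 (cell_r c))).

Lemma rot_cellI : injective rot_cell.
Proof.
move=> [n [t [e x]]] [n' [t' [e' x']]] E.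
have nn : n = n' := congr1 tag E; subst n'.
move/eqP: E; rewrite eq_Tagged /= => /eqP E.
have tt : t = t' := congr1 tag E; subst t'.
move/eqP: E; rewrite eq_Tagged /= => /eqP E.
have ee : e = e' := congr1 fst E; subst e'.
have /(congr1 val) /= := congr1 snd E => /rot_inj xx.
by have -> : x = x' by apply: val_inj; exact: xx.
Qed.

Definition mk_cell (n : 'I_(#|empty_perm| + sbound (tup_species (pts s) p)).+1) (t : 'S_n) (e : embedding empty_perm (std t))
  (x : tup_species (pts s) p (std t)) : tcell := existT _ n (existT _ t (e, x)).

Lemma rot_cellE n t e x : rot_cell (@mk_cell n t e x) = mk_cell e (rot_tuple 1 x).
Proof. by []. Qed.

Lemma rot_cell_iter m n t e x : (m <= p)%N ->
  iter m rot_cell (@mk_cell n t e x) = mk_cell e (rot_tuple m x).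
Proof.
elim: m => [|m IH] mp.
  by congr mk_cell; apply: val_inj; rewrite /= rot0.
rewrite iterS IH ?(ltnW mp) // rot_cellE; congr mk_cell; apply: val_inj => /=.
by rewrite -rotS ?size_tuple.
Qed.

Lemma rot_cell_fixed n t e x : rot_cell (@mk_cell n t e x) = mk_cell e x -> rot 1 x = x.
Proof.
move/eqP; rewrite eq_Tagged /= => /eqP E.
move/eqP: E; rewrite eq_Tagged /= => /eqP E.
have E2 : rot_tuple 1 x = x := congr1 snd E.
by rewrite -[RHS]/(val x) -[in RHS]E2.
Qed.

Lemma rot_cell_order c : iter p rot_cell c = c.
Proof.
case: c => [n [t [e x]]]; apply: etrans (rot_cell_iter e x (leqnn p)) _.
congr mk_cell; apply: val_inj; rewrite /=.
transitivity (rot (size x) x); last exact: rot_size.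
by rewrite size_tuple.
Qed.

Lemma good_rot_cell c : good F (rot_cell c) = good F c.
Proof.
have R m (t : seq (pts s m)) : rot 1 t =i t by move=> y; rewrite mem_rot.
case: c => [n [t [e x]]]; apply/asboolP/asboolP => -[gx FV]; split=> // v;
  (case: (gx v) => [|/tup_suppP[y yx vy]]; first by left); right;
  apply/tup_suppP; exists y => //.
  by rewrite -(R _ x).
by rewrite (R _ x).
Qed.

(** An integer is fixed by Frobenius in characteristic [p]; this is where integrality of the measure
    enters. *)
Lemma mu_pow X Y (h : embedding X Y) : mu h ^+ p = mu h.
Proof. by have [z ->] := mu_int h; rewrite -(pFrobenius_autE pk) rmorph_int. Qed.

(** A cell is fixed by rotation exactly when its tuple is constant, and then it is a cell of a
    single point. Its term is the [p]-th power of the term of that point, the measure included by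
    [mu_pow]. *)
Lemma itr_frobenius : itr mu (kpow p) = itr mu f ^+ p.
Proof.
have pp : prime p by case/andP: pk.
have p0 : (0 < p)%N := prime_gt0 pp.
rewrite -[in LHS](prednK p0) itr_kpow (prednK p0).
apply: (etrans (sum_fixed pk
  (w := fun c : tcell => mu (cell_l c) * cycprod (cell_r c)) rot_cellI
  rot_cell_order good_rot_cell _)).
  by move=> [n [t [e x]]]; congr (_ * _); exact: cycprod_rot.
rewrite /itr /integ -(pFrobenius_autE pk) rmorph_sum /=.
under [RHS]eq_bigr do rewrite pFrobenius_autE exprMn mu_pow.
have fixed (c : tcell) : rot_cell c == c -> exists x, cell_r c = [tuple of nseq p x].
  case: c => n [t [e x]] /eqP/rot_cell_fixed.
  exact: rot1_fixed.
pose rel (c : tcell) (d : cell empty_perm (pts s)) := `[< exists g : embedding (cell_perm d) (cell_perm c),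
  cell_r c = [tuple of nseq p (smap g (cell_r d))] >].
(* There are no parameters: the structure is generated by the tuple, hence by its one repeated
   entry. *)
have surj (c : tcell) (d : cell empty_perm (pts s)) (g : embedding (cell_perm d) (cell_perm c)) :
    good F c -> cell_r c = [tuple of nseq p (smap g (cell_r d))] ->
    forall v : cell_perm c, exists u : cell_perm d, g u = v.
  move=> gc cE v; case: (good_gen gc v) => [[[]]|].
  rewrite cE => /tup_suppP[y /nseqP[-> _]]; rewrite supp_map => /imsetP[u _ ->].
  by exists u.
have nseq_inj V (x y : pts s V) : [tuple of nseq p x] = [tuple of nseq p y] -> x = y.
  by move=> /(congr1 val) /=; rewrite -(prednK p0) => -[].
apply: (sum_match (rel := rel)).
- move=> c /andP[gc /fixed[x cx]].
  have [d [gd [g [_ gx]]]] := cell_complete F_her (emb_empty (cell_perm c)) x (good_mem gc).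
  by exists d; split=> //; apply/asboolP; exists g; rewrite cx gx.
- move=> d gd; have Fd := good_mem gd.
  have [c [gc [g [_ gx]]]] := @cell_complete F F_her empty_perm (tup_species (pts s) p) _
    (emb_empty (cell_perm d)) [tuple of nseq p (cell_r d)] Fd.
  have gs : forall v, exists u, g u = v.
    move=> v; have : v \in supp (cell_r d).
      by case: (good_gen gd v) => [[[]]|].
    move=> vd; have : v \in tup_supp ([tuple of nseq p (cell_r d)] : tup_species (pts s) p _).
      apply/tup_suppP; exists (cell_r d) => //.
      by apply/nseqP.
    by rewrite -gx tup_supp_map => /imsetP[u _ ->]; exists u.
  have [h [_ hg]] := emb_surj_inv gs.
  have cE : cell_r c = [tuple of nseq p (smap h (cell_r d))].
    rewrite -[cell_r c](smap_id (T := tup_species (pts s) p)) -hg smap_comp gx.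
    by apply: val_inj; rewrite /= map_nseq.
  exists c; split; last by apply/asboolP; exists h.
  rewrite gc /=; apply/eqP; case: c gc g gx gs h hg cE => n [t [e x]] gc g gx gs h hg cE.
  apply: etrans (rot_cellE e x) _; congr mk_cell; rewrite [x]cE.
  by apply: val_inj; apply: rot1_nseq.
- move=> c d d' /andP[gc _] gd gd' /asboolP[g cE] /asboolP[g' cE'].
  have [h [gh _]] := emb_surj_inv (surj _ _ _ gc cE').
  apply: (@cell_rigid F _ _ d d' (comp_emb h g)) => //; first exact: emb_empty_unique.
  apply: (@smap_inj _ _ _ g').
  rewrite -smap_comp comp_embA gh comp_id_emb.
  by apply: nseq_inj; rewrite -cE -cE'.
- move=> c c' d /andP[gc _] /andP[gc' _] gd /asboolP[g cE] /asboolP[g' cE'].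
  have [h [_ hg]] := emb_surj_inv (surj _ _ _ gc cE).
  apply: (@cell_rigid F _ _ c c' (comp_emb g' h)) => //; first exact: emb_empty_unique.
  have E : smap (comp_emb g' h) (smap g (cell_r d)) = smap g' (cell_r d).
    by rewrite -smap_comp -comp_embA hg comp_emb_id.
  rewrite cE cE'; apply: val_inj; apply: etrans (map_nseq _ _ _) _.
  by rewrite E.
move=> c d /andP[gc _] gd /asboolP[g cE].
rewrite cE (cycprod_nseq (smap g (cell_r d))) ev_map; congr (_ * _).
rewrite (emb_empty_unique (cell_l c) (comp_emb g (cell_l d))).
have := surj _ _ _ gc cE; have := good_mem gc; have := good_mem gd => Fd Fc gs.
exact: (measure_surj muP).
Qed.
End Powers.

(** * Nilpotent matrices and traces of powers *)

Section MatrixPowers.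
Variable K : fieldType.

Definition mpow n (A : 'M[K]_n) m := iter m (mulmx A) 1%:M.

(** Passing from [C R] to [R C] shifts the exponent by one. With a rank factorisation of a singular
    matrix this lowers the size, which drives both inductions on matrices. *)
Lemma mpow_conj n r (C : 'M[K]_(n, r)) (R : 'M[K]_(r, n)) m :
  mpow (C *m R) m.+1 = C *m mpow (R *m C) m *m R.
Proof.
elim: m => [|m IH]; first by rewrite /mpow /= !mulmx1.
by rewrite {1}/mpow iterS -/(mpow _ m.+1) IH /mpow iterS !mulmxA.
Qed.

Lemma mpow_unit n (A : 'M[K]_n) m : A \in unitmx -> mpow A m \in unitmx.
Proof.
by move=> Au; elim: m => [|m IH]; rewrite ?unitmx1 // /mpow iterS unitmx_mul Au.
Qed.

Lemma unitmx0 n : (0 : 'M[K]_n) \in unitmx -> n = 0%N.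
Proof. by case: n => // n; rewrite unitmxE det0 unitr0. Qed.

(* Induction on the size: [A = C R] with [R C] of size the rank of [A]. *)
Lemma mxtrace_nilpotent n (A : 'M[K]_n) m : mpow A m = 0 -> \tr A = 0.
Proof.
have [N] := ubnP n; elim: N n A m => // N IH n A m nN Am.
have [fullA|nfull] := eqVneq (\rank A) n.
  have Au : A \in unitmx by rewrite -row_full_unit /row_full fullA.
  have := mpow_unit m Au; rewrite Am => /unitmx0 n0.
  by subst n; rewrite /mxtrace big_ord0.
rewrite -{1}(mulmx_base A) mxtrace_mulC.
apply: (IH _ _ m.+1).
  by rewrite -ltnS; apply: leq_trans nN; rewrite ltnS ltn_neqAle nfull rank_leq_row.
rewrite mpow_conj mulmx_base; have -> : mpow A m = 0 := Am.
by rewrite mulmx0 mul0mx.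
Qed.

Lemma mpow_expr n (A : 'M[K]_n.+1) m : mpow A m = A ^+ m.
Proof.
by elim: m => [|m IH]; rewrite ?expr0 // exprS /mpow iterS -/(mpow A m) IH.
Qed.

(** If [A] were invertible of positive size, the trace of the Cayley-Hamilton identity would reduce
    to the size times the determinant up to sign, nonzero in characteristic zero. Otherwise a rank
    factorisation lowers the size. *)
Lemma mx_nilpotent n (A : 'M[K]_n) : [pchar K] =i pred0 ->
  (forall m, \tr (mpow A m.+1) = 0) -> exists m, mpow A m = 0.
Proof.
move=> K0; have [N] := ubnP n; elim: N n A => // N IH n A nN trA.
have [fullA|nfull] := eqVneq (\rank A) n.
  exists 0%N; have Au : A \in unitmx by rewrite -row_full_unit /row_full fullA.
  case: n A nN trA fullA Au => [|n] A nN trA fullA Au; first by apply/matrixP => -[].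
  have := Cayley_Hamilton A; rewrite -[char_poly A]coefK poly_def.
  rewrite raddf_sum size_char_poly big_ord_recl /= => /(congr1 mxtrace).
  rewrite raddfD /= raddf_sum big1 => [|i _]; last first.
    by rewrite linearZ /= linearZ /= rmorphXn /= horner_mx_X -mpow_expr trA mulr0.
  rewrite addr0 linearZ /= expr0 rmorph1 linearZ /= mxtrace1 raddf0 char_poly_det.
  move/eqP; rewrite !mulf_eq0 signr_eq0 /= ((pcharf0P K).1 K0) orbF => /eqP d0.
  by move: Au; rewrite unitmxE d0 unitr0.
have rk : (\rank A < N)%N.
  by rewrite -ltnS; apply: leq_trans nN; rewrite ltnS ltn_neqAle nfull rank_leq_row.
have trB m : \tr (mpow (row_base A *m col_base A) m.+1) = 0.
  rewrite mpow_conj mxtrace_mulC mulmxA mulmx_base.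
  by have := trA m; rewrite {1}/mpow iterS -/(mpow A m).
have [m Bm] := IH _ _ rk trB.
exists m.+1; rewrite -(mulmx_base A) mpow_conj.
by have -> : mpow (row_base A *m col_base A) m = 0 := Bm; rewrite mulmx0 mul0mx.
Qed.
End MatrixPowers.

(** ** Integral structure *)

Section IntegralForm.
Variables (F : permutation -> Prop) (F0 : F empty_perm) (mu : emb_function int).
Hypothesis F_her : hereditary F.
Hypothesis muP : forall K : fieldType, is_measure F (scalar_measure K mu).
Implicit Types s t u : perm_ob F.

(** An integral form of the morphism spaces: the structure constants are integers, and [scal]
    extends scalars to a field of any characteristic. *)
Definition zhom s t := {ffun amalgs s t -> int}.

Definition zcoef s t (f : zhom s t) i j W (a : embedding (s i) W)
    (b : embedding (t j) W) : int :=
  \sum_(A : amalg0 F (s i) (t j) | induced A a b)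
    f (existT (fun ij => amalg0 F (s ij.1) (t ij.2)) (i, j) A).

Definition zcomp s t u (g : zhom t u) (f : zhom s t) : zhom s u :=
  [ffun c => \sum_(j : summand t)
     \sum_(W : amalg3 F (s (am_i c)) (t j) (u (am_j c)))
     \sum_(h : embedding (am_ob c) (amalg3_perm W) |
             induced_by (A := tagged c) (amalg3_1 W) (amalg3_3 W) h)
       zcoef f (amalg3_1 W) (amalg3_2 W) * zcoef g (amalg3_2 W) (amalg3_3 W) *
       mu h].

Definition zid s : zhom s s := [ffun c => (agree (am_l c) (am_r c))%:R].

Definition scal (K : fieldType) s t (f : zhom s t) : perm_hom K s t :=
  [ffun c => (f c)%:~R].

Lemma scal_comp K s t u (g : zhom t u) (f : zhom s t) :
  scal K (zcomp g f) = perm_comp (scalar_measure K mu) (scal K g) (scal K f).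
Proof.
apply/ffunP => c; rewrite !ffunE rmorph_sum; apply: eq_bigr => j _.
rewrite rmorph_sum; apply: eq_bigr => W _; rewrite rmorph_sum; apply: eq_bigr => h _.
rewrite !rmorphM /= /scalar_measure; congr (_ * _ * _).
  by rewrite /zcoef rmorph_sum; apply: eq_bigr => A _; rewrite ffunE.
by rewrite /zcoef rmorph_sum; apply: eq_bigr => A _; rewrite ffunE.
Qed.

Lemma scal_id K s : scal K (zid s) = perm_id K s.
Proof. by apply/ffunP => c; rewrite !ffunE rmorph_nat. Qed.

Lemma scal_iter K s (f : zhom s s) n :
  scal K (iter n (zcomp f) (zid s)) = kpow (scalar_measure K mu) (scal K f) n.
Proof.
by elim: n => [|n IH]; rewrite ?scal_id // iterS scal_comp IH.
Qed.

Definition trace_coef s (c : amalgs s s) : int :=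
  mu (emb_empty (am_ob c)) * (rp c == lp c)%:R.

Lemma itrE (K : fieldType) s (f : perm_hom K s s) :
  itr (scalar_measure K mu) f = \sum_c f c * (trace_coef c)%:~R.
Proof.
rewrite -[f in LHS](perm_comp1m F_her (muP K)) (itr_amalgs F0 F_her (muP K)).
apply: eq_bigr => c _; rewrite (ev_id K F_her); last exact: am_mem.
by rewrite /trace_coef rmorphM rmorph_nat mulrA mulrAC mulrC mulrA.
Qed.

Definition ztr s (f : zhom s s) : int := \sum_c f c * trace_coef c.

Lemma scal_tr (K : fieldType) s (f : zhom s s) :
  itr (scalar_measure K mu) (scal K f) = (ztr f)%:~R.
Proof.
by rewrite itrE rmorph_sum; apply: eq_bigr => c _; rewrite ffunE rmorphM.
Qed.

Lemma itr0 (K : fieldType) s : itr (scalar_measure K mu) (0 : perm_hom K s s) = 0.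
Proof. by rewrite itrE big1 // => c _; rewrite ffunE mul0r. Qed.

Section Field.
Variable K : fieldType.
Let muK := scalar_measure K mu.
Let muKP : is_measure F muK := muP K.
Notation pcomp := (perm_comp muK).

Definition nilp s (f : perm_hom K s s) := exists n, kpow muK f n = 0.

Lemma pcomp0 s t u (g : perm_hom K t u) : pcomp g (0 : perm_hom K s t) = 0.
Proof.
have := perm_comp_linear F_her muKP (s := s) g (-1) 0 0.
by rewrite scaler0 addr0 scaleN1r addNr.
Qed.

Lemma pcompD s t u (g : perm_hom K t u) (f f' : perm_hom K s t) :
  pcomp g (f + f') = pcomp g f + pcomp g f'.
Proof.
by have := perm_comp_linear F_her muKP g 1 f f'; rewrite !scale1r.
Qed.

Lemma pcompZ s t u (g : perm_hom K t u) a (f : perm_hom K s t) :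
  pcomp g (a *: f) = a *: pcomp g f.
Proof.
by have := perm_comp_linear F_her muKP g a f 0; rewrite !addr0 pcomp0 addr0.
Qed.

Lemma pcompZl s t u a (g : perm_hom K t u) (f : perm_hom K s t) :
  pcomp (a *: g) f = a *: pcomp g f.
Proof.
have L := perm_comp_linearl F_her muKP (u := u) f.
have L0 : pcomp (0 : perm_hom K t u) f = 0.
  by have := L (-1) 0 0; rewrite scaler0 addr0 scaleN1r addNr.
by have := L a g 0; rewrite /= addr0 L0 addr0.
Qed.

Lemma pcompDl s t u (g g' : perm_hom K t u) (f : perm_hom K s t) :
  pcomp (g + g') f = pcomp g f + pcomp g' f.
Proof.
by have := perm_comp_linearl F_her muKP f 1 g g'; rewrite !scale1r.
Qed.

Lemma kpowD s (f : perm_hom K s s) m n :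
  kpow muK f (m + n) = pcomp (kpow muK f m) (kpow muK f n).
Proof.
elim: m => [|m IH]; first by rewrite add0n (perm_comp1m F_her muKP).
by rewrite addSn {1}/kpow iterS -/(kpow muK f (m + n)) IH (perm_compA F_her muKP).
Qed.

Lemma kpowM s (f : perm_hom K s s) m n :
  kpow muK (kpow muK f m) n = kpow muK f (n * m).
Proof.
elim: n => [|n IH]; first by rewrite mul0n.
by rewrite mulSn kpowD -IH.
Qed.

Lemma kpow_ge s (f : perm_hom K s s) m n : kpow muK f m = 0 -> (m <= n)%N ->
  kpow muK f n = 0.
Proof. by move=> f0 mn; rewrite -(subnK mn) kpowD f0 pcomp0. Qed.

(** Iterating the Frobenius identity raises the trace to the power [p^j], while the corresponding
    power of [f] vanishes for large [j]. *)
Lemma nilp_trace_pchar p s (f : perm_hom K s s) : p \in [pchar K] ->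
  nilp f -> itr muK f = 0.
Proof.
move=> pK [n fn]; have pp : prime p by case/andP: pK.
have muZ X Y (h : embedding X Y) : exists z : int, @scalar_measure K mu X Y h = z%:~R by exists (@mu X Y h).
have frob j (g : perm_hom K s s) : itr muK (kpow muK g (p ^ j)) = itr muK g ^+ (p ^ j).
  elim: j g => [|j IH] g; first by rewrite expn0 expr1 /kpow /= (perm_compm1 F_her muKP).
  by rewrite expnS {1}mulnC -kpowM IH (itr_frobenius F0 F_her muKP _ pK muZ) -exprM.
have np : (n <= p ^ n)%N by apply: ltnW; apply: ltn_expl; apply: prime_gt1.
have := frob n f; rewrite (kpow_ge fn np) itr0 => /esym/eqP.
by rewrite expf_eq0 => /andP[_ /eqP].
Qed.

(** * The regular representation and its trace form *)

Section Regular.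
Variable s : perm_ob F.
Let n := #|amalgs s s|.
Let hom := perm_hom K s s.

Definition dlt (i : 'I_n) : hom := delta_hom K (enum_val i).

Lemma dlt_sum (f : hom) : f = \sum_i f (enum_val i) *: dlt i.
Proof.
apply/ffunP => c; rewrite sum_ffunE (bigD1 (enum_rank c)) //= big1 ?addr0 => [|i ic].
  by rewrite !ffunE enum_rankK eqxx /GRing.scale /= mulr1.
rewrite !ffunE; case: eqVneq => [ci|_]; last by rewrite /GRing.scale /= mulr0.
by rewrite ci enum_valK eqxx in ic.
Qed.

(** Matrices act on row vectors, so [rho] reverses products, as [rho_comp] records. *)
Definition rho (y : hom) : 'M[K]_n := \matrix_(i, j) pcomp y (dlt i) (enum_val j).
Definition rowh (f : hom) : 'rV[K]_n := \row_i f (enum_val i).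

Lemma rowh_inj : injective rowh.
Proof.
move=> f g /rowP E; apply/ffunP => c.
by have := E (enum_rank c); rewrite !mxE enum_rankK.
Qed.

Lemma rowh_comp (y x : hom) : rowh (pcomp y x) = rowh x *m rho y.
Proof.
apply/rowP => j; rewrite !mxE {1}[x]dlt_sum.
have -> : pcomp y (\sum_i x (enum_val i) *: dlt i) = \sum_i x (enum_val i) *: pcomp y (dlt i).
  rewrite (big_morph (fun x : hom => pcomp y x) (@pcompD _ _ _ y) (@pcomp0 _ _ _ y)).
  by apply: eq_bigr => i _; rewrite pcompZ.
rewrite sum_ffunE; apply: eq_bigr => i _.
by rewrite !mxE ffunE.
Qed.

Lemma rho_comp (z y : hom) : rho (pcomp z y) = rho y *m rho z.
Proof.
apply/row_matrixP => i.
have R w : row i (rho w) = rowh (pcomp w (dlt i)) by apply/rowP => j; rewrite !mxE.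
by rewrite row_mul !R -(perm_compA F_her muKP) rowh_comp.
Qed.

Lemma rho1 : rho (perm_id K s) = 1%:M.
Proof.
apply/row_matrixP => i; apply/rowP => j; rewrite !mxE (perm_comp1m F_her muKP) ffunE.
by rewrite (inj_eq enum_val_inj) eq_sym.
Qed.

Lemma rhoD (y z : hom) : rho (y + z) = rho y + rho z.
Proof. by apply/matrixP => i j; rewrite !mxE pcompDl ffunE. Qed.

Lemma rhoZ a (y : hom) : rho (a *: y) = a *: rho y.
Proof. by apply/matrixP => i j; rewrite !mxE pcompZl ffunE. Qed.

Lemma rho_sum (f : hom) : rho f = \sum_i f (enum_val i) *: rho (dlt i).
Proof.
rewrite {1}[f]dlt_sum (big_morph rho rhoD (_ : rho 0 = 0)).
  by apply: eq_bigr => i _; rewrite rhoZ.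
by rewrite -(scale0r (0 : hom)) rhoZ !scale0r.
Qed.

Lemma rho_pow (y : hom) m : rho (kpow muK y m) = mpow (rho y) m.
Proof.
elim: m => [|m IH]; first exact: rho1.
by rewrite (kpowSr F_her muKP) rho_comp IH.
Qed.

Lemma rho_nilp (y : hom) : (exists m, mpow (rho y) m = 0) -> nilp y.
Proof.
move=> [m ym]; exists m; apply: rowh_inj.
rewrite -[kpow muK y m](perm_compm1 F_her muKP) rowh_comp rho_pow ym mulmx0.
by apply/rowP => j; rewrite !mxE ffunE.
Qed.

Definition gram : 'M[K]_n := \matrix_(i, j) \tr (rho (dlt i) *m rho (dlt j)).

Lemma gramE (x : hom) j : (rowh x *m gram) 0 j = \tr (rho x *m rho (dlt j)).
Proof.
rewrite mxE [in RHS]rho_sum mulmx_suml raddf_sum; apply: eq_bigr => i _.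
by rewrite !mxE /= -scalemxAl mxtraceZ.
Qed.

Lemma gram_pairing (x y : hom) :
  \tr (rho x *m rho y) = \sum_j (rowh x *m gram) 0 j * y (enum_val j).
Proof.
rewrite [rho y]rho_sum mulmx_sumr raddf_sum; apply: eq_bigr => j _.
by rewrite /= gramE -scalemxAr mxtraceZ mulrC.
Qed.

(** A non-degenerate trace form represents the trace by an element [c], and the symmetry of the
    trace makes [c] central. So the trace of [f] is the matrix trace of [f c], which is nilpotent
    along with [f]. *)
Lemma gram_unit_trace (f : hom) : gram \in unitmx -> nilp f -> itr muK f = 0.
Proof.
move=> Gu [m fm].
pose tau : 'rV[K]_n := \row_j (trace_coef (enum_val j))%:~R.
pose c : hom := [ffun a => (tau *m invmx gram) 0 (enum_rank a)].
have rc : rowh c = tau *m invmx gram.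
  by apply/rowP => j; rewrite !mxE ffunE enum_valK mxE.
have tauE y : \tr (rho c *m rho y) = itr muK y.
  rewrite gram_pairing itrE rc mulmxKV // (reindex (@enum_val _ (mem (amalgs s s)))) /=; last first.
    by apply: onW_bij; exact: enum_val_bij.
  by apply: eq_bigr => j _; rewrite mxE mulrC.
have nondeg x : (forall y, \tr (rho x *m rho y) = 0) -> x = 0.
  move=> H; apply: rowh_inj; rewrite -[rowh x](mulmxK Gu).
  have -> : rowh x *m gram = 0.
    by apply/rowP => j; rewrite gramE H mxE.
  by rewrite mul0mx; apply/rowP => j; rewrite !mxE ffunE.
have central y : pcomp c y = pcomp y c.
  apply/eqP; rewrite -subr_eq0; apply/eqP/nondeg => z.
  rewrite rhoD -scaleN1r rhoZ scaleN1r !rho_comp mulmxDl mulNmx raddfD raddfN /=.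
  rewrite -(mulmxA (rho y)) mxtrace_mulC -!mulmxA -(rho_comp y z) -(rho_comp z y) !tauE.
  by rewrite (itrC F0 F_her muKP) subrr.
rewrite -tauE -rho_comp; apply: (mxtrace_nilpotent (m := m)).
rewrite -rho_pow.
have -> : kpow muK (pcomp f c) m = pcomp (kpow muK f m) (kpow muK c m).
  have comm j : pcomp c (kpow muK f j) = pcomp (kpow muK f j) c.
    elim: j => [|j IH]; first by rewrite (perm_comp1m F_her muKP) (perm_compm1 F_her muKP).
    rewrite /kpow iterS -/(kpow muK f j) (perm_compA F_her muKP) central.
    by rewrite -(perm_compA F_her muKP) IH (perm_compA F_her muKP).
  clear fm; elim: m => [|m IH]; first by rewrite (perm_comp1m F_her muKP).
  have A := perm_compA F_her muKP; have S (h : hom) : kpow muK h m.+1 = pcomp h (kpow muK h m) by [].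
  by rewrite !S IH -(A _ _ _ _ f c) (A _ _ _ _ c) comm -(A _ _ _ _ _ c) (A _ _ _ _ f).
rewrite fm -[X in X = _]/(rho _).
have -> : pcomp (0 : hom) (kpow muK c m) = 0.
  by rewrite -(scale0r (0 : hom)) pcompZl !scale0r.
by rewrite -(scale0r (0 : hom)) rhoZ !scale0r.
Qed.

(** An element [x] of the radical makes all positive powers of [y x] traceless in the regular
    representation, so [y x] is nilpotent and its categorical trace vanishes for every [y]; the
    diagonal trace pairing then kills [x]. *)
Lemma gram_unit_pchar0 : [pchar K] =i pred0 ->
  (forall X, F X -> muK (emb_empty X) != 0) ->
  (forall f : hom, nilp f -> itr muK f = 0) -> gram \in unitmx.
Proof.
move=> K0 reg nil0; rewrite -row_free_unit -kermx_eq0.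
apply/rowV0P => v /sub_kermxP vG.
pose x : hom := [ffun a => v 0 (enum_rank a)].
have rx : rowh x = v by apply/rowP => j; rewrite !mxE ffunE enum_valK.
have x0 y : \tr (rho x *m rho y) = 0.
  by rewrite gram_pairing rx vG big1 // => j _; rewrite mxE mul0r.
have nx y : nilp (pcomp y x).
  apply: rho_nilp; apply: (mx_nilpotent K0) => m.
  rewrite -rho_pow (kpowSr F_her muKP) rho_comp rho_comp -mulmxA.
  by rewrite -(rho_comp _ y) x0.
suff -> : v = rowh 0 by apply/rowP => j; rewrite !mxE ffunE.
rewrite -rx; congr rowh; apply/ffunP => c.
have /eqP := nil0 _ (nx (transpose (delta_hom K c))).
rewrite (itr_delta F0 F_her muKP) mulf_eq0 (negbTE (reg _ (am_mem c))) /= => /eqP ->.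
by rewrite ffunE.
Qed.
End Regular.
End Field.

Lemma intr_pchar0 (K : fieldType) (d : int) : [pchar K] =i pred0 -> d != 0 ->
  d%:~R != 0 :> K.
Proof.
move=> K0; have E m : (m%:R == 0 :> K) = (m == 0%N) := (pcharf0P K).1 K0 m.
case: d => d d0; first by have := E d; rewrite pmulrn => ->.
by rewrite NegzE mulrNz oppr_eq0; have := E d.+1; rewrite pmulrn => ->.
Qed.

Lemma scal_inj (s t : perm_ob F) : injective (@scal rat s t).
Proof.
move=> f g /ffunP E; apply/ffunP => c.
by have := E c; rewrite !ffunE => /intr_inj.
Qed.

Lemma scal_rat (s t : perm_ob F) (f : perm_hom rat s t) :
  exists (d : int) (y : zhom s t), d != 0 /\ d%:~R *: f = scal rat y.
Proof.
pose d : int := \prod_c denq (f c).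
pose y : zhom s t := [ffun c => numq (f c) * \prod_(c' | c' != c) denq (f c')].
exists d, y; split; first by apply/prodf_neq0 => c _; exact: denq_neq0.
apply/ffunP => c; rewrite !ffunE /d (bigD1 c) //= !rmorphM /=.
rewrite /GRing.scale /= mulrAC; congr (_ * _).
by rewrite -{2}(divq_num_den (f c)) mulrC divfK // intr_eq0 denq_neq0.
Qed.

(* After clearing denominators, the trace is divisible by all primes. *)
Lemma nilp_trace_rat (s : perm_ob F) (f : perm_hom rat s s) : nilp f ->
  itr (scalar_measure rat mu) f = 0.
Proof.
move=> [n fn]; have [d [y [d0 dy]]] := scal_rat f.
have yn : iter n (zcomp y) (zid s) = 0.
  apply: scal_inj; rewrite scal_iter -dy.
  have E m : kpow (scalar_measure rat mu) (d%:~R *: f) m =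
     d%:~R ^+ m *: kpow (scalar_measure rat mu) f m.
    elim: m => [|m IH]; first by rewrite expr0 scale1r.
    by rewrite /kpow !iterS -!/(kpow _ _ _) IH pcompZ pcompZl scalerA exprSr.
  by rewrite E fn scaler0; apply/ffunP => c; rewrite !ffunE.
have ty : ztr y = 0.
  apply/eqP; apply/negPn/negP => t0.
  have [p pt pp] := prime_above `|ztr y|%N.
  have pF : p \in [pchar 'F_p] := pchar_Fp pp.
  have : itr (scalar_measure 'F_p mu) (scal 'F_p y) = 0.
    apply: (nilp_trace_pchar pF); exists n; rewrite -scal_iter yn.
    by apply/ffunP => c; rewrite !ffunE.
  rewrite scal_tr => /eqP; rewrite -(dvdz_pcharf pF) dvdzE /= => /dvdn_leq.
  by rewrite absz_gt0 t0 leqNgt pt => /(_ isT).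
have : itr (scalar_measure rat mu) (d%:~R *: f) = 0 by rewrite dy scal_tr ty.
have -> : itr (scalar_measure rat mu) (d%:~R *: f) = d%:~R * itr (scalar_measure rat mu) f.
  by rewrite !itrE mulr_sumr; apply: eq_bigr => c _; rewrite ffunE mulrA.
by move=> /eqP; rewrite mulf_eq0 intr_eq0 (negbTE d0) => /eqP.
Qed.

Hypothesis mu_reg : forall X, F X -> mu (emb_empty X) != 0.

Theorem nilp_trace (K : fieldType) (s : perm_ob F) (f : perm_hom K s s) : nilp f ->
  itr (scalar_measure K mu) f = 0.
Proof.
have [[p pK]|K0] := pselect (exists p, p \in [pchar K]).
  exact: nilp_trace_pchar pK.
have {}K0 : [pchar K] =i pred0.
  by move=> p; apply/negbTE/negP => pK; case: K0; exists p.
apply: gram_unit_trace.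
pose zd (i : 'I_#|amalgs s s|) : zhom s s := [ffun c => (c == enum_val i)%:R].
pose zrho i : 'M[int]_#|amalgs s s| := \matrix_(l, j) zcomp (zd i) (zd l) (enum_val j).
pose zgram : 'M[int]_#|amalgs s s| := \matrix_(i, j) \tr (zrho i *m zrho j).
(* Stated for every field [L] because it serves twice: for [rat], where the determinant is shown to
   be nonzero, and for [K]. *)
have gE (L : fieldType) : gram L s = map_mx intr zgram.
  have dE i : dlt L i = scal L (zd i).
    by apply/ffunP => c; rewrite !ffunE rmorph_nat.
  have rE i : rho (dlt L i) = map_mx intr (zrho i).
    by apply/matrixP => l j; rewrite !mxE !dE -scal_comp ffunE.
  apply/matrixP => i j.
  rewrite [LHS]mxE.
  rewrite [RHS]mxE.
  rewrite [zgram i j]mxE.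
  transitivity (\tr (map_mx intr (zrho i) *m map_mx intr (zrho j)) : L).
    exact: (f_equal2 (fun A B => \tr (A *m B)) (rE i) (rE j)).
  rewrite -(map_mxM _ (zrho i)).
  exact: (trace_map_mx _ (zrho i *m zrho j)).
have Q0 : [pchar rat] =i pred0 by exact: Num.Theory.pchar_num.
have U (L : fieldType) : (gram L s \in unitmx) = ((\det zgram)%:~R != 0 :> L).
  by rewrite (gE L) unitmxE (det_map_mx _ zgram) unitfE.
have gu (L : fieldType) : [pchar L] =i pred0 ->
    (forall f : perm_hom L s s, nilp f -> itr (scalar_measure L mu) f = 0) ->
    (\det zgram)%:~R != 0 :> L.
  move=> L0 H; rewrite -(U L); apply: (@gram_unit_pchar0 L s L0 _ H) => X FX.
  exact: (@intr_pchar0 L (mu (emb_empty X)) L0 (mu_reg FX)).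
have D := gu rat Q0 (@nilp_trace_rat s).
rewrite (U K).
apply: (intr_pchar0 K0).
by apply: contra D => /eqP ->.
Qed.
End IntegralForm.

(** * Semi-simplicity from a non-degenerate trace *)

Local Open Scope smc_scope.

Lemma linear_dependence (k : fieldType) (V : lmodType k) n (e : 'I_n -> V)
    (v : 'I_n.+1 -> V) :
  (forall w, exists c : 'I_n -> k, w = \sum_a c a *: e a) ->
  exists c : 'I_n.+1 -> k, (exists i, c i != 0) /\ \sum_i c i *: v i = 0.
Proof.
move=> gen; have [m mE] := choice (fun i => gen (v i)).
pose M : 'M[k]_(n.+1, n) := \matrix_(i, j) m i j.
have : kermx M != 0.
  rewrite kermx_eq0 /row_free; apply/negP => /eqP rM.
  by have := rank_leq_col M; rewrite rM ltnn.
case/rowV0Pn => c /sub_kermxP cM c0; exists (fun i => c 0 i); split.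
  apply/existsP; rewrite -negb_forall; apply: contra c0 => /forallP H.
  by apply/eqP/rowP => i; rewrite mxE; apply/eqP.
transitivity (\sum_i \sum_a (c 0 i * m i a) *: e a).
  by apply: eq_bigr => i _; rewrite mE scaler_sumr; apply: eq_bigr => a _; rewrite scalerA.
rewrite exchange_big /= big1 // => a _; rewrite -scaler_suml.
have /rowP/(_ a) := cM; rewrite !mxE => E.
by rewrite (_ : \sum_i _ = 0) ?scale0r // -[RHS]E; apply: eq_bigr => i _; rewrite mxE.
Qed.

Section Endomorphisms.
Variables (k : fieldType) (C : smc k).
Local Notation A := (compA (smcP C)).
Local Notation I1 := (comp1m (smcP C)).
Local Notation I2 := (compm1 (smcP C)).
Implicit Types X Y Z : ob C.

Lemma compNm X Y Z (g : mor Y Z) (f : mor X Y) : (- g) ∘ f = - (g ∘ f).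
Proof. by rewrite -scaleN1r compZm scaleN1r. Qed.
Lemma compmN X Y Z (g : mor Y Z) (f : mor X Y) : g ∘ (- f) = - (g ∘ f).
Proof. by rewrite -scaleN1r compmZ scaleN1r. Qed.
Lemma compBm X Y Z (g g' : mor Y Z) (f : mor X Y) : (g - g') ∘ f = g ∘ f - g' ∘ f.
Proof. by rewrite compDm compNm. Qed.
Lemma compmB X Y Z (g : mor Y Z) (f f' : mor X Y) : g ∘ (f - f') = g ∘ f - g ∘ f'.
Proof. by rewrite compmD compmN. Qed.
Lemma compm_sum X Y Z (I : Type) (r : seq I) (P : pred I) (g : mor Y Z) (f : I -> mor X Y) :
  g ∘ (\sum_(i <- r | P i) f i) = \sum_(i <- r | P i) g ∘ f i.
Proof. by rewrite (big_morph _ (@compmD _ C _ _ _ g) (@compm0 _ C _ _ _ g)). Qed.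
Lemma comp_summ X Y Z (I : Type) (r : seq I) (P : pred I) (g : I -> mor Y Z) (f : mor X Y) :
  (\sum_(i <- r | P i) g i) ∘ f = \sum_(i <- r | P i) g i ∘ f.
Proof.
by rewrite (big_morph (fun g => g ∘ f) (fun g g' => compDm g g' f) (@comp0m _ C _ _ _ f)).
Qed.

Definition pw X (a : mor X X) n : mor X X := iter n (comp a) (idm X).

Lemma pwS X (a : mor X X) n : pw a n.+1 = a ∘ pw a n.
Proof. by []. Qed.

Lemma pwD X (a : mor X X) m n : pw a (m + n) = pw a m ∘ pw a n.
Proof. by elim: m => [|m IH]; rewrite ?I1 // addSn !pwS IH A. Qed.

Lemma pw_comm X (a q : mor X X) n : a ∘ q = q ∘ a -> pw a n ∘ q = q ∘ pw a n.
Proof.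
by move=> aq; elim: n => [|n IH]; rewrite ?I1 ?I2 // pwS -A IH !A aq.
Qed.

Hypothesis fd : forall X Y, finite_dim (mor X Y).

(** [e] is the projection onto the stable image of [a]. The powers of [a] are linearly dependent;
    the lowest term of a relation gives [a^m = a^(m+1) q] with [q] a polynomial in [a], and the
    power [m+1] of [a q] is the idempotent. *)
Lemma fitting X (a : mor X X) : exists n e b,
  [/\ e ∘ e = e, e ∘ a = a ∘ e, e = b ∘ a & e ∘ pw a n = pw a n].
Proof.
have [n [g gen]] := fd X X.
have [c [[i0 ci0] rel]] := linear_dependence (fun i : 'I_n.+1 => pw a i) gen.
have [m cm m_min] := @arg_minnP _ i0 (fun i => c i != 0) (fun i => i : nat) ci0.
pose q := - (c m)^-1 *: \sum_(i < n.+1 | (m < i)%N) c i *: pw a (i - m.+1).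
have qa : a ∘ q = q ∘ a.
  rewrite /q compmZ compZm compm_sum comp_summ; congr (_ *: _); apply: eq_bigr => i _.
  by rewrite compmZ compZm (pw_comm _ (erefl (a ∘ a))).
have am : pw a m = pw a m.+1 ∘ q.
  rewrite /q compmZ compm_sum.
  have -> : \sum_(i < n.+1 | (m < i)%N) pw a m.+1 ∘ (c i *: pw a (i - m.+1)) = - (c m *: pw a m).
    have := rel; rewrite (bigD1 m) //= addrC => /eqP; rewrite addr_eq0 => /eqP <-.
    rewrite [RHS](bigID (fun i : 'I_n.+1 => (m < i)%N)) /= [X in _ = _ + X]big1 ?addr0.
      apply: eq_big => [i|i mi].
        by rewrite andb_idl // => mi; apply: contraTneq mi => ->; rewrite ltnn.
      by rewrite compmZ -[_ ∘ _]/(pw a m.+1 ∘ pw a (i - m.+1)) -pwD subnKC.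
    move=> i /andP[im]; rewrite -leqNgt => mi.
    have [->|/m_min] := eqVneq (c i) 0; first by rewrite scale0r.
    by move=> mi'; case/eqP: im; apply: val_inj; apply/eqP; rewrite eqn_leq mi' mi.
  by rewrite scalerN scaleNr opprK scalerA mulVf // scale1r.
pose w := a ∘ q; pose M := m.+1.
have wa : w ∘ a = a ∘ w by rewrite /w -A -qa.
have wu : w ∘ pw a M = pw a M by rewrite /w -A -(pw_comm _ qa) -am.
have wju j : pw w j ∘ pw a M = pw a M.
  by elim: j => [|j IH]; rewrite ?I1 // pwS -A IH.
have wM : pw w M = pw a M ∘ pw q M.
  elim: (M) => [|j IH]; first by rewrite I1.
  by rewrite !pwS IH /w -!A; congr (_ ∘ _); rewrite !A -(pw_comm _ qa).
exists M, (pw w M), (pw w m ∘ q); split=> //.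
- by rewrite {2}wM A wju -wM.
- exact: (pw_comm M wa).
by rewrite /M -addn1 pwD /= I2 -A -qa.
Qed.

Section Orthogonal.
Variable X : ob C.

Definition orthogonal_idempotents N (d : 'I_N -> mor X X) : Prop :=
  [/\ forall i, d i != 0, forall i, d i ∘ d i = d i
    & forall i j, i != j -> d i ∘ d j = 0].

(** Nonzero orthogonal idempotents are linearly independent. *)
Lemma orthogonal_bound : exists m, forall N (d : 'I_N -> mor X X),
  orthogonal_idempotents d -> (N <= m)%N.
Proof.
have [n [g gen]] := fd X X; exists n => N d [d0 dd dij].
rewrite leqNgt; apply/negP => nN.
have [c [[i ci] rel]] := linear_dependence (fun i : 'I_n.+1 => d (widen_ord nN i)) gen.
move: (congr1 (comp (d (widen_ord nN i))) rel); rewrite compm0 compm_sum (bigD1 i) //= big1.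
  by rewrite addr0 compmZ dd => /eqP; rewrite scaler_eq0 (negbTE ci) (negbTE (d0 _)).
move=> j ji; rewrite compmZ dij ?scaler0 //; apply: contra ji => /eqP E.
by apply/eqP/val_inj; have := congr1 val E.
Qed.

Lemma orthogonal_cons N (d : 'I_N -> mor X X) e :
  orthogonal_idempotents d -> e != 0 -> e ∘ e = e ->
  (forall i, d i ∘ e = 0) -> (forall i, e ∘ d i = 0) ->
  orthogonal_idempotents (fun i => oapp d e (unlift ord0 i)).
Proof.
move=> [d0 dd dij] e0 ee de ed; split=> [i|i|i j].
- by case: unliftP => [j _|_] /=.
- by case: unliftP => [j _|_] /=.
case: unliftP => [i' ->|->]; case: unliftP => [j' ->|->] //=.
by rewrite (inj_eq (@lift_inj _ _)); apply: dij.
Qed.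
End Orthogonal.

Variable tau : forall X, mor X X -> k.
Hypothesis tau_nilp : forall X (a : mor X X) n, pw a n = 0 -> tau a = 0.
Hypothesis tau_nondeg : forall X Y (f : mor X Y),
  (forall g : mor Y X, tau (g ∘ f) = 0) -> f = 0.

(** Some [g f] has nonzero trace, so it is not nilpotent; its Fitting idempotent is nonzero and of
    the form [b g f]. *)
Lemma nonzero_idempotent X Y (f : mor X Y) : f != 0 ->
  exists h : mor Y X, h ∘ f != 0 /\ (h ∘ f) ∘ (h ∘ f) = h ∘ f.
Proof.
move=> f0; have [g gf] : exists g : mor Y X, tau (g ∘ f) != 0.
  apply: contrapT => H; case/eqP: f0; apply: tau_nondeg => g.
  by apply/eqP/negPn/negP => gf; apply: H; exists g.
have [n [e [b [ee ea eb en]]]] := fitting (g ∘ f).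
exists (b ∘ g); rewrite -A -eb; split=> //.
apply: contraNneq gf => e0; apply/eqP; apply: (@tau_nilp _ _ n).
by rewrite -en e0 comp0m.
Qed.

(* A maximal idempotent of the form [h ∘ f] acts as the identity on [f]. *)
Lemma von_neumann_regular X Y (f : mor X Y) : exists g : mor Y X, f ∘ g ∘ f = f.
Proof.
have [m bound] := orthogonal_bound X.
(* The counter [r] is the room left for further idempotents: an orthogonal family has at most [m]
   members, so [N = m.+1] is never reached. *)
suff step r N (d : 'I_N -> mor X X) (h : mor Y X) : (N + r = m.+1)%N ->
    orthogonal_idempotents d -> \sum_i d i = h ∘ f -> exists g, f ∘ g ∘ f = f.
  apply: (step m.+1 0 (fun i => 0) 0) => //; first by split=> -[].
  by rewrite big_ord0 comp0m.
elim: r N d h => [|r IH] N d h Nr od dh.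
  by have := bound _ _ od; rewrite -[N]addn0 Nr ltnn.
pose e := h ∘ f; have de i : d i ∘ e = d i /\ e ∘ d i = d i.
  case: od => _ dd dij; rewrite /e -dh compm_sum comp_summ.
  by split; rewrite (bigD1 i) //= dd big1 ?addr0 // => j ji; rewrite dij // eq_sym.
have ee : e ∘ e = e.
  by rewrite {1}/e -dh comp_summ -[RHS]dh; apply: eq_bigr => i _; case: (de i).
have [f0|f0] := eqVneq (f ∘ (idm X - e)) 0.
  by exists h; apply/eqP; rewrite eq_sym -subr_eq0 -A -{1}[f]I2 -compmB f0.
have [h' []] := nonzero_idempotent f0; set e' := h' ∘ _ => e'0 e'e'.
have e'e : e' ∘ e = 0 by rewrite /e' -!A compBm I1 ee subrr !compm0.
(* [e'] is orthogonal to [e] on one side only; [n] is its correction, orthogonal to [e] on both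
   sides. *)
pose n := (idm X - e) ∘ e'.
have nE : n = e' - e ∘ e' by rewrite /n compBm I1.
have e'n : e' ∘ n = e' by rewrite nE compmB e'e' A e'e comp0m subr0.
have nn : n ∘ n = n by rewrite {1}/n -A e'n.
(* The new [h] is chosen so that [h f] becomes [e + n]. *)
apply: (IH _ (fun i => oapp d n (unlift ord0 i)) (h + (idm X - e) ∘ (h' ∘ (idm Y - f ∘ h)))).
- by rewrite addSnnS.
- apply: orthogonal_cons => //.
  + by apply: contraNneq e'0 => n0; rewrite -e'n n0 compm0.
  + move=> i; rewrite nE compmB A; case: (de i) => -> _; exact: subrr.
  + move=> i; case: (de i) => _ <-; rewrite A /n -(A _ e' e) e'e.
    by rewrite compm0 comp0m.
rewrite big_ord_recl unlift_none /= addrC.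
under eq_bigr => i _ do rewrite liftK /=.
rewrite dh compDm /n /e' -!A; congr (_ + _ ∘ (_ ∘ _)).
by rewrite compmB compBm I1 I2 /e !A.
Qed.
End Endomorphisms.

(** * From von Neumann regularity to semi-simplicity *)

Section Regular.
Variables (k : fieldType) (C : smc k).
Local Notation A := (compA (smcP C)).
Local Notation I1 := (comp1m (smcP C)).
Local Notation I2 := (compm1 (smcP C)).
Implicit Types X Y Z : ob C.

Hypothesis fd : forall X Y, finite_dim (mor X Y).
Hypothesis vN : forall X Y (f : mor X Y), exists g : mor Y X, f ∘ g ∘ f = f.
Hypothesis split_idem : forall X (e : mor X X), e ∘ e = e ->
  exists (Y : ob C) (i : mor Y X) (p : mor X Y), p ∘ i = idm Y /\ i ∘ p = e.
Hypothesis direct_sums : forall n (S : 'I_n -> ob C), exists X, is_direct_sum S X.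

(** If [f g f = f], then [1 - g f] projects onto the kernel and [1 - f g] onto the cokernel. A mono
    is split by [g] and is the kernel of [1 - f g]; dually for an epi. *)
Lemma regular_abelian : abelian C.
Proof.
split=> //.
- move=> X Y f; have [g fgf] := vN f.
  have fe : f ∘ (idm X - g ∘ f) = 0 by rewrite compmB I2 A fgf subrr.
  have ee : (idm X - g ∘ f) ∘ (idm X - g ∘ f) = idm X - g ∘ f.
    by rewrite {1}compBm I1 -A fe compm0 subr0.
  have [K [i [p [pi ip]]]] := split_idem ee; exists K, i; split.
    by rewrite -[i]I2 -pi !A -(A f) ip fe comp0m.
  move=> T t ft; exists (p ∘ t); split; first by rewrite A ip compBm I1 -A ft compm0 subr0.
  by move=> u <-; rewrite A pi I1.
- move=> X Y f; have [g fgf] := vN f.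
  have ef : (idm Y - f ∘ g) ∘ f = 0 by rewrite compBm I1 fgf subrr.
  have ee : (idm Y - f ∘ g) ∘ (idm Y - f ∘ g) = idm Y - f ∘ g.
    by rewrite compmB I2 A ef comp0m subr0.
  have [K [i [p [pi ip]]]] := split_idem ee; exists K, p; split.
    by rewrite -[p]I1 -pi -!A (A i) ip ef compm0.
  move=> T t tf; exists (t ∘ i); split.
    by rewrite -A ip compmB I2 A tf comp0m subr0.
  by move=> u <-; rewrite -A pi I2.
- move=> X Y f mf; have [g fgf] := vN f.
  have gf : g ∘ f = idm X by apply: mf; rewrite A fgf I2.
  exists Y, (idm Y - f ∘ g); split; first by rewrite compBm I1 fgf subrr.
  move=> T t et; exists (g ∘ t); split; last by move=> u <-; rewrite A gf I1.
  by move/eqP: et; rewrite compBm I1 subr_eq0 A => /eqP.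
- move=> X Y f ef; have [g fgf] := vN f.
  have fg : f ∘ g = idm Y by apply: ef; rewrite fgf I1.
  exists X, (idm X - g ∘ f); split; first by rewrite compmB I2 A fgf subrr.
  move=> T t te; exists (t ∘ g); split; last by move=> u <-; rewrite -A fg I2.
  by move/eqP: te; rewrite compmB I2 subr_eq0 A => /eqP.
Qed.

Definition bounded X m := forall N (d : 'I_N -> mor X X),
  orthogonal_idempotents d -> (N <= m)%N.

(** A family on [S], carried over to [X], can be extended by the complementary idempotent
    [1 - j q]. *)
Lemma bounded_summand X S (j : mor S X) (q : mor X S) m :
  q ∘ j = idm S -> j ∘ q <> idm X -> bounded X m.+1 -> bounded S m.
Proof.
move=> qj jq bX N d [d0 dd dij]; rewrite -ltnS.
pose e := idm X - j ∘ q.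
have ej : e ∘ j = 0 by rewrite /e compBm I1 -A qj I2 subrr.
have qe : q ∘ e = 0 by rewrite /e compmB I2 A qj I1 subrr.
apply: (bX _ (fun i => oapp (fun i => j ∘ d i ∘ q) e (unlift ord0 i))).
apply: orthogonal_cons.
- split=> [i|i|i i' ii'].
  + apply: contra (d0 i) => /eqP H; apply/eqP.
    by rewrite -[d i]I2 -[d i]I1 -qj -!A (A (d i)) !(A j) H comp0m compm0.
  + by rewrite -!A (A q) qj I1 !A -(A j) dd.
  by rewrite -!A (A q) qj I1 !A -(A j) dij // compm0 comp0m.
- by rewrite subr_eq0; apply/eqP => E; case: jq.
- by rewrite {1}/e compBm I1 -A qe compm0 subr0.
- by move=> i; rewrite -A qe compm0.
by move=> i; rewrite !A ej !comp0m.
Qed.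

Lemma zero_objP X : idm X = 0 -> is_zero_ob X.
Proof.
move=> X0; split=> T f g.
  by rewrite -[f]I2 -[g]I2 X0 !compm0.
by rewrite -[f]I1 -[g]I1 X0 !comp0m.
Qed.

(** Regularity turns a subobject [i] into the idempotent [i g], so an object without proper
    idempotents is simple. A proper idempotent gives a summand with a smaller bound. *)
Lemma simple_summand m X : bounded X m -> idm X <> 0 ->
  exists S (j : mor S X) (q : mor X S), simple S /\ q ∘ j = idm S.
Proof.
elim: m X => [|m IH] X bX X0.
  have /bX : orthogonal_idempotents (fun _ : 'I_1 => idm X); last by [].
  split=> [i|i|i i']; [exact/eqP | exact: I1 | by rewrite !ord1].
have [[e [ee [e0 e1]]]|indec] :=
    pselect (exists e : mor X X, e ∘ e = e /\ e <> 0 /\ e <> idm X).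
  have [Y [i [p [pi ip]]]] := split_idem ee.
  have [||S [j [q [sS qj]]]] := IH Y.
  - by apply: (bounded_summand pi) bX; rewrite ip.
  - by move=> Y0; apply: e0; rewrite -ip -[i]I2 Y0 compm0 comp0m.
  by exists S, (i ∘ j), (q ∘ p); split; rewrite // -A (A p) pi I1.
exists X, (idm X), (idm X); split; last exact: I1.
split=> [[/(_ X (idm X) 0)]//|U i mi].
have [g igi] := vN i; have gi : g ∘ i = idm U by apply: mi; rewrite A igi I2.
have [ig|ig] := pselect (i ∘ g = 0).
  left; apply: zero_objP; rewrite -gi; apply: mi.
  by rewrite gi compm0 I2 -igi ig comp0m.
right; exists g; split=> //; apply: contrapT => ig1; apply: indec.
by exists (i ∘ g); rewrite A igi.
Qed.

(** One simple summand is split off at each step; both the finite length and the direct sum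
    decomposition are read off from it. *)
Inductive decomposable : ob C -> Prop :=
| decomposable_zero X : idm X = 0 -> decomposable X
| decomposable_sum X' X S (i : mor X' X) (p : mor X X') (j : mor S X) (q : mor X S) :
    p ∘ i = idm X' -> q ∘ j = idm S -> p ∘ j = 0 -> q ∘ i = 0 ->
    i ∘ p + j ∘ q = idm X -> simple S -> decomposable X' -> decomposable X.

Lemma decompose m X : bounded X m -> decomposable X.
Proof.
elim: m X => [|m IH] X bX; have [X0|X0] := eqVneq (idm X) 0.
- exact: decomposable_zero.
- have /bX : orthogonal_idempotents (fun _ : 'I_1 => idm X); last by [].
  split=> [i|i|i i']; [exact: X0 | exact: I1 | by rewrite !ord1].
- exact: decomposable_zero.
have [S [j [q [sS qj]]]] := simple_summand bX (elimN eqP X0).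
have ee : (idm X - j ∘ q) ∘ (idm X - j ∘ q) = idm X - j ∘ q.
  by rewrite {1}compBm I1 compmB I2 -A (A q) qj I1 subrr subr0.
have [X' [i [p [pi ip]]]] := split_idem ee.
have pj : p ∘ j = 0 by rewrite -[p]I1 -pi -!A (A i) ip compBm I1 -A qj I2 subrr compm0.
have qi : q ∘ i = 0 by rewrite -[i]I2 -pi !A -(A q) ip compmB I2 A qj I1 subrr comp0m.
apply: (decomposable_sum pi qj pj qi _ sS).
  by rewrite ip subrK.
apply: IH; apply: (bounded_summand pi) bX => E.
case: sS => nS _; apply: nS; apply: zero_objP.
by rewrite -qj -[j]I1 -E -A pj !compm0.
Qed.

Lemma regular_decomposable X : decomposable X.
Proof. by have [m] := orthogonal_bound fd X; exact: decompose. Qed.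

Lemma regular_finite_length X : finite_length X.
Proof.
elim: (regular_decomposable X) => {X} [X X0|X' X S i p j q pi qj pj qi s1 sS _ IH].
  by apply: finite_length_zero; apply: zero_objP.
apply: (finite_length_extension (i := i) (p := q)) sS IH.
  split=> // T t qt; exists (p ∘ t); split; last by move=> u <-; rewrite A pi I1.
  by rewrite A -[RHS]I1 -s1 compDm -(A j) qt compm0 addr0.
split=> // T t ti; exists (t ∘ j); split; last by move=> u <-; rewrite -A qj I2.
by rewrite -A -[RHS]I2 -s1 compmD (A t i) ti comp0m add0r.
Qed.

Lemma regular_semisimple : semisimple C.
Proof.
move=> X; elim: (regular_decomposable X) => {X} [X X0|X' X S i p j q pi qj pj qi s1 sS _].
  exists 0%N, (fun _ => X); split; first by case.
  by exists (fun _ => idm X), (fun _ => idm X); split=> [[]//|[]//|]; rewrite big_ord0 X0.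
move=> [n [S' [sS' [inj [proj [pi' pi0 sum1]]]]]].
pose S1 (a : 'I_n.+1) := oapp S' S (unlift ord0 a).
(* The source of the map depends on the option, hence a [match] with a return type. *)
pose inj1 (a : 'I_n.+1) : mor (S1 a) X :=
  match unlift ord0 a as o return mor (oapp S' S o) X with
  | Some b => i ∘ inj b | None => j end.
pose proj1 (a : 'I_n.+1) : mor X (S1 a) :=
  match unlift ord0 a as o return mor X (oapp S' S o) with
  | Some b => proj b ∘ p | None => q end.
exists n.+1, S1; split.
  by move=> a; rewrite /S1; case: (unlift ord0 a).
exists inj1, proj1; split.
- move=> a; rewrite /S1 /inj1 /proj1; case: (unlift ord0 a) => [b|] //=.
  by rewrite -A (A p) pi I1 pi'.
- move=> a b ab; rewrite /S1 /inj1 /proj1.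
  case: unliftP ab => [a' ->|->]; case: unliftP => [b' ->|->] //=.
  + rewrite (inj_eq (@lift_inj _ _)) => ab.
    by rewrite -A (A p) pi I1 pi0.
  + by move=> _; rewrite A qi comp0m.
  + by move=> _; rewrite -A pj compm0.
rewrite big_ord_recl /inj1 /proj1 /S1 unlift_none -s1 addrC; congr (_ + _).
rewrite (eq_bigr (fun a => i ∘ (inj a ∘ proj a) ∘ p)); last by move=> a _; rewrite liftK !A.
by rewrite -comp_summ -compm_sum sum1 I2.
Qed.
End Regular.

(** * Passage of regularity and direct sums to the idempotent completion *)

Section KaroubiRegular.
Variables (k : fieldType) (C : smc k).
Local Notation A := (compA (smcP C)).

Lemma kar_split (P : kar_ob C) (e : kar_hom P P) : kar_comp e e = e ->
  exists (Q : ob (kar C)) (i : mor Q (P : ob (kar C))) (p : mor (P : ob (kar C)) Q),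
    p ∘ i = idm Q /\ i ∘ p = e.
Proof.
move=> /(congr1 (@kval _ _ _ _)) ee; change (kval e ∘ kval e = kval e) in ee.
have i_pr : kar_pred (P := KarOb ee) (Q := P) (kval e).
  by apply/eqP; rewrite /= kval_l ee.
have p_pr : kar_pred (P := P) (Q := KarOb ee) (kval e).
  by apply/eqP; rewrite /= -A kval_r ee.
exists (KarOb ee), (KarHom i_pr), (KarHom p_pr).
by split; apply: kar_val_inj; exact: ee.
Qed.

Lemma kar_finite_dim (P Q : ob (kar C)) :
  finite_dim (mor (kob P) (kob Q)) -> finite_dim (mor P Q).
Proof.
move=> [n [e gen]]; exists n, (fun i => kar_res (e i) : mor P Q) => v.
have [c vE] := gen (kval v); exists c; apply: kar_val_inj.
transitivity (kidem Q ∘ (\sum_a c a *: e a) ∘ kidem P).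
  by rewrite -vE (eqP (kvalP v)).
rewrite compm_sum comp_summ (big_morph (@kval _ _ P Q) (id1 := 0) (op1 := +%R)) //.
by apply: eq_bigr => a _; rewrite compmZ compZm.
Qed.

Lemma kar_von_neumann (P Q : ob (kar C)) (f : mor P Q) :
  (exists g, kval f ∘ g ∘ kval f = kval f) -> exists g : mor Q P, f ∘ g ∘ f = f.
Proof.
move=> [g fgf]; exists (kar_res g); apply: kar_val_inj.
change (kval f ∘ (kidem P ∘ g ∘ kidem Q) ∘ kval f = kval f).
by rewrite !A kval_r -!A kval_l A.
Qed.

(** The direct sum of the underlying objects carries the diagonal idempotent [e]. *)
Lemma kar_direct_sums :
  (forall n (S : 'I_n -> ob C), exists X, is_direct_sum S X) ->
  forall n (S : 'I_n -> ob (kar C)), exists X, is_direct_sum S X.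
Proof.
move=> ds n S; have [X [inj [proj [pi pi0 sum1]]]] := ds n (fun a => kob (S a)).
pose e := \sum_a inj a ∘ kidem (S a) ∘ proj a.
have pe a : proj a ∘ e = kidem (S a) ∘ proj a.
  rewrite compm_sum (bigD1 a) //= !A pi (comp1m (smcP C)) big1 ?addr0 // => b ba.
  by rewrite !A pi0 ?comp0m // eq_sym.
have ei a : e ∘ inj a = inj a ∘ kidem (S a).
  rewrite comp_summ (bigD1 a) //= -!A pi (compm1 (smcP C)) big1 ?addr0 // => b ba.
  by rewrite -!A pi0 // !compm0.
have ee : e ∘ e = e.
  rewrite {1}/e comp_summ; apply: eq_bigr => a _.
  by rewrite -!A pe kidemA.
pose E := KarOb ee.
have i_pr a : kar_pred (P := S a) (Q := E) (inj a ∘ kidem (S a)).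
  by apply/eqP; rewrite /= A ei -!A !kidemP.
have p_pr a : kar_pred (P := E) (Q := S a) (kidem (S a) ∘ proj a).
  by apply/eqP; rewrite /= kidemA -A pe kidemA.
exists E, (fun a => KarHom (i_pr a)), (fun a => KarHom (p_pr a)); split.
- move=> a; apply: kar_val_inj; change (kidem (S a) ∘ proj a ∘ (inj a ∘ kidem (S a)) = kidem (S a)).
  by rewrite -A (A (proj a)) pi (comp1m (smcP C)) kidemP.
- move=> a b ab; apply: kar_val_inj.
  change (kidem (S a) ∘ proj a ∘ (inj b ∘ kidem (S b)) = 0).
  by rewrite -A (A (proj a)) pi0 // comp0m compm0.
apply: kar_val_inj; rewrite (big_morph (@kval _ _ E E) (id1 := 0) (op1 := +%R)) //.
by apply: eq_bigr => a _; rewrite /= -!A kidemA.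
Qed.
End KaroubiRegular.

Section KaroubiRestriction.
Variables (k : fieldType) (C : smc k).
Local Notation A := (compA (smcP C)).
Local Notation T := (tensm_comp (smcP C)).
Implicit Types P Q R S : ob (kar C).

Definition kar_natural P Q (n : mor (kob P) (kob Q)) : Prop :=
  n ∘ kidem P = kidem Q ∘ n.

(** Cutting a morphism down by the idempotents is not functorial in general; it suffices that the
    inner morphism commutes with them. *)
Lemma kar_res_comp P Q R (n' : mor (kob Q) (kob R)) (n : mor (kob P) (kob Q)) :
  kar_natural n -> (kar_res n' : mor Q R) ∘ (kar_res n : mor P Q) = kar_res (n' ∘ n).
Proof.
move=> nn; apply: kar_val_inj.
change (kidem R ∘ n' ∘ kidem Q ∘ (kidem Q ∘ n ∘ kidem P) = kidem R ∘ (n' ∘ n) ∘ kidem P).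
have E : kidem Q ∘ n ∘ kidem P = n ∘ kidem P by rewrite -nn -A kidemP.
by rewrite E -!A (A (kidem Q)) E.
Qed.

Lemma kar_res_comp3 P Q R S (a : mor (kob R) (kob S)) (b : mor (kob Q) (kob R))
    (c : mor (kob P) (kob Q)) : kar_natural b -> kar_natural c ->
  (kar_res a : mor R S) ∘ (kar_res b : mor Q R) ∘ (kar_res c : mor P Q) =
  kar_res (a ∘ b ∘ c).
Proof. by move=> nb nc; rewrite !kar_res_comp. Qed.

Lemma kar_res_tens P Q P' Q' (n : mor (kob P) (kob Q)) (n' : mor (kob P') (kob Q')) :
  (kar_res n : mor P Q) ⊠ (kar_res n' : mor P' Q') =
  (kar_res (n ⊠ n' : mor (kob (P ⊗ P')) (kob (Q ⊗ Q'))) : mor (P ⊗ P') (Q ⊗ Q')).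
Proof. by apply: kar_val_inj; rewrite /= !T. Qed.

Lemma kar_res_idm P : (kar_res (idm (kob P)) : mor P P) = idm P.
Proof.
by apply: kar_val_inj; rewrite /= (compm1 (smcP C)) kidemP.
Qed.

Lemma kar_res_tensr P Q S (n : mor (kob P) (kob Q)) :
  (kar_res n : mor P Q) ⊠ idm S =
  (kar_res (n ⊠ idm (kob S) : mor (kob (P ⊗ S)) (kob (Q ⊗ S))) : mor (P ⊗ S) (Q ⊗ S)).
Proof. by rewrite -(kar_res_idm S) kar_res_tens. Qed.

Lemma kar_res_tensl P Q S (n : mor (kob P) (kob Q)) :
  idm S ⊠ (kar_res n : mor P Q) =
  (kar_res (idm (kob S) ⊠ n : mor (kob (S ⊗ P)) (kob (S ⊗ Q))) : mor (S ⊗ P) (S ⊗ Q)).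
Proof. by rewrite -(kar_res_idm S) kar_res_tens. Qed.

Lemma kar_natural_tens P Q P' Q' (n : mor (kob P) (kob Q)) (n' : mor (kob P') (kob Q')) :
  kar_natural n -> kar_natural n' ->
  kar_natural (P := P ⊗ P') (Q := Q ⊗ Q') (n ⊠ n').
Proof. by rewrite /kar_natural /= => nn nn'; rewrite -!T nn nn'. Qed.

Lemma kar_natural_idm P : kar_natural (P := P) (Q := P) (idm (kob P)).
Proof. by rewrite /kar_natural (comp1m (smcP C)) (compm1 (smcP C)). Qed.
End KaroubiRestriction.

(** * Duals and traces in the Karoubi completion *)

Section KaroubiDual.
Variables (k : fieldType) (C : smc k).
Local Notation A := (compA (smcP C)).
Local Notation T := (tensm_comp (smcP C)).
Local Notation I1 := (comp1m (smcP C)).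
Local Notation I2 := (compm1 (smcP C)).
Variables P D : ob (kar C).
Variables (e : mor (D ⊗ P) one) (c : mor one (P ⊗ D)).
Let p : mor (kob P) (kob P) := kidem P.
Let q : mor (kob D) (kob D) := kidem D.
Let e0 : mor (kob D ⊗ kob P) one := kval e.
Let c0 : mor one (kob P ⊗ kob D) := kval c.

Let pp : p ∘ p = p.
Proof. exact: kidemP. Qed.
Let qq : q ∘ q = q.
Proof. exact: kidemP. Qed.
Let eqp : e0 ∘ (q ⊠ p) = e0.
Proof. exact: (kval_r e). Qed.
Let pqc : (p ⊠ q) ∘ c0 = c0.
Proof. exact: (kval_l c). Qed.

(** The morphisms [e] and [c] absorb the idempotents that cut down the structural maps, so the
    zigzag is that of the base category followed on the right by one copy of [p]. *)
Lemma kar_zigzag : kval (runit P ∘ (idm P ⊠ e) ∘ assoc P D P ∘ (c ⊠ idm P)) =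
  runit (kob P) ∘ (idm (kob P) ⊠ e0) ∘ assoc (kob P) (kob D) (kob P) ∘
    (c0 ⊠ idm (kob P)) ∘ (idm one ⊠ p).
Proof.
change (kval (kar_runit P) ∘ (p ⊠ e0) ∘ kval (kar_assoc P D P) ∘ (c0 ⊠ p) =
  runit (kob P) ∘ (idm (kob P) ⊠ e0) ∘ assoc (kob P) (kob D) (kob P) ∘
    (c0 ⊠ idm (kob P)) ∘ (idm one ⊠ p)).
rewrite kar_runitE kar_assocE -/p -/q.
rewrite -!A (A (p ⊠ idm one)) -T pp I1.
have -> : p ⊠ e0 = (idm (kob P) ⊠ e0) ∘ (p ⊠ (q ⊠ p)) by rewrite -T I1 eqp.
rewrite -!A; congr (_ ∘ (_ ∘ _)).
rewrite (A (p ⊠ (q ⊠ p))) -(assoc_nat (smcP C)) -!A; congr (_ ∘ _).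
by rewrite -!T !I1 !I2 !pp !pqc.
Qed.

Lemma kar_zagzig (a : mor (D ⊗ (P ⊗ D)) (D ⊗ P ⊗ D))
    (a0 : mor (kob D ⊗ (kob P ⊗ kob D)) (kob D ⊗ kob P ⊗ kob D)) :
  inverse_of (assoc D P D) a -> inverse_of (assoc (kob D) (kob P) (kob D)) a0 ->
  kval (lunit D ∘ (e ⊠ idm D) ∘ a ∘ (idm D ⊠ c)) =
  lunit (kob D) ∘ (e0 ⊠ idm (kob D)) ∘ a0 ∘ (idm (kob D) ⊠ c0) ∘ (q ⊠ idm one).
Proof.
move=> [_ aa] [aa0 _].
have nat0 : a0 ∘ (q ⊠ (p ⊠ q)) = ((q ⊠ p) ⊠ q) ∘ a0.
  transitivity (a0 ∘ (q ⊠ (p ⊠ q)) ∘ (assoc (kob D) (kob P) (kob D) ∘ a0)).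
    by rewrite (_ : assoc _ _ _ ∘ a0 = idm _) ?I2 //; case: (assoc_iso (smcP C) (kob D) (kob P) (kob D)) => b [b1 b2]; rewrite -[a0]I2 -b2 (A a0) aa0 I1.
  by rewrite -!A (A (q ⊠ (p ⊠ q))) -(assoc_nat (smcP C)) -!A (A a0) aa0 I1.
(* [a] is an arbitrary inverse of the associator in the completion; uniqueness of inverses
   identifies it with the cut-down of [a0]. *)
have aE : kval a = ((q ⊠ p) ⊠ q) ∘ a0.
  have al : ((q ⊠ p) ⊠ q) ∘ kval a = kval a := kval_l a.
  have := congr1 (@kval _ _ _ _) aa.
  change (kval (kar_assoc D P D) ∘ kval a = q ⊠ (p ⊠ q) -> kval a = (q ⊠ p) ⊠ q ∘ a0).
  rewrite kar_assocE -A -/p -/q al => E.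
  by rewrite -nat0 -E A aa0 I1.
change (kval (kar_lunit D) ∘ (e0 ⊠ q) ∘ kval a ∘ (q ⊠ c0) =
  lunit (kob D) ∘ (e0 ⊠ idm (kob D)) ∘ a0 ∘ (idm (kob D) ⊠ c0) ∘ (q ⊠ idm one)).
rewrite kar_lunitE aE -/p -/q -!A; congr (_ ∘ _).
rewrite (A (idm one ⊠ q)) -T qq I1 (A (e0 ⊠ q)) -T eqp qq.
have -> : e0 ⊠ q = (e0 ⊠ idm (kob D)) ∘ ((q ⊠ p) ⊠ q) by rewrite -T I1 eqp.
rewrite -A; congr (_ ∘ _); rewrite A -nat0 -A; congr (_ ∘ _).
by rewrite -!T !I1 !I2 !qq !pqc.
Qed.

Lemma kar_trace (f : mor P P) : kval (e ∘ braid P D ∘ (f ⊠ idm D) ∘ c) =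
  e0 ∘ braid (kob P) (kob D) ∘ (kval f ⊠ idm (kob D)) ∘ c0.
Proof.
change (e0 ∘ kval (kar_braid P D) ∘ (kval f ⊠ q) ∘ c0 =
  e0 ∘ braid (kob P) (kob D) ∘ (kval f ⊠ idm (kob D)) ∘ c0).
rewrite kar_braidE -/p -/q -!A; congr (_ ∘ (_ ∘ _)).
rewrite -[in RHS]pqc !A -!T kval_l I1 qq.
by rewrite kval_r.
Qed.
End KaroubiDual.

(** * Direct sums, duals and traces of permutation modules *)

Section PermRigid.
Variables (k : fieldType) (F : permutation -> Prop) (F0 : F empty_perm).
Variable mu : emb_function k.
Hypotheses (F_her : hereditary F) (muP : is_measure F mu).
Implicit Types s t u v : perm_ob F.

Let one : perm_ob F := perm_one F0.
Let C : smc k := Smc (perm_laws F0 F_her muP).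
Local Notation pcomp := (perm_comp mu).
Local Notation cin := (curry_in (F0 := F0) F_her).
Local Notation cout := (curry_out (F0 := F0) F_her).

Lemma perm_finite_dim s t : finite_dim (perm_hom k s t).
Proof.
exists #|amalgs s t|, (fun i => [ffun c => (c == enum_val i)%:R] : perm_hom k s t) => f.
exists (fun i => f (enum_val i)); apply/ffunP => c.
rewrite sum_ffunE (bigD1 (enum_rank c)) //= big1 ?addr0 => [|i ic].
  by rewrite !ffunE enum_rankK eqxx /GRing.scale /= mulr1.
rewrite !ffunE; case: eqVneq => [ci|_]; last by rewrite /GRing.scale /= mulr0.
by rewrite ci enum_valK eqxx in ic.
Qed.

Section DirectSum.
Variables (n : nat) (S : 'I_n -> perm_ob F).

Definition perm_sum : perm_ob F :=
  @PermOb F {a : 'I_n & summand (S a)} (fun i => S (tag i) (tagged i))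
    (fun i => perm_ofP (tagged i)).

Definition sum_pt a V (x : pts (S a) V) : pts perm_sum V :=
  @pt F perm_sum (Tagged (fun a => summand (S a)) (tag x)) V (tagged x).

Definition sum_inj a : perm_hom k (S a) perm_sum :=
  of_kernel (fun V x y => (sum_pt x == y)%:R).

Lemma sum_inj_delta a : is_delta (sum_inj a) (fun V _ => @sum_pt a V).
Proof.
move=> V FV x y; rewrite (ev_of_kernel F_her) // => V1 V2 g x1 y1 _.
by rewrite -[sum_pt _]/(smap g (sum_pt x1)) smap_eq.
Qed.

Lemma sum_pt_eq a V (x y : pts (S a) V) : (sum_pt x == sum_pt y) = (x == y).
Proof.
apply/eqP/eqP => [|->//]; case: x y => i x [j y] E.
have /eqP := congr1 tag E; rewrite eq_Tagged /= => /eqP ij.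
by subst j; rewrite (@pt_inj F perm_sum (Tagged (fun a => summand (S a)) i) V x y E).
Qed.

Lemma sum_pt_neq a b V (x : pts (S a) V) (y : pts (S b) V) : a != b ->
  (sum_pt x == sum_pt y) = false.
Proof.
move=> ab; apply/eqP => E; case/eqP: ab.
exact: (congr1 (fun z : pts perm_sum V => tag (tag z)) E).
Qed.

Lemma perm_sumP : is_direct_sum (C := C) S perm_sum.
Proof.
exists sum_inj, (fun a => transpose (sum_inj a)).
have pi a b V (x : pts (S b) V) z : F V ->
    ev (pcomp (transpose (sum_inj a)) (sum_inj b)) x z = (sum_pt z == sum_pt x)%:R.
  move=> FV; rewrite (delta_compl F_her muP _ (@sum_inj_delta b) FV).
  by rewrite (ev_transpose F_her) // (sum_inj_delta FV).
have piE a : pcomp (transpose (sum_inj a)) (sum_inj a) = perm_id k (S a).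
  by apply: ev_ext => V x z FV; rewrite pi // sum_pt_eq (ev_id k F_her) // eq_sym.
have pi0 a b : a != b -> pcomp (transpose (sum_inj a)) (sum_inj b) = 0.
  by move=> ab; apply: ev_ext => V x z FV; rewrite pi // sum_pt_neq // ev0.
split=> //; apply: ev_ext => V x y FV.
(* Every point of the sum lies in one summand, so the last identity is checked after composing with
   [sum_inj a]. *)
pose a := tag (tag x); pose x0 : pts (S a) V := @pt F (S a) (tagged (tag x)) V (tagged x).
have xE : x = sum_pt x0.
  by rewrite /x0 /a; case: x {a x0} => [[a i] x].
rewrite xE -(delta_compl F_her muP _ (@sum_inj_delta a) FV).
pose i_ b : mor (S b : ob C) (perm_sum : ob C) := sum_inj b.
pose p_ b : mor (perm_sum : ob C) (S b : ob C) := transpose (sum_inj b).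
have -> : pcomp (\sum_b pcomp (sum_inj b) (transpose (sum_inj b))) (sum_inj a) = sum_inj a.
  transitivity ((\sum_b i_ b ∘ p_ b) ∘ i_ a) => //; rewrite comp_summ (bigD1 a) // big1 => [|b ba].
    by apply: etrans (addr0 _) _; rewrite -(compA (smcP C)) (piE a : p_ a ∘ i_ a = idm _) (compm1 (smcP C)).
  by rewrite -(compA (smcP C)) (pi0 b a ba : p_ b ∘ i_ a = 0) compm0.
by rewrite (sum_inj_delta FV) (ev_id k F_her).
Qed.
End DirectSum.

Lemma perm_zigzagE s d (c : perm_hom k one (perm_tens s d))
    (e : perm_hom k (perm_tens d s) one) :
  pcomp (pcomp (pcomp (perm_runit k F0 s) (perm_tensm (perm_id k s) e))
    (perm_assoc k s d s)) (perm_tensm c (perm_id k s)) =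
  pcomp (transpose (pcomp (cin e) (cout c))) (perm_lunit k F0 s).
Proof.
apply: ev_ext => V x z FV; apply: etrans (ev_zigzag F_her muP c e x z FV) _.
by rewrite (delta_compl F_her muP _ (@lunit_delta k F F0 F_her s) FV) (ev_transpose F_her).
Qed.

Lemma perm_zagzigE s d (c : perm_hom k one (perm_tens s d))
    (e : perm_hom k (perm_tens d s) one) :
  pcomp (pcomp (pcomp (perm_lunit k F0 d) (perm_tensm e (perm_id k d)))
    (transpose (perm_assoc k d s d))) (perm_tensm (perm_id k d) c) =
  pcomp (pcomp (cout c) (cin e)) (perm_runit k F0 d).
Proof.
apply: ev_ext => V x z FV; apply: etrans (ev_zagzig F_her muP c e x z FV) _.
by rewrite (delta_compl F_her muP _ (@runit_delta k F F0 F_her d) FV).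
Qed.

Lemma transpose_assoc_inverse (s t u : ob C) :
  inverse_of (assoc s t u) (transpose (perm_assoc k s t u)).
Proof.
exact: (delta_inverse F_her muP (@assoc_delta k F F_her s t u) (@assoc_codelta k F F_her s t u)).
Qed.

Lemma inverse_assoc (s t u : ob C) (a : mor (s ⊗ (t ⊗ u)) (s ⊗ t ⊗ u)) :
  inverse_of (assoc s t u) a -> a = transpose (perm_assoc k s t u).
Proof.
move=> [aa _]; have [_ b2] := transpose_assoc_inverse s t u.
by rewrite -[LHS](compm1 (smcP C)) -b2 (compA (smcP C)) aa (comp1m (smcP C)).
Qed.

Lemma lunit_cancel s t (f g : perm_hom k s t) :
  pcomp f (perm_lunit k F0 s) = pcomp g (perm_lunit k F0 s) -> f = g.
Proof.
have [_ b2] := delta_inverse F_her muP (@lunit_delta k F F0 F_her s)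
  (@lunit_codelta k F F0 F_her s).
move=> /(congr1 (fun h => pcomp h (transpose (perm_lunit k F0 s)))).
by rewrite -!(perm_compA F_her muP) b2 !(perm_compm1 F_her muP).
Qed.

(** Each object is its own dual: unit and counit are both the identity kernel, read as a function of
    two variables. *)
Lemma perm_rigid : rigid C.
Proof.
move=> s; split.
pose c : perm_hom k one (perm_tens s s) := uncurry_out F0 (perm_id k s).
pose e : perm_hom k (perm_tens s s) one := uncurry_in F0 (perm_id k s).
have ec : pcomp (cin e) (cout c) = perm_id k s.
  by rewrite (uncurry_outK F0 F_her) (uncurry_inK F0 F_her) (perm_comp1m F_her muP).
have ce : pcomp (cout c) (cin e) = perm_id k s.
  by rewrite (uncurry_outK F0 F_her) (uncurry_inK F0 F_her) (perm_comp1m F_her muP).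
exists s e c; split.
  apply: etrans (perm_zigzagE c e) _.
  by rewrite ec (transpose_id k F_her) (perm_comp1m F_her muP).
move=> a /inverse_assoc ->; apply: etrans (perm_zagzigE c e) _.
by rewrite ce (perm_comp1m F_her muP).
Qed.

(** The dual is an arbitrary witness of [R]. Its zigzag, after cancelling the unitor, says that its
    curried kernels compose to the identity. *)
Lemma perm_trace (R : rigid C) s (f : perm_hom k s s) :
  tr R f = itr mu f *: perm_id k one.
Proof.
rewrite /tr; set D := inhabited_witness _; have zig := dual_zigzag (dualP D).
pose d : perm_ob F := dual D; pose e : perm_hom k (perm_tens d s) one := Defs.ev D.
pose c : perm_hom k one (perm_tens s d) := coev D.
have ec : transpose (pcomp (cin e) (cout c)) = perm_id k s.
  apply: lunit_cancel; rewrite -perm_zigzagE (perm_comp1m F_her muP).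
  exact: zig.
rewrite [LHS](one_scalar F_her); congr (_ *: _).
apply: etrans (ev_trace F_her muP c e f) _.
by rewrite ec (perm_comp1m F_her muP).
Qed.

Let pone V : pts one V := pt1 F0 V.

Lemma curry_out_inj s t : injective (@curry_out k F F0 F_her s t).
Proof.
by move=> c c' E; apply: ev_ext => V x y FV; rewrite !(ev_curry_out F_her) // E.
Qed.

Lemma curry_in_inj s t : injective (@curry_in k F F0 F_her s t).
Proof.
by move=> c c' E; apply: ev_ext => V x y FV; rewrite !(ev_curry_in F_her) // E.
Qed.

(** Tensoring becomes composition on the two sides of the curried kernel; this shows that the unit
    chosen in [kar_perm_rigid] absorbs the idempotents. *)
Lemma curry_out_tensm s t s' t' (f : perm_hom k s s') (g : perm_hom k t t')
    (c : perm_hom k one (perm_tens s t)) :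
  cout (pcomp (perm_tensm f g) c) = pcomp (pcomp g (cout c)) (transpose f).
Proof.
apply: ev_ext => V x y FV; pose w0 := tpair F_her FV x y.
have -> : ev (cout (pcomp (perm_tensm f g) c)) x y =
    ev (pcomp (perm_tensm f g) c) (pone V) w0.
  by rewrite (ev_curry_out F_her) // tp1_pair tp2_pair.
rewrite (ev_comp F_her muP) //.
pose psi := fun V1 (h : embedding V V1) (a : pts s V1) (b : pts t V1) =>
  ev (cout c) a b * (ev f a (smap h x) * ev g b (smap h y)).
transitivity (integ F mu (fun V1 (h : embedding V V1) (w : pts (perm_tens s t) V1) =>
  psi V1 h (tp1 w) (tp2 w))).
  apply: eq_integ => V1 h w F1; rewrite /comp_kernel (ev_curry_out F_her) //.
  by rewrite (ev_tensm F_her) // tp1_map tp2_map tp1_pair tp2_pair.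
apply: etrans (integ_tens_comp F_her muP (psi := psi) FV _) _.
  by move=> V1 V2 h' h a b F2; rewrite /psi !smap_comp !ev_map.
rewrite (ev_comp F_her muP) //; apply: eq_integ => V1 h a F1.
rewrite /comp_kernel (ev_transpose F_her) // (ev_comp F_her muP) // -integZ.
apply: eq_integ => V2 h' b F2; rewrite /psi /comp_kernel !smap_comp ev_map.
ring.
Qed.

Lemma curry_in_tensm s t s' t' (f : perm_hom k s' s) (g : perm_hom k t' t)
    (e : perm_hom k (perm_tens s t) one) :
  cin (pcomp e (perm_tensm f g)) = pcomp (pcomp (transpose g) (cin e)) f.
Proof.
apply: ev_ext => V x y FV; pose w0 := tpair F_her FV x y.
have -> : ev (cin (pcomp e (perm_tensm f g))) x y =
    ev (pcomp e (perm_tensm f g)) w0 (pone V).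
  by rewrite (ev_curry_in F_her) // tp1_pair tp2_pair.
rewrite (ev_comp F_her muP) //.
pose psi := fun V1 (h : embedding V V1) (a : pts s V1) (b : pts t V1) =>
  ev (cin e) a b * (ev f (smap h x) a * ev g (smap h y) b).
transitivity (integ F mu (fun V1 (h : embedding V V1) (w : pts (perm_tens s t) V1) =>
  psi V1 h (tp1 w) (tp2 w))).
  apply: eq_integ => V1 h w F1; rewrite /comp_kernel (ev_curry_in F_her) //.
  by rewrite (ev_tensm F_her) // tp1_map tp2_map tp1_pair tp2_pair mulrC.
apply: etrans (integ_tens_comp F_her muP (psi := psi) FV _) _.
  by move=> V1 V2 h' h a b F2; rewrite /psi !smap_comp !ev_map.
rewrite (ev_comp F_her muP) //; apply: eq_integ => V1 h a F1.
rewrite /comp_kernel (ev_comp F_her muP) // -integZ.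
apply: eq_integ => V2 h' b F2; rewrite /psi /comp_kernel (ev_transpose F_her) //.
rewrite !smap_comp ev_map.
ring.
Qed.

(** The dual of the image of [p] is the image of the transpose of [p], and this transpose, read as a
    function of two variables, is both unit and counit. *)
Lemma kar_perm_rigid : rigid (kar C).
Proof.
move=> P; split; pose s : perm_ob F := kob P; pose p : perm_hom k s s := kidem P.
have pp : pcomp p p = p := kidemP P.
pose q := transpose p.
have qq : pcomp q q = q by rewrite -(perm_comp_transpose F_her muP) pp.
pose D : ob (kar C) := @KarOb k C s q qq.
pose c0 := uncurry_out F0 q; pose e0 := uncurry_in F0 q.
have coutE : cout c0 = q by rewrite (uncurry_outK F0 F_her).
have cinE : cin e0 = q by rewrite (uncurry_inK F0 F_her).
have c_pr : kar_pred (C := C) (P := kar_one C) (Q := kar_tens P D) c0.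
  apply/eqP; apply: etrans (compm1 (smcP C) _) _.
  by apply: curry_out_inj; rewrite curry_out_tensm coutE -/q !qq.
have e_pr : kar_pred (C := C) (P := kar_tens D P) (Q := kar_one C) e0.
  apply/eqP; rewrite -(compA (smcP C)); apply: etrans (comp1m (smcP C) _) _.
  by apply: curry_in_inj; rewrite curry_in_tensm cinE -/q !qq.
pose c : mor (Defs.one : ob (kar C)) (P ⊗ D) := KarHom c_pr.
pose e : mor (D ⊗ P) (Defs.one : ob (kar C)) := KarHom e_pr.
exists D e c; split.
  apply: kar_val_inj; rewrite kar_zigzag.
  transitivity (kval (kar_lunit P)) => //; rewrite kar_lunitE.
  have -> : runit (kob P) ∘ (idm (kob P) ⊠ kval e) ∘ assoc (kob P) (kob D) (kob P) ∘
    (kval c ⊠ idm (kob P)) = kidem P ∘ lunit (kob P).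
    by apply: etrans (perm_zigzagE c0 e0) _; rewrite coutE cinE qq (transposeK F_her).
  rewrite -(compA (smcP C)) (lunit_nat (smcP C)) (compA (smcP C)).
  by rewrite (kidemP P).
move=> a aP; apply: kar_val_inj.
rewrite (kar_zagzig e c aP (transpose_assoc_inverse s s s)).
transitivity (kval (kar_runit D)) => //; rewrite kar_runitE.
have -> : lunit (kob D) ∘ (kval e ⊠ idm (kob D)) ∘ transpose (perm_assoc k s s s) ∘
    (idm (kob D) ⊠ kval c) = kidem D ∘ runit (kob D).
  by apply: etrans (perm_zagzigE c0 e0) _; rewrite coutE cinE qq.
rewrite -(compA (smcP C)) (runit_nat (smcP C)) (compA (smcP C)).
by rewrite (kidemP D).
Qed.

(** The zigzag gives the identity only on the image of [p], which suffices because [f = p f]. *)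
Lemma kar_perm_trace (R : rigid (kar C)) (P : ob (kar C)) (f : mor P P) :
  kval (tr R f) = itr mu (kval f) *: perm_id k one.
Proof.
rewrite /tr; set D := inhabited_witness _; have zig := dual_zigzag (dualP D).
pose e : mor (dual D ⊗ P) (Defs.one : ob (kar C)) := Defs.ev D.
pose c : mor (Defs.one : ob (kar C)) (P ⊗ dual D) := coev D.
pose s : perm_ob F := kob P; pose p : perm_hom k s s := kidem P.
pose d : perm_ob F := kob (dual D).
pose e0 : perm_hom k (perm_tens d s) one := kval e.
pose c0 : perm_hom k one (perm_tens s d) := kval c.
have ec : pcomp (transpose (pcomp (cin e0) (cout c0))) p = p.
  apply: lunit_cancel; rewrite -!(perm_compA F_her muP).
  have E : pcomp p (perm_lunit k F0 s) = pcomp (perm_lunit k F0 s) (perm_tensm (perm_id k one) p).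
    by rewrite (perm_lunit_nat F0 F_her muP).
  rewrite E (perm_compA F_her muP) -perm_zigzagE.
  apply: etrans (esym (kar_zigzag e c)) _.
  by rewrite /e /c zig; exact: kar_lunitE.
apply: etrans (kar_trace e c f) _.
rewrite [LHS](one_scalar F_her); congr (_ *: _).
apply: etrans (ev_trace F_her muP c0 e0 (kval f)) _.
have -> : kval f = pcomp p (kval f) by rewrite -[LHS](kval_l f).
by rewrite (perm_compA F_her muP) ec.
Qed.

Lemma perm_end_one : bijective (fun a : k => a *: perm_id k one).
Proof.
exists (fun f => ev f (pone empty_perm) (pone empty_perm)) => [a|f].
  by rewrite evZ (ev_id k F_her) // eqxx mulr1.
exact/esym/(one_scalar F_her).
Qed.

Lemma kar_end_one : bijective (fun a : k => a *: idm (Defs.one : ob (kar C))).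
Proof.
have [g gK Kg] := perm_end_one.
exists (fun f : mor (Defs.one : ob (kar C)) Defs.one => g (kval f)) => [a|f]; first exact: gK.
by apply: kar_val_inj; exact: Kg.
Qed.
End PermRigid.

(** * The support of a measure *)

Lemma scalar_is_measure (K : fieldType) (F : permutation -> Prop) (mu : emb_function int) :
  is_measure F mu -> is_measure F (scalar_measure K mu).
Proof.
move=> [m_iso m_comp m_amalg]; rewrite /scalar_measure; split.
- by move=> X Y i FX FY bi; rewrite (m_iso _ _ _ FX FY bi).
- by move=> X Y Z j i FX FY FZ; rewrite (m_comp _ _ _ _ _ FX FY FZ) rmorphM.
by move=> Y X Y' i j FY FX FY'; rewrite (m_amalg _ _ _ i j FY FX FY') rmorph_sum.
Qed.

Section Support.
Variables (mu : emb_function int) (hmu : is_measure all_perms mu).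
Local Notation F' := (measure_support mu).

Lemma mu_emb_empty X Y (h : embedding X Y) :
  mu (emb_empty Y) = mu h * mu (emb_empty X).
Proof.
rewrite (emb_empty_unique (emb_empty Y) (comp_emb h (emb_empty X))).
exact: (measure_comp hmu).
Qed.

Lemma support_hereditary : hereditary F'.
Proof.
move=> X Y h; rewrite /measure_support (mu_emb_empty h).
by apply: contraNneq => ->; rewrite mulr0.
Qed.

Lemma measure_out_of_support X Y (h : embedding X Y) : F' X -> ~ F' Y -> mu h = 0.
Proof.
move=> FX FY; apply/eqP; apply: contrapT => h0; apply: FY.
by rewrite /measure_support (mu_emb_empty h) mulf_neq0 //; exact/negP.
Qed.

Lemma all_hereditary : hereditary all_perms.
Proof. by []. Qed.

(** The amalgamations lost on restriction leave the support, so by multiplicativity their terms in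
    axiom (iii) vanish. *)
Lemma support_measure : is_measure F' mu.
Proof.
split=> [X Y i _ _|X Y Z j i _ _ _|Y X Y' i j FY FX FY'].
- exact: (measure_iso hmu).
- exact: (measure_comp hmu).
rewrite (measure_amalg hmu i j) // (bigID (fun A => `[< F' (amalg_perm A) >])) /=.
rewrite [X in _ + X]big1 => [|A /asboolPn nA]; last exact: measure_out_of_support.
by rewrite addr0 (@sum_amalg_sub _ all_perms F' _ _ _ i j (fun V h => mu h)).
Qed.

Section Field.
Variable k : fieldType.
Let muk := scalar_measure k mu.

(** A nonzero value is [1] or [-1] as an integer, so it stays nonzero in every characteristic. *)
Lemma support_regular X : F' X -> muk (emb_empty X) != 0.
Proof.
rewrite /measure_support /muk /scalar_measure.
case: (mu_empty_small hmu X) => -> // _; first by rewrite mulr1z oner_eq0.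
by rewrite mulrN1z oppr_eq0 oner_eq0.
Qed.

Let muP' : is_measure F' muk := scalar_is_measure k support_measure.
Let F0' := support_empty hmu.
Let C' : smc k := Smc (perm_laws F0' support_hereditary muP').
Implicit Types s t : perm_ob F'.

Lemma support_nilp_trace s (f : perm_hom k s s) : nilp mu f -> itr muk f = 0.
Proof.
apply: (nilp_trace F0' support_hereditary) => [K|X].
  exact: scalar_is_measure support_measure.
by [].
Qed.

Lemma support_nondegenerate s t (f : perm_hom k s t) :
  (forall g, itr muk (perm_comp muk g f) = 0) -> f = 0.
Proof.
move=> H; apply/ffunP => c; rewrite ffunE.
have /eqP := H (transpose (delta_hom k c)).
rewrite (itr_delta F0' support_hereditary muP') mulf_eq0.
by rewrite (negbTE (support_regular (am_mem c))) => /eqP.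
Qed.

Lemma support_von_neumann (X Y : ob C') (f : mor X Y) : exists g : mor Y X, f ∘ g ∘ f = f.
Proof.
apply: (@von_neumann_regular k C' _ (fun X f => itr muk f)) => {X Y f}.
- exact: perm_finite_dim.
- by move=> X a n a0; apply: support_nilp_trace; exists n.
exact: support_nondegenerate.
Qed.

Theorem support_semisimple_pre_tannakian : pre_tannakian (kar C') /\ semisimple (kar C').
Proof.
have fd (X Y : ob (kar C')) : finite_dim (mor X Y).
  by apply: kar_finite_dim; apply: perm_finite_dim.
have vN (X Y : ob (kar C')) (f : mor X Y) : exists g : mor Y X, f ∘ g ∘ f = f.
  by apply: kar_von_neumann; apply: support_von_neumann.
have sp (X : ob (kar C')) (e : mor X X) : e ∘ e = e ->
  exists (Y : ob (kar C')) (i : mor Y X) (p : mor X Y), p ∘ i = idm Y /\ i ∘ p = e.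
  exact: kar_split.
have ds n (S : 'I_n -> ob (kar C')) : exists X, is_direct_sum S X.
  apply: kar_direct_sums => m T; exists (perm_sum T); exact: perm_sumP.
split; last exact: regular_semisimple.
split=> //.
- exact: kar_laws.
- exact: regular_abelian.
- exact: regular_finite_length.
- exact: kar_perm_rigid.
exact: kar_end_one.
Qed.
End Field.
End Support.

(** * Restriction to the support *)

Section IntegralRestriction.
Variables (R : comPzRingType) (F F' : permutation -> Prop) (mu : emb_function R).
Hypotheses (F_her : hereditary F) (F_her' : hereditary F').
Hypotheses (sub : forall V, F' V -> F V) (muP : is_measure F mu).
Variables (T T' : species) (alpha : forall V, T' V -> T V).
Hypothesis alpha_map : forall V V' (g : embedding V V') x,
  alpha (smap g x) = smap g (alpha x).
Hypothesis alpha_inj : forall V, injective (@alpha V).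
Hypothesis alpha_supp : forall V (x : T' V), supp (alpha x) = supp x.
Hypothesis alpha_surj : forall V (x : T V), F' V -> exists x', alpha x' = x.

(** The cells that leave [F'] have measure zero by [out]; the others are matched with the cells of
    [T'] through [alpha]. *)
Lemma integ_restrict W (phi : family R W T) : F' W ->
  (forall V (e : embedding W V), ~ F' V -> mu e = 0) -> natural F phi ->
  integ F mu phi = integ F' mu (fun V e x => phi V e (alpha x)).
Proof.
move=> FW out nphi; rewrite /integ (bigID (fun c => `[< F' (cell_perm c) >])) /=.
rewrite [X in _ + X]big1 ?addr0; last first.
  by move=> c /andP[_ /asboolPn nc]; rewrite out ?mul0r.
have inv V V' (g : embedding V V') (e : embedding W V) (x : T V) :
    gen (comp_emb g e) (smap g x) -> exists g' : embedding V' V,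
    [/\ comp_emb g g' = id_emb V', comp_emb g' g = id_emb V & forall v, exists u, g u = v].
  move=> /gen_map gs; have [g' [gg' g'g]] := emb_surj_inv gs.
  by exists g'.
pose rel (c : cell W T) (c' : cell W T') :=
  [exists g : embedding (cell_perm c') (cell_perm c),
    (comp_emb g (cell_l c') == cell_l c) && (smap g (alpha (cell_r c')) == cell_r c)].
have relP c c' : rel c c' -> exists g : embedding (cell_perm c') (cell_perm c),
    comp_emb g (cell_l c') = cell_l c /\ smap g (alpha (cell_r c')) = cell_r c.
  by case/existsP => g /andP[/eqP gl /eqP gr]; exists g.
apply: (sum_match (rel := rel)).
- move=> c /andP[/good_gen gc /asboolP Fc].
  have [x' x'E] := alpha_surj (cell_r c) Fc.
  have [c' [gc' [g [gl gr]]]] := cell_complete F_her' (cell_l c) x' Fc.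
  exists c'; split=> //; apply/existsP; exists g.
  by rewrite gl eqxx -alpha_map gr x'E eqxx.
- move=> c' gc'; have Fc' := good_mem gc'.
  have [c [gc [g [gl gr]]]] := cell_complete F_her (cell_l c') (alpha (cell_r c')) (sub Fc').
  have [|g' [gg' g'g _]] := @inv _ _ g (cell_l c) (cell_r c).
    by rewrite gl gr => v; rewrite alpha_supp; exact: good_gen gc' v.
  exists c; rewrite gc /=; split; first by apply/asboolP; exact: F_her' g Fc'.
  apply/existsP; exists g'; rewrite -gl -gr -smap_comp comp_embA g'g comp_id_emb.
  by rewrite smap_id !eqxx.
- move=> c c' c'' /andP[/good_gen gc _] gc' gc'' /relP[g1 [l1 r1]] /relP[g2 [l2 r2]].
  have [|g' [gg' g'g _]] := @inv _ _ g2 (cell_l c'') (alpha (cell_r c'')).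
    by rewrite l2 r2.
  apply: (cell_rigid (g := comp_emb g' g1) gc'').
    by rewrite -comp_embA l1 -l2 comp_embA g'g comp_id_emb.
  apply: alpha_inj; rewrite alpha_map smap_comp r1 -r2 -smap_comp g'g.
  exact: smap_id.
- move=> c1 c2 c' /andP[/good_gen gc1 _] /andP[gc2 _] _ /relP[g1 [l1 r1]] /relP[g2 [l2 r2]].
  have [|g' [gg' g'g _]] := @inv _ _ g1 (cell_l c') (alpha (cell_r c')).
    by rewrite l1 r1.
  apply: (cell_rigid (g := comp_emb g2 g') gc2).
    by rewrite -l1 -comp_embA (comp_embA g') g'g comp_id_emb.
  by rewrite -r1 smap_comp -(smap_comp g') g'g smap_id.
move=> c c' /andP[gc _] gc' /relP[g [gl gr]].
have Fc := good_mem gc; have Fc' := sub (good_mem gc').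
rewrite -gl -gr nphi //; congr (_ * _); apply: (measure_surj muP) => //.
  exact: sub.
by apply: (@gen_map _ _ _ _ g (cell_l c') (alpha (cell_r c'))); rewrite gl gr; exact: good_gen gc.
Qed.
End IntegralRestriction.

(** * Calculus of graphs of maps of points *)

Section DeltaCalculus.
Variables (k : fieldType) (F : permutation -> Prop) (mu : emb_function k).
Hypotheses (F_her : hereditary F) (muP : is_measure F mu).
Implicit Types s t u : perm_ob F.

Lemma delta_comp s t u (g : perm_hom k t u) (f : perm_hom k s t) a b :
  is_delta f a -> is_delta g b ->
  is_delta (perm_comp mu g f) (fun V FV x => b V FV (a V FV x)).
Proof. by move=> fa gb V FV x y; rewrite (delta_compl F_her muP _ fa FV) (gb V FV). Qed.

Lemma delta_tens s t s' t' (f : perm_hom k s t) (g : perm_hom k s' t') a b :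
  is_delta f a -> is_delta g b ->
  is_delta (perm_tensm f g)
    (fun V FV x => tpair F_her FV (a V FV (tp1 x)) (b V FV (tp2 x))).
Proof.
move=> fa gb V FV x y; rewrite (ev_tensm F_her _ _ _ _ FV) (fa V FV) (gb V FV) natbM.
by rewrite [in RHS]tp_eq tp1_pair tp2_pair.
Qed.

Lemma delta_eq s t (f g : perm_hom k s t) a b : is_delta f a -> is_delta g b ->
  (forall V (FV : F V) x, a V FV x = b V FV x) -> f = g.
Proof. by move=> fa gb ab; apply: ev_ext => V x y FV; rewrite (fa V FV) (gb V FV) ab. Qed.
End DeltaCalculus.

(** For each [Y] an object [G0 Y] and an isomorphism [u Y] are chosen; morphisms are conjugated by
    [u] and pulled back along the fully faithful functor. *)
Lemma fully_faithful_quasi_inverse (k : fieldType) (C D : smc_data k) (Fn : functor C D) :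
  smc_laws D ->
  (forall (X Y : ob C) (f g : mor X Y), fmap Fn f = fmap Fn g -> f = g) ->
  (forall (X Y : ob C) (g : mor (Fn X) (Fn Y)), exists f : mor X Y, fmap Fn f = g) ->
  (forall Y : ob D, exists (X : ob C) (u : mor (Fn X) Y), is_iso u) ->
  exists G : functor D C, quasi_inverse Fn G.
Proof.
move=> LD faith full /choice[G0 G0P].
pose u Y : mor (Fn (G0 Y)) Y := sval (cid (G0P Y)).
have u_iso Y : is_iso (u Y) := svalP (cid (G0P Y)).
pose v Y : mor Y (Fn (G0 Y)) := sval (cid (u_iso Y)).
have vu Y : v Y ∘ u Y = idm _ by case: (svalP (cid (u_iso Y))).
have uv Y : u Y ∘ v Y = idm _ by case: (svalP (cid (u_iso Y))).
pose pre (X Y : ob C) (g : mor (Fn X) (Fn Y)) : mor X Y := sval (cid (full X Y g)).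
have preK (X Y : ob C) (g : mor (Fn X) (Fn Y)) : fmap Fn (pre X Y g) = g.
  exact: svalP (cid (full X Y g)).
pose G1 (Y Y' : ob D) (g : mor Y Y') := pre _ _ (v Y' ∘ g ∘ u Y).
have G11 Y : G1 _ _ (idm Y) = idm (G0 Y).
  by apply: faith; rewrite preK fmap1 (compm1 LD) vu.
have G1M (X Y Z : ob D) (g : mor Y Z) (f : mor X Y) : G1 _ _ (g ∘ f) = G1 _ _ g ∘ G1 _ _ f.
  apply: faith; rewrite fmap_comp !preK -!(compA LD) (compA LD (u Y)) uv.
  by rewrite (comp1m LD).
exists (Functor G11 G1M); split.
  exists (fun X => pre _ _ (u (Fn X))); split=> [X|X Y f].
    exists (pre _ _ (v (Fn X))); split; apply: faith; rewrite fmap_comp !preK fmap1.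
      exact: vu.
    exact: uv.
  apply: faith; rewrite !fmap_comp !preK -!(compA LD) (compA LD (u _)) uv.
  by rewrite (comp1m LD).
exists u; split=> // X Y f; rewrite preK -!(compA LD) (compA LD (u _)) uv.
by rewrite (comp1m LD).
Qed.

(** * The restriction functor and its kernel *)

Section Restriction.
Variables (mu : emb_function int) (hmu : is_measure all_perms mu) (k : fieldType).
Local Notation F := all_perms.
Local Notation F' := (measure_support mu).
Let muk := scalar_measure k mu.
Let F0' : F' empty_perm := support_empty hmu.
Let her : hereditary F := all_hereditary.
Let her' : hereditary F' := support_hereditary hmu.
Let muP : is_measure F muk := scalar_is_measure k hmu.
Let muP' : is_measure F' muk := scalar_is_measure k (support_measure hmu).
Let C : smc k := Smc (perm_laws (F := F) I her muP).
Let C' : smc k := Smc (perm_laws F0' her' muP').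
Local Notation pcomp := (perm_comp muk).
Implicit Types s t u : perm_ob F.

Definition res_ob s : perm_ob F' :=
  @PermOb F' {i : summand s | `[< F' (s i) >]} (fun i => s (val i))
    (fun i => asboolW (valP i)).

Definition res_in s V (x : pts (res_ob s) V) : pts s V :=
  @pt F s (val (tag x)) V (tagged x).

Lemma res_in_map s V V' (g : embedding V V') (x : pts (res_ob s) V) :
  res_in (smap g x) = smap g (res_in x).
Proof. by []. Qed.

Lemma res_in_inj s V : injective (@res_in s V).
Proof.
case=> i x [j y] E; have ij : i = j by apply: val_inj; exact: (congr1 tag E).
by subst j; rewrite (@pt_inj F s (val i) V x y E).
Qed.

Lemma res_in_supp s V (x : pts (res_ob s) V) : supp (res_in x) = supp x.
Proof. by []. Qed.

(** A summand that embeds in a member of the support lies in the support by heredity, so over [F']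
    restriction loses no point. *)
Lemma res_in_surj s V (x : pts s V) : F' V -> exists x', res_in x' = x.
Proof.
case: x => i x FV; have Fi : `[< F' (s i) >] by apply/asboolP; exact: her' x FV.
by exists (@pt F' (res_ob s) (exist _ i Fi) V x).
Qed.

Definition res_pt s V (FV : F' V) (x : pts s V) : pts (res_ob s) V :=
  sval (cid (res_in_surj x FV)).

Lemma res_ptK s V (FV : F' V) (x : pts s V) : res_in (res_pt FV x) = x.
Proof. by rewrite /res_pt; case: (cid _). Qed.

Definition res s t (f : perm_hom k s t) : perm_hom k (res_ob s) (res_ob t) :=
  of_kernel (fun V x y => ev f (res_in x) (res_in y)).

Lemma ev_res s t (f : perm_hom k s t) V (x : pts (res_ob s) V) y : F' V ->
  ev (res f) x y = ev f (res_in x) (res_in y).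
Proof.
move=> FV; rewrite (ev_of_kernel her') // => V1 V2 g a b _.
by rewrite !res_in_map ev_map.
Qed.

#[local] Opaque res.

(** Dropping summands need not respect composition in general; here the dropped middle points have
    measure zero over any structure in the support. *)
Lemma res_comp s t u (g : perm_hom k t u) (f : perm_hom k s t) :
  res (pcomp g f) = pcomp (res g) (res f).
Proof.
apply: ev_ext => V x z FV; rewrite ev_res // (ev_comp her muP) // (ev_comp her' muP') //.
rewrite (integ_restrict her her' _ muP (@res_in_map t) (@res_in_inj t)
  (@res_in_supp t) (@res_in_surj t) FV) //; last 2 first.
- by move=> V' e nF; rewrite /muk /scalar_measure (measure_out_of_support hmu).
- exact: comp_kernel_natural.
apply: eq_integ => V' e y FV'.
by rewrite /comp_kernel !ev_res // !res_in_map.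
Qed.

Lemma res_id s : res (perm_id k s) = perm_id k (res_ob s).
Proof.
apply: ev_ext => V x y FV; rewrite (ev_res _ x y FV).
by rewrite (ev_id k her (res_in x) (res_in y) I) (ev_id k her' x y FV) (inj_eq (@res_in_inj s V)).
Qed.

Lemma res_linear s t : linear (@res s t).
Proof.
move=> a f g; apply: ev_ext => V x y FV.
by rewrite (ev_res _ x y FV) !evD !evZ (ev_res f x y FV) (ev_res g x y FV).
Qed.

Lemma res0 s t : res (0 : perm_hom k s t) = 0.
Proof. by apply: ev_ext => V x y FV; rewrite (ev_res _ x y FV) !ev0. Qed.

Lemma itr_res s (f : perm_hom k s s) : itr muk f = itr muk (res f).
Proof.
rewrite /itr (integ_restrict her her' _ muP (@res_in_map s) (@res_in_inj s)
  (@res_in_supp s) (@res_in_surj s) F0') //; last 2 first.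
- by move=> V' e nF; rewrite /muk /scalar_measure (measure_out_of_support hmu).
- by move=> V V' g e x _; rewrite ev_map.
by apply: eq_integ => V e x FV; rewrite ev_res.
Qed.

Lemma res_kpow s (f : perm_hom k s s) n : res (kpow muk f n) = kpow muk (res f) n.
Proof.
elim: n => [|n IH]; first exact: res_id.
have S v (h : perm_hom k v v) : kpow muk h n.+1 = pcomp h (kpow muk h n) by [].
by rewrite S res_comp IH.
Qed.

Lemma nilpotent_trace s (f : perm_hom k s s) n : kpow muk f n = 0 -> itr muk f = 0.
Proof.
move=> fn; rewrite itr_res; apply: support_nilp_trace => //.
by exists n; rewrite -[kpow _ _ _]res_kpow fn res0.
Qed.

(* Extension by zero: [res] is full. *)
Definition ext_hom s t (g : perm_hom k (res_ob s) (res_ob t)) : perm_hom k s t :=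
  [ffun c => if pselect (F' (am_ob c)) is left Fc
     then ev g (res_pt Fc (lp c)) (res_pt Fc (rp c)) else 0].

Lemma ext_homK s t (g : perm_hom k (res_ob s) (res_ob t)) : res (ext_hom g) = g.
Proof.
apply: ev_ext => V x y FV; rewrite ev_res //.
have [c [h [hx hy]]] := amalgs_complete her (res_in x) (res_in y) (I : F V).
rewrite -hx -hy ev_map_am ffunE; case: pselect => [Fc|[]]; last exact: her' h FV.
rewrite -(ev_map g h); congr (ev g _ _); apply: res_in_inj.
  by rewrite res_in_map res_ptK.
by rewrite res_in_map res_ptK.
Qed.

(** Traces are computed on the support, where the pairing is perfect, and [ext_hom] lifts every test
    morphism from there. *)
Lemma res_eq0P s t (f : perm_hom k s t) :
  (forall g, itr muk (pcomp f g) = 0) <-> res f = 0.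
Proof.
split=> [H|f0 g].
  apply: (support_nondegenerate hmu) => g'.
  by rewrite -(ext_homK g') -res_comp -itr_res (itrC I her muP) H.
rewrite itr_res res_comp f0.
have -> : pcomp 0 (res g) = 0 := @comp0m k C' _ _ _ (res g).
rewrite /itr -[RHS](integ0 F' muk empty_perm (pts (res_ob t))).
by apply: eq_integ => V e x FV; rewrite ev0.
Qed.

Lemma kar_trace_eq0 (R : rigid (kar C)) (P : ob (kar C)) (f : mor P P) :
  tr R f = 0 <-> itr muk (kval f) = 0.
Proof.
have E := kar_perm_trace R f; split=> [f0|f0].
  have := congr1 (@kval _ _ _ _) f0; rewrite E => /eqP.
  rewrite scaler_eq0 => /orP[/eqP//|/eqP id0].
  have := congr1 (fun h => ev h (pt1 (F := F) I empty_perm) (pt1 (F := F) I empty_perm)) id0.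
  by rewrite ev0 (ev_id k her) // eqxx => /eqP; rewrite oner_eq0.
by apply: kar_val_inj; rewrite E f0 scale0r.
Qed.

(** In the completion the test morphisms are only those of the form [p g q]. As [x = q x p],
    cyclicity of the trace shows that they detect as much as all [g]. *)
Lemma res_negligible (R : rigid (kar C)) (P Q : ob (kar C)) (x : mor P Q) :
  negligible R x <-> res (kval x) = 0.
Proof.
split=> [neg|/res_eq0P H g]; last by apply/kar_trace_eq0; exact: H.
apply/res_eq0P => g.
pose p : perm_hom k (kob P) (kob P) := kidem P.
pose q : perm_hom k (kob Q) (kob Q) := kidem Q.
have xp : pcomp (kval x) p = kval x := kval_r x.
have qx : pcomp q (kval x) = kval x := kval_l x.
have : itr muk (pcomp (kval x) (pcomp (pcomp p g) q)) = 0.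
  exact: (kar_trace_eq0 R _).1 (neg (@kar_res k C Q P g)).
rewrite -(perm_compA her muP p) (perm_compA her muP _ p) xp (perm_compA her muP).
by rewrite (itrC I her muP) (perm_compA her muP) qx.
Qed.

Definition ten_to s t V (FV : F' V) (x : pts (perm_tens (res_ob s) (res_ob t)) V) :
    pts (res_ob (perm_tens s t)) V :=
  res_pt FV (tpair her I (res_in (tp1 x)) (res_in (tp2 x))).

Definition ten_from s t V (FV : F' V) (z : pts (res_ob (perm_tens s t)) V) :
    pts (perm_tens (res_ob s) (res_ob t)) V :=
  tpair her' FV (res_pt FV (tp1 (res_in z))) (res_pt FV (tp2 (res_in z))).

(** Restricting a tensor product and tensoring restrictions give families of amalgamations over
    different index types; this graph identifies equal pairs of points. *)
Definition res_tens s t :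
    perm_hom k (perm_tens (res_ob s) (res_ob t)) (res_ob (perm_tens s t)) :=
  of_kernel (fun V (x : pts (perm_tens (res_ob s) (res_ob t)) V)
      (z : pts (res_ob (perm_tens s t)) V) =>
    ((res_in (tp1 x) == tp1 (res_in z)) && (res_in (tp2 x) == tp2 (res_in z)))%:R).

Lemma ev_res_tens s t V (x : pts (perm_tens (res_ob s) (res_ob t)) V)
    (z : pts (res_ob (perm_tens s t)) V) : F' V -> ev (res_tens s t) x z =
  ((res_in (tp1 x) == tp1 (res_in z)) && (res_in (tp2 x) == tp2 (res_in z)))%:R.
Proof.
move=> FV; rewrite (ev_of_kernel her' _ _ _ FV) // => V1 V2 g a b _.
by rewrite !tp1_map !tp2_map !res_in_map !tp1_map !tp2_map !smap_eq.
Qed.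

Lemma res_tens_delta s t : is_delta (res_tens s t) (@ten_to s t).
Proof.
move=> V FV x z; rewrite (ev_res_tens _ _ FV) /ten_to -(inj_eq (@res_in_inj _ V)) res_ptK.
by rewrite [in RHS]tp_eq tp1_pair tp2_pair.
Qed.

Lemma res_tens_codelta s t : is_codelta (res_tens s t) (@ten_from s t).
Proof.
move=> V FV x z; rewrite (ev_res_tens _ _ FV) /ten_from [in RHS]tp_eq tp1_pair tp2_pair.
rewrite -(inj_eq (@res_in_inj s V)) -(inj_eq (@res_in_inj t V)) !res_ptK.
by congr (nat_of_bool (_ && _))%:R; exact: eq_sym.
Qed.

Lemma res_delta s t (f : perm_hom k s t) a : is_delta f a ->
  is_delta (res f) (fun V FV x => res_pt FV (a V I (res_in x))).
Proof.
move=> fa V FV x y; rewrite (ev_res _ x y FV) (fa V I).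
by rewrite -(inj_eq (@res_in_inj t V)) res_ptK.
Qed.

Lemma res_tens_nat s t s' t' (f : perm_hom k s s') (g : perm_hom k t t') :
  pcomp (res_tens s' t') (perm_tensm (res f) (res g)) =
  pcomp (res (perm_tensm f g)) (res_tens s t).
Proof.
apply: ev_ext => V x z FV.
rewrite (codelta_compr her' muP' _ (@res_tens_codelta s' t') FV).
rewrite (delta_compl her' muP' _ (@res_tens_delta s t) FV).
rewrite (ev_tensm her' _ _ _ _ FV) !(ev_res _ _ _ FV) (ev_tensm her _ _ _ _ I).
by rewrite /ten_to /ten_from !tp1_pair !tp2_pair !res_ptK !tp1_pair !tp2_pair.
Qed.

Lemma res_tens_assoc s t u :
  pcomp (pcomp (res (perm_assoc k s t u)) (res_tens (perm_tens s t) u))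
    (perm_tensm (res_tens s t) (perm_id k (res_ob u))) =
  pcomp (pcomp (res_tens s (perm_tens t u)) (perm_tensm (perm_id k (res_ob s)) (res_tens t u)))
    (perm_assoc k (res_ob s) (res_ob t) (res_ob u)).
Proof.
apply: (delta_eq
  (delta_comp her' muP'
    (delta_tens her' (@res_tens_delta s t) (@id_delta k F' her' (res_ob u)))
    (delta_comp her' muP' (@res_tens_delta (perm_tens s t) u)
       (res_delta (@assoc_delta k F her s t u))))
  (delta_comp her' muP' (@assoc_delta k F' her' (res_ob s) (res_ob t) (res_ob u))
    (delta_comp her' muP'
       (delta_tens her' (@id_delta k F' her' (res_ob s)) (@res_tens_delta t u))
       (@res_tens_delta s (perm_tens t u))))) => V FV x.
rewrite /ten_to /assoc_pt; congr (res_pt FV _).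
by rewrite !res_ptK !(tp1_pair, tp2_pair) !res_ptK !(tp1_pair, tp2_pair).
Qed.

Lemma res_tens_braid s t :
  pcomp (res (perm_braid k s t)) (res_tens s t) =
  pcomp (res_tens t s) (perm_braid k (res_ob s) (res_ob t)).
Proof.
apply: (delta_eq
  (delta_comp her' muP' (@res_tens_delta s t) (res_delta (@braid_delta k F her s t)))
  (delta_comp her' muP' (@braid_delta k F' her' (res_ob s) (res_ob t)) (@res_tens_delta t s)))
  => V FV x.
rewrite /ten_to /braid_pt; congr (res_pt FV _).
by rewrite !res_ptK !(tp1_pair, tp2_pair).
Qed.

Definition res_one : perm_hom k (perm_one F0') (res_ob (perm_one (F := F) I)) :=
  of_kernel (fun V _ _ => 1).

Lemma res_one_pt V (FV : F' V) (x : pts (res_ob (perm_one (F := F) I)) V) :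
  x = res_pt FV (pt1 (F := F) I V).
Proof. by apply: res_in_inj; rewrite res_ptK; exact: pt1_eq. Qed.

Lemma res_one_delta : is_delta res_one (fun V FV _ => res_pt FV (pt1 (F := F) I V)).
Proof.
move=> V FV x y; rewrite (ev_of_kernel her' _ _ _ FV) //.
by rewrite [y](res_one_pt FV) eqxx.
Qed.

Lemma res_one_codelta : is_codelta res_one (fun V FV _ => pt1 F0' V).
Proof.
move=> V FV x y; rewrite (ev_of_kernel her' _ _ _ FV) //.
by rewrite [x]pt1_eq eqxx.
Qed.

Lemma res_tens_lunit s :
  pcomp (pcomp (res (perm_lunit k (F := F) I s)) (res_tens (perm_one (F := F) I) s))
    (perm_tensm res_one (perm_id k (res_ob s))) = perm_lunit k F0' (res_ob s).
Proof.
apply: (delta_eq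
  (delta_comp her' muP'
    (delta_tens her' res_one_delta (@id_delta k F' her' (res_ob s)))
    (delta_comp her' muP' (@res_tens_delta (perm_one (F := F) I) s)
       (res_delta (@lunit_delta k F I her s))))
  (@lunit_delta k F' F0' her' (res_ob s))) => V FV x.
rewrite /ten_to /lunit_pt; apply: res_in_inj.
by rewrite !res_ptK !(tp1_pair, tp2_pair).
Qed.

Lemma res_tens_runit s :
  pcomp (pcomp (res (perm_runit k (F := F) I s)) (res_tens s (perm_one (F := F) I)))
    (perm_tensm (perm_id k (res_ob s)) res_one) = perm_runit k F0' (res_ob s).
Proof.
apply: (delta_eq
  (delta_comp her' muP'
    (delta_tens her' (@id_delta k F' her' (res_ob s)) res_one_delta)
    (delta_comp her' muP' (@res_tens_delta s (perm_one (F := F) I))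
       (res_delta (@runit_delta k F I her s))))
  (@runit_delta k F' F0' her' (res_ob s))) => V FV x.
rewrite /ten_to /runit_pt; apply: res_in_inj.
by rewrite !res_ptK !(tp1_pair, tp2_pair).
Qed.

Lemma kres_ob_subproof (P : ob (kar C)) :
  (res (kidem P) : mor (res_ob (kob P) : ob C') _) ∘ res (kidem P) = res (kidem P).
Proof. by rewrite -[LHS](res_comp (kidem P) (kidem P)); congr res; exact: (kidemP P). Qed.

Definition kres_ob (P : ob (kar C)) : ob (kar C') := KarOb (kres_ob_subproof P).

Lemma kres_subproof (P Q : ob (kar C)) (x : mor P Q) :
  kar_pred (C := C') (P := kres_ob P) (Q := kres_ob Q) (res (kval x)).
Proof.
apply/eqP.
transitivity (res (pcomp (pcomp (kidem Q) (kval x)) (kidem P))); first by rewrite !res_comp.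
by congr res; exact: (eqP (kvalP x)).
Qed.

Definition kres (P Q : ob (kar C)) (x : mor P Q) : mor (kres_ob P) (kres_ob Q) :=
  KarHom (kres_subproof x).

Lemma kres_res (P Q : ob (kar C)) (n : perm_hom k (kob P) (kob Q)) :
  kres (@kar_res k C P Q n) = @kar_res k C' (kres_ob P) (kres_ob Q) (res n).
Proof.
apply: kar_val_inj.
change (res (pcomp (pcomp (kidem Q) n) (kidem P)) =
  pcomp (pcomp (res (kidem Q)) (res n)) (res (kidem P))).
by rewrite !res_comp.
Qed.

(** * The functor out of the semi-simplification *)

Section Functor.
Variable R : rigid (kar C).
Local Notation SS := (semisimplification R).

(** The chosen representative differs from [f] by a negligible morphism, which restriction kills; so
    the functor may be computed on any representative. *)
Lemma kres_repr (P Q : ob (kar C)) (f : mor P Q) : kres (ss_repr (ss_pi R f)) = kres f.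
Proof.
apply: kar_val_inj; have /res_negligible := ss_repr_pi R f.
move=> E; apply/eqP; rewrite -subr_eq0; apply/eqP; rewrite -[RHS]E.
change (res (kval (ss_repr (ss_pi R f))) - res (kval f) =
  res (kval (ss_repr (ss_pi R f)) - kval f)).
have := res_linear (-1) (kval f) (kval (ss_repr (ss_pi R f))).
by rewrite !scaleN1r addrC => <-; rewrite addrC.
Qed.

Definition ss_fmap (P Q : ob SS) (x : mor P Q) : mor (kres_ob P) (kres_ob Q) :=
  kres (ss_repr x).

Lemma ss_fmap1 (P : ob SS) : ss_fmap (idm P) = idm (kres_ob P).
Proof. by apply: etrans (kres_repr _) _; apply: kar_val_inj. Qed.

Lemma ss_fmap_comp (P Q T : ob SS) (g : mor Q T) (f : mor P Q) :
  ss_fmap (g ∘ f) = ss_fmap g ∘ ss_fmap f.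
Proof.
apply: etrans (kres_repr _) _; apply: kar_val_inj.
exact: (res_comp (kval (ss_repr g)) (kval (ss_repr f))).
Qed.

Definition ss_functor : functor SS (kar C') := Functor ss_fmap1 ss_fmap_comp.

Lemma ss_functor_linear : linear_functor ss_functor.
Proof.
move=> P Q a x y; rewrite -[x](ss_reprK (rC := R)) -[y](ss_reprK (rC := R)).
transitivity (ss_fmap (ss_pi R (a *: ss_repr x + ss_repr y))).
  congr ss_fmap; rewrite -ss_piD -ss_piZ.
  by rewrite !ss_reprK.
rewrite /= /ss_fmap !kres_repr; apply: kar_val_inj.
exact: (res_linear a (kval (ss_repr x)) (kval (ss_repr y))).
Qed.

Lemma ss_functor_faithful (P Q : ob SS) (x y : mor P Q) :
  fmap ss_functor x = fmap ss_functor y -> x = y.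
Proof.
move=> /(congr1 (@kval _ _ _ _)) E.
change (res (kval (ss_repr x)) = res (kval (ss_repr y))) in E.
rewrite -[x](ss_reprK (rC := R)) -[y](ss_reprK (rC := R)); apply/ss_piP/res_negligible.
change (res (kval (ss_repr x) - kval (ss_repr y)) = 0).
have := res_linear (-1) (kval (ss_repr y)) (kval (ss_repr x)).
by rewrite E !scaleN1r addNr addrC.
Qed.

Lemma ss_functor_full (P Q : ob SS) (g : mor (ss_functor P) (ss_functor Q)) :
  exists x : mor P Q, fmap ss_functor x = g.
Proof.
exists (ss_pi R (@kar_res k C P Q (ext_hom (kval g)))).
apply: etrans (kres_repr _) _; rewrite kres_res ext_homK.
by apply: kar_val_inj; exact: (eqP (kvalP g)).
Qed.

(* Idempotents lift along [res]: apply Fitting's lemma to any lift. *)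
Lemma ss_functor_surj (Y : ob (kar C')) :
  exists (P : ob SS) (u : mor (ss_functor P) Y), is_iso u.
Proof.
pose t : perm_ob F' := kob Y; pose p : perm_hom k t t := kidem Y.
have pp : pcomp p p = p := kidemP Y.
(* [t] is read as an object over all permutations. Restricting it back gives an object whose
   summands are indexed by a subtype, isomorphic to [t] through [j]. *)
pose s : perm_ob F := @PermOb F (summand t) t (fun _ => I).
pose up V (x : pts t V) : pts s V := @pt F s (tag x) V (tagged x).
have up_inj V : injective (@up V).
  by case=> i x [j y] E; have ij : i = j := congr1 tag E; subst j;
    rewrite (@pt_inj F s i V x y E).
have up_surj V (x : pts s V) : exists y, up V y = x.
  by exists (@pt F' t (tag x) V (tagged x)); case: x.
pose j : perm_hom k (res_ob s) t := of_kernel (fun V x y => (res_in x == up V y)%:R).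
have evj V x y : F' V -> ev j x y = (res_in x == up V y)%:R.
  move=> FV; rewrite (ev_of_kernel her' _ _ _ FV) // => V1 V2 g a b _.
  by rewrite -[up V2 _]/(smap g (up V1 b)) res_in_map smap_eq.
pose dn V (x : pts s V) : pts t V := sval (cid (up_surj V x)).
have upK V x : up V (dn V x) = x by exact: (svalP (cid (up_surj V x))).
have jd : is_delta j (fun V _ x => dn V (res_in x)).
  by move=> V FV x y; rewrite evj // -(inj_eq (up_inj V)) upK.
have jc : is_codelta j (fun V FV y => res_pt FV (up V y)).
  by move=> V FV x y; rewrite evj // -(inj_eq (@res_in_inj s V)) res_ptK eq_sym.
have [j1 j2] := delta_inverse her' muP' jd jc; set j' := transpose j in j1 j2.
pose p2 := pcomp (pcomp j' p) j.
have p2p2 : pcomp p2 p2 = p2.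
  rewrite /p2 -!(perm_compA her' muP') (perm_compA her' muP' j) j2.
  by rewrite (perm_comp1m her' muP') (perm_compA her' muP' p) pp.
have [n [e [b [ee _ eb en]]]] := @fitting k C (@perm_finite_dim k F) s (ext_hom p2).
(* [e] factors through the lift and fixes a power of it. As [p2] is idempotent, restricting these
   two facts gives [res e ∘ p2 = res e] and [res e ∘ p2 = p2]. *)
have re : res e = p2.
  have ebr : res e = pcomp (res b) p2 by rewrite {1}eb [res _]res_comp ext_homK.
  have pw2 m : pcomp p2 (kpow muk p2 m) = p2.
    elim: m => [|m IH]; first exact: (perm_compm1 her' muP').
    by rewrite -[kpow _ _ _]/(pcomp p2 (kpow muk p2 m)) IH p2p2.
  have enr : pcomp (res e) p2 = p2.
    have := congr1 (fun h => pcomp (res h) p2) en.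
    rewrite [res (e ∘ _)]res_comp [pw _ _]/(kpow muk (ext_hom p2) n) res_kpow ext_homK.
    have pwr m : pcomp (kpow muk p2 m) p2 = p2.
      by rewrite -(kpowSr her' muP') -[RHS](pw2 m).
    by rewrite -(perm_compA her' muP') pwr.
  have E : pcomp (res e) p2 = res e by rewrite ebr -(perm_compA her' muP') p2p2.
  by rewrite -[LHS]E.
pose P : ob (kar C) := @KarOb k C s e ee.
have jn : kar_natural (C := C') (P := kres_ob P) (Q := Y) j.
  change (pcomp j (res e) = pcomp p j); rewrite re /p2 !(perm_compA her' muP') j2.
  by rewrite (perm_comp1m her' muP').
exists P, (@kar_res k C' (kres_ob P) Y j).
by apply: kar_res_iso; [exact: jn | exists j'].
Qed.

Definition ss_eps : mor (one : ob (kar C')) (ss_functor one) :=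
  @kar_res k C' (kar_one C') (kres_ob (kar_one C)) res_one.

Definition ss_phi (P Q : ob SS) :
    mor (ss_functor P ⊗ ss_functor Q) (ss_functor (P ⊗ Q)) :=
  @kar_res k C' (kar_tens (kres_ob P) (kres_ob Q)) (kres_ob (kar_tens P Q))
    (res_tens (kob P) (kob Q)).

Lemma ss_phi_natural (P Q : ob (kar C)) :
  kar_natural (C := C') (P := (kres_ob P ⊗ kres_ob Q : ob (kar C'))) (Q := kres_ob (P ⊗ Q))
    (res_tens (kob P) (kob Q)).
Proof. exact: (res_tens_nat (kidem P) (kidem Q)). Qed.

Lemma ss_eps_natural :
  kar_natural (C := C') (P := (one : ob (kar C'))) (Q := kres_ob (one : ob (kar C))) res_one.
Proof.
change (pcomp res_one (perm_id k _) = pcomp (res (perm_id k (perm_one (F := F) I))) res_one).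
by rewrite res_id (perm_compm1 her' muP') (perm_comp1m her' muP').
Qed.

Lemma ss_fmap_res (P Q : ob SS) (n : perm_hom k (kob P) (kob Q)) :
  fmap ss_functor (ss_pi R (@kar_res k C P Q n) : mor P Q) =
  @kar_res k C' (kres_ob P) (kres_ob Q) (res n).
Proof. by apply: etrans (kres_repr _) _; exact: kres_res. Qed.

Lemma ss_functor_monoidal : symmetric_monoidal ss_eps ss_phi.
Proof.
have nat1 (P : ob (kar C')) := @kar_natural_idm k C' P.
split.
- apply: kar_res_iso ss_eps_natural _; exists (transpose res_one).
  exact: (delta_inverse her' muP' res_one_delta res_one_codelta).
- move=> P Q; apply: kar_res_iso (@ss_phi_natural P Q) _.
  exists (transpose (res_tens (kob P) (kob Q))).
  exact: (delta_inverse her' muP' (@res_tens_delta _ _) (@res_tens_codelta _ _)).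
- move=> P Q P' Q' f g.
  have E : fmap ss_functor (f ⊠ g) = kres (ss_repr f ⊠ ss_repr g) by exact: kres_repr.
  rewrite E.
  exact: (@kar_res_nat k C' (kar_tens (kres_ob P) (kres_ob Q)) (kres_ob (kar_tens P Q))
    (kar_tens (kres_ob P') (kres_ob Q')) (kres_ob (kar_tens P' Q')) _ _
    (kar_tensm (kres (ss_repr f)) (kres (ss_repr g))) (kres (kar_tensm (ss_repr f) (ss_repr g)))
    (@ss_phi_natural P Q) (@ss_phi_natural P' Q')
    (res_tens_nat (kval (ss_repr f)) (kval (ss_repr g)))).
- move=> P Q T.
  have E1 : fmap ss_functor (assoc P Q T) =
      @kar_res k C' (kres_ob (P ⊗ Q ⊗ T)) (kres_ob (P ⊗ (Q ⊗ T)))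
        (res (perm_assoc k (kob P) (kob Q) (kob T))).
    exact: (@ss_fmap_res (P ⊗ Q ⊗ T) (P ⊗ (Q ⊗ T))).
  have E2 := @kar_res_tensr k C' (kar_tens (kres_ob P) (kres_ob Q)) (kres_ob (kar_tens P Q))
    (kres_ob T) (res_tens (kob P) (kob Q)).
  have E3 := @kar_res_tensl k C' (kar_tens (kres_ob Q) (kres_ob T)) (kres_ob (kar_tens Q T))
    (kres_ob P) (res_tens (kob Q) (kob T)).
  apply: etrans (f_equal2 (fun a b => a ∘ ss_phi (P ⊗ Q) T ∘ b) E1 E2) _.
  apply: etrans (@kar_res_comp3 k C' _ _ _ _ _ _ _ (@ss_phi_natural (P ⊗ Q) T)
    (kar_natural_tens (@ss_phi_natural P Q) (nat1 (kres_ob T)))) _.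
  apply/esym.
  apply: etrans (congr1 (fun b => ss_phi P (Q ⊗ T) ∘ b ∘ assoc _ _ _) E3) _.
  apply: etrans (@kar_res_comp3 k C' _ _ _ _ _ _ _
    (kar_natural_tens (nat1 (kres_ob P)) (@ss_phi_natural Q T))
    (kar_assoc_nat (kres_ob P) (kres_ob Q) (kres_ob T))) _.
  apply/esym.
  exact: (congr1 (@kar_res k C' (kar_tens (kar_tens (kres_ob P) (kres_ob Q)) (kres_ob T))
    (kres_ob (kar_tens P (kar_tens Q T)))) (res_tens_assoc (kob P) (kob Q) (kob T))).
- move=> P.
  have E1 : fmap ss_functor (lunit P) =
      @kar_res k C' (kres_ob (one ⊗ P)) (kres_ob P) (res (perm_lunit k (F := F) I (kob P))).
    exact: (@ss_fmap_res (one ⊗ P) P).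
  have E2 := @kar_res_tensr k C' (kar_one C') (kres_ob (kar_one C)) (kres_ob P) res_one.
  apply: etrans (f_equal2 (fun a b => a ∘ ss_phi one P ∘ b) E1 E2) _.
  apply: etrans (@kar_res_comp3 k C' _ _ _ _ _ _ _ (@ss_phi_natural one P)
    (kar_natural_tens ss_eps_natural (nat1 (kres_ob P)))) _.
  exact: (congr1 (@kar_res k C' (kar_tens (kar_one C') (kres_ob P)) (kres_ob P))
    (res_tens_lunit (kob P))).
- move=> P.
  have E1 : fmap ss_functor (runit P) =
      @kar_res k C' (kres_ob (P ⊗ one)) (kres_ob P) (res (perm_runit k (F := F) I (kob P))).
    exact: (@ss_fmap_res (P ⊗ one) P).
  have E2 := @kar_res_tensl k C' (kar_one C') (kres_ob (kar_one C)) (kres_ob P) res_one.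
  apply: etrans (f_equal2 (fun a b => a ∘ ss_phi P one ∘ b) E1 E2) _.
  apply: etrans (@kar_res_comp3 k C' _ _ _ _ _ _ _ (@ss_phi_natural P one)
    (kar_natural_tens (nat1 (kres_ob P)) ss_eps_natural)) _.
  exact: (congr1 (@kar_res k C' (kar_tens (kres_ob P) (kar_one C')) (kres_ob P))
    (res_tens_runit (kob P))).
move=> P Q.
have E1 : fmap ss_functor (braid P Q) =
    @kar_res k C' (kres_ob (P ⊗ Q)) (kres_ob (Q ⊗ P)) (res (perm_braid k (kob P) (kob Q))).
  exact: (@ss_fmap_res (P ⊗ Q) (Q ⊗ P)).
apply: etrans (congr1 (fun a => a ∘ ss_phi P Q) E1) _.
apply: etrans (@kar_res_comp k C' (kar_tens (kres_ob P) (kres_ob Q)) (kres_ob (kar_tens P Q))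
  (kres_ob (kar_tens Q P)) (res (perm_braid k (kob P) (kob Q))) _ (@ss_phi_natural P Q)) _.
apply/esym.
apply: etrans (@kar_res_comp k C' (kar_tens (kres_ob P) (kres_ob Q))
  (kar_tens (kres_ob Q) (kres_ob P)) (kres_ob (kar_tens Q P)) (res_tens (kob Q) (kob P)) _
  (kar_braid_nat (kres_ob P) (kres_ob Q))) _.
apply/esym.
exact: (congr1 (@kar_res k C' (kar_tens (kres_ob P) (kres_ob Q)) (kres_ob (kar_tens Q P)))
  (res_tens_braid (kob P) (kob Q))).
Qed.

Theorem ss_equivalence : smc_equivalent SS (kar C').
Proof.
exists ss_functor; split; first exact: ss_functor_linear.
  by exists ss_eps, ss_phi; exact: ss_functor_monoidal.
apply: (fully_faithful_quasi_inverse (smcP (kar C'))).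
- exact: ss_functor_faithful.
- exact: ss_functor_full.
exact: ss_functor_surj.
Qed.
End Functor.
End Restriction.

Theorem theorem5p3 (k : fieldType) (mu : emb_function int)
    (hmu : is_measure all_perms mu) :
  let muk := scalar_measure k mu in
  exists (L : smc_laws (perm_data (F := all_perms) I muk))
         (L' : smc_laws (perm_data (support_empty hmu) muk)),
  let Perm := Smc L in
  let Perm' := Smc L' in
  [/\ pre_tannakian (kar Perm') /\ semisimple (kar Perm'),
      exists R : rigid Perm,
        forall (X : ob Perm) (f : mor X X), nilpotent_endo f -> tr R f = 0%R
    & exists R : rigid (kar Perm),
        smc_equivalent (semisimplification R) (kar Perm')].
Proof.
move=> muk; pose muP := scalar_is_measure k hmu.
exists (perm_laws I all_hereditary muP).
exists (perm_laws (support_empty hmu) (support_hereditary hmu)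
  (scalar_is_measure k (support_measure hmu))).
split; first exact: support_semisimple_pre_tannakian.
  exists (@perm_rigid k all_perms I muk all_hereditary muP) => X f [n fn].
  apply: etrans (perm_trace _ f) _.
  by rewrite (nilpotent_trace hmu (fn : kpow muk f n = 0)) scale0r.
exists (@kar_perm_rigid k all_perms I muk all_hereditary muP); exact: ss_equivalence.
Qed.
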